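(* Consider a passive LTV system $\dot x(t)=A(t)x(t)+B(t)u(t)$, $y(t)=C(t)x(t)+D(t)u(t)$ on $\mathbb T$, with $A\in L^1_{\mathrm{loc}}(\mathbb T,\mathbb C^{n,n})$, $B\in L^2_{\mathrm{loc}}(\mathbb T,\mathbb C^{n,m})$, $C\in L^2_{\mathrm{loc}}(\mathbb T,\mathbb C^{m,n})$, $D\in L^\infty_{\mathrm{loc}}(\mathbb T,\mathbb C^{m,m})$, and suppose that for every $t_0,t_1\in\mathbb T$, $t_0\le t_1$, there exists $c>0$ such that $D(t)+D(t)^{\mathrm H}\ge cI_m$ for a.e. $t\in[t_0,t_1]$. Then the Riccati differential equation $$A^{\mathrm H}Q+QA+\dot Q+(C^{\mathrm H}-QB)(D+D^{\mathrm H})^{-1}(C-B^{\mathrm H}Q)=0$$ has a solution $Q_a\in W^{1,1}_{\mathrm{loc}}(\mathbb T,\mathbf S^n_+(\mathbb C))$ which induces the available storage function $V_a$, i.e. $V_a(t,x)=\frac12x^{\mathrm H}Q_a(t)x$ for all $(t,x)\in\mathbb T\times\mathbb C^n$. In particular, $Q_a$ is a solution of the differential KYP inequality $$\begin{bmatrix}-A^{\mathrm H}Q_a-Q_aA-\dot Q_a& C^{\mathrm H}-Q_aB\\ C-B^{\mathrm H}Q_a& D+D^{\mathrm H}\end{bmatrix}(t)\ge 0\quad\text{for a.e. }t\in\mathbb T.$$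
   Context: $\mathbb T\subseteq\mathbb R$ is an open (possibly unbounded) interval. $M^{\mathrm H}$ is the conjugate transpose; $\mathbf S^n_+(\mathbb C)$ is the set of Hermitian positive semidefinite $n\times n$ matrices, and $\ge$ is the Loewner order on Hermitian matrices. Solutions of the Riccati equation satisfy it a.e. on $\mathbb T$; $W^{1,1}_{\mathrm{loc}}$ functions are identified with their continuous representatives. A state-input-output solution is a triple $(x,u,y)$ with $x\in W^{1,1}_{\mathrm{loc}}(\mathbb T,\mathbb C^n)$, $u,y\in L^2_{\mathrm{loc}}(\mathbb T,\mathbb C^m)$ satisfying the system equations a.e. on $\mathbb T$. The system is passive if there is a storage function, i.e. a map $V:\mathbb T\times\mathbb C^n\to[0,\infty)$ with $V(t,0)=0$ for all $t\in\mathbb T$ and $V(t_1,x(t_1))-V(t_0,x(t_0))\le\int_{t_0}^{t_1}\mathrm{Re}(y(t)^{\mathrm H}u(t))\,\mathrm dt$ for all $t_0\le t_1$ in $\mathbb T$ and all state-input-output solutions $(x,u,y)$. Available storage: $V_a(t_0,x_0)=\sup\big(-\int_{t_0}^{t_1}\mathrm{Re}(y(t)^{\mathrm H}u(t))\,\mathrm dt\big)\in[0,+\infty]$, where the supremum is over all $t_1\in\mathbb T$, $t_1\ge t_0$, and all inputs $u\in L^2_{\mathrm{loc}}(\mathbb T,\mathbb C^m)$, with $(x,y)$ the state and output uniquely determined by $u$ and $x(t_0)=x_0$. *)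

(* Defs.v *)
From HB Require Import structures.
From mathcomp Require Import all_boot all_order all_algebra.
From mathcomp Require Import all_classical all_reals all_analysis.
From mathcomp Require Import complex.

Set Implicit Arguments.
Unset Strict Implicit.
Unset Printing Implicit Defensive.

Import Order.TTheory GRing.Theory Num.Theory.
Import numFieldNormedType.Exports.

Local Open Scope classical_set_scope.
Local Open Scope ring_scope.
Local Open Scope complex_scope.
Local Open Scope sesquilinear_scope.

(* Everywhere below, functions of time are total functions on R of which only
   the values on the open interval T matter, [complex.Re] and [complex.Im] are
   the R-valued real and imaginary parts, and [M ^t*] is the conjugate
   transpose. *)

Section FunctionSpaces.
Context {R : realType}.
Local Notation mu := (@lebesgue_measure R).
Implicit Types (T : set R) (f g : R -> R) (p : \bar R).

Definition Lploc p T f :=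
  measurable_fun T f /\
  forall K, K `<=` T -> compact K -> finite_norm mu p (f \_ K).

(* In dimension one, compactly supported C^1 functions may be used as test
   functions in the definition of W^{1,1} (Brezis, Functional Analysis, Sobolev
   Spaces and Partial Differential Equations, Section 8.2). *)
Definition test_fun T (phi : R -> R) :=
  [/\ forall t, derivable phi t 1,
      continuous (derive1 phi)
    & exists K, [/\ compact K, K `<=` T & forall t, ~ K t -> phi t = 0]].

(* f is the continuous representative of an element of W^{1,1}_loc(T), and its
   weak derivative is (the class of) df. *)
Definition W11loc_deriv T f df :=
  [/\ {within T, continuous f}, Lploc 1 T f, Lploc 1 T df
    & forall phi, test_fun T phi ->
        (\int[mu]_(t in T) (f t * derive1 phi t) =
         - \int[mu]_(t in T) (df t * phi t))%R].

Section Matrices.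
Variables k l : nat.
Implicit Types M dM : R -> 'M[R[i]]_(k, l).

Definition Lploc_mx p T M := forall i j,
  Lploc p T (fun t => complex.Re (M t i j)) /\
  Lploc p T (fun t => complex.Im (M t i j)).

Definition W11loc_deriv_mx T M dM := forall i j,
  W11loc_deriv T (fun t => complex.Re (M t i j))
                 (fun t => complex.Re (dM t i j)) /\
  W11loc_deriv T (fun t => complex.Im (M t i j))
                 (fun t => complex.Im (dM t i j)).

Definition W11loc_mx T M := exists dM, W11loc_deriv_mx T M dM.

End Matrices.
End FunctionSpaces.

Section Loewner.
Context {R : realType} {k : nat}.
Implicit Types M N : 'M[R[i]]_k.

(* On R[i], [0 <= z] means that z is real and nonnegative. *)
Definition psd M :=
  M \is hermsymmx /\ forall x : 'cV[R[i]]_k, 0 <= (x ^t* *m M *m x) 0 0.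

Definition loewner_ge M N := psd (M - N).

End Loewner.

Section LTV.
Context {R : realType} {n m : nat}.
Local Notation mu := (@lebesgue_measure R).
Variable T : set R.
Variables (A : R -> 'M[R[i]]_(n, n)) (B : R -> 'M[R[i]]_(n, m)).
Variables (C : R -> 'M[R[i]]_(m, n)) (D : R -> 'M[R[i]]_(m, m)).

Definition sio_solution (x : R -> 'cV[R[i]]_n) (u y : R -> 'cV[R[i]]_m) :=
  [/\ Lploc_mx 2%:E T u, Lploc_mx 2%:E T y
    & exists dx, W11loc_deriv_mx T x dx /\
        {ae mu, forall t, T t ->
           dx t = A t *m x t + B t *m u t /\ y t = C t *m x t + D t *m u t}].

Definition supply (u y : R -> 'cV[R[i]]_m) (t0 t1 : R) : R :=
  (\int[mu]_(t in `[t0, t1]) complex.Re (((y t) ^t* *m u t) 0 0))%R.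

Definition storage_function (V : R -> 'cV[R[i]]_n -> R) :=
  [/\ forall t x, T t -> 0 <= V t x,
      forall t, T t -> V t 0 = 0
    & forall x u y, sio_solution x u y ->
      forall t0 t1, T t0 -> T t1 -> t0 <= t1 ->
        V t1 (x t1) - V t0 (x t0) <= supply u y t0 t1].

Definition passive := exists V, storage_function V.

Definition available_storage (t0 : R) (x0 : 'cV[R[i]]_n) : \bar R :=
  ereal_sup [set v | exists t1 x u y,
    [/\ T t1, t0 <= t1, sio_solution x u y, x t0 = x0
      & v = (- supply u y t0 t1)%:E]].

Definition riccati_solution (Q : R -> 'M[R[i]]_n) :=
  exists dQ, W11loc_deriv_mx T Q dQ /\
    {ae mu, forall t, T t ->
       (A t) ^t* *m Q t + Q t *m A t + dQ t
       + ((C t) ^t* - Q t *m B t) *m invmx (D t + (D t) ^t*)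
         *m (C t - (B t) ^t* *m Q t) = 0}.

Definition kyp_solution (Q : R -> 'M[R[i]]_n) :=
  exists dQ, W11loc_deriv_mx T Q dQ /\
    {ae mu, forall t, T t ->
       loewner_ge
         (block_mx (- ((A t) ^t* *m Q t) - Q t *m A t - dQ t)
                   ((C t) ^t* - Q t *m B t)
                   (C t - (B t) ^t* *m Q t)
                   (D t + (D t) ^t*))
         0}.

End LTV.

(* Main.v *)
(* A trajectory and its costate (x, p) solve a linear Hamiltonian system
   x' = F x + G p, p' = - S x - F^H p, with the input u recovered from
   (D + D^H) u = - (C x - B^H p).  Along such a trajectory the bilinear supply
   against any other trajectory (z, w, v) is the exact derivative of Re (z^H p);
   for the horizon [t, b] this makes the solution with p(b) = 0 optimal.  If
   (X, P) is the matrix solution with X(b) = 1 and P(b) = 0, then X(s) is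
   invertible for s <= b: X(s) v = 0 with P(s) v <> 0 would allow the extraction
   of arbitrarily much supply at time s, against the bound by a storage function.
   Hence Q_b = P X^-1 induces the available storage with horizon b.  The Q_b
   increase with b and are bounded by the storage function, so they converge to
   some Qa as b tends to sup T.  For fixed b the relation between Q_b'(b) and
   Q_b'(t), t <= b <= b', given by the Hamiltonian flow is algebraic, hence passes
   to the limit b' -> sup T, and shows Qa = L U^-1 for a Hamiltonian solution
   (U, L).  Differentiating L U^-1 gives the Riccati equation. *)

Require Import Defs.
From HB Require Import structures.
From mathcomp Require Import all_boot all_order all_algebra.
From mathcomp Require Import all_classical all_reals all_analysis.
From mathcomp Require Import complex.
From mathcomp Require Import measurable_realfun ess_sup_inf.
From mathcomp Require Import ring lra zify.

Set Implicit Arguments.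
Unset Strict Implicit.
Unset Printing Implicit Defensive.

Import Order.TTheory GRing.Theory Num.Theory.
Import numFieldNormedType.Exports.

Local Open Scope classical_set_scope.
Local Open Scope ring_scope.
Local Open Scope complex_scope.
Local Open Scope sesquilinear_scope.

(** * Primitives of locally integrable functions *)

Section RealPrimitives.
Context {R : realType}.
Local Notation mu := (@lebesgue_measure R).
Implicit Types (a b c s t : R) (f g h df dg : R -> R).

(** Two obstacles shape the proof. The coefficients are merely integrable and derivatives are weak,
    so all calculus is done on the integral form [rprim], into which weak derivatives are translated
    once in each direction; the product rule, linear equations and inverses are rebuilt for that
    form.

    The second obstacle is that the supply is an indefinite quadratic functional: stationarity of a
    Hamiltonian trajectory does not by itself make it optimal. Passivity takes the place of
    convexity. The difference d of two trajectories with the same initial state starts at 0, so its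
    supply is at least V(t, d(t)), and this dominates half the quadratic form of Q_b at d(t); that
    is exactly the second-order term needed to complete the square. The storage function is only
    evaluated along trajectories, so nothing about its shape or regularity enters.

    Finite horizons are used because the supremum over all horizons need not be attained; p(b) = 0
    is the transversality condition for a free final state. Quadratic forms are compared with twice
    the supply, whence the factor 1/2 in the available storage. *)

Definition L1 a b f := mu.-integrable `[a, b] (EFin \o f).

(** Absolute continuity in integral form. No pointwise derivative is ever taken, and [df] matters
    only up to a null set. *)
Definition rprim a b f df := L1 a b df /\
  forall s t, a <= s -> s <= t -> t <= b ->
    f t - f s = \int[mu]_(x in `[s, t]) df x.

Lemma sub_itvcc a b s t : a <= s -> t <= b -> `[s, t] `<=` `[a, b].
Proof. by move=> as_ tb; apply: subset_itvScc; rewrite bnd_simp. Qed.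

Lemma L1_sub a b s t f : a <= s -> t <= b -> L1 a b f -> L1 s t f.
Proof. by move=> as_ tb; apply: integrableS => //; exact: sub_itvcc. Qed.

Lemma L1_meas a b f : L1 a b f -> measurable_fun `[a, b] f.
Proof. by move=> /integrableP[/measurable_EFinP]. Qed.

Lemma L1D a b f g : L1 a b f -> L1 a b g -> L1 a b (fun t => f t + g t).
Proof. move=> lf lg; exact: (integrableD _ lf lg). Qed.

Lemma L1Z a b k f : L1 a b f -> L1 a b (fun t => k * f t).
Proof. move=> lf; exact: (integrableZl _ k lf). Qed.

Lemma L1_norm a b f : L1 a b f -> L1 a b (fun t => `|f t|).
Proof. exact: integrable_norm. Qed.

Lemma L1_dom a b f g : measurable_fun `[a, b] f -> L1 a b g ->
  (forall t, a <= t <= b -> `|f t| <= g t) -> L1 a b f.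
Proof.
move=> mf lg fg; apply: le_integrable lg => //; first exact/measurable_EFinP.
move=> t /=; rewrite in_itv /= => tab; rewrite lee_fin.
by rewrite (le_trans (fg _ tab)) // ler_norm.
Qed.

Lemma Rint_split a b s t f : L1 a b f -> a <= s -> s <= t -> t <= b ->
  \int[mu]_(x in `[a, t]) f x =
  \int[mu]_(x in `[a, s]) f x + \int[mu]_(x in `[s, t]) f x.
Proof.
move=> lf as_ st tb; have lf' : L1 a t f by apply: L1_sub lf.
have := @Rintegral_itvB R f (BLeft a) (BRight t) s lf'.
rewrite !bnd_simp => /(_ as_ st) E.
rewrite -(@Rintegral_itv_obnd_cbnd R s); first by rewrite -E; ring.
apply: integrableS lf => //; apply: subset_trans (sub_itvcc as_ tb).
exact: subset_itv_oc_cc.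
Qed.

Lemma rprim_sub a b s t f df : a <= s -> t <= b ->
  rprim a b f df -> rprim s t f df.
Proof.
move=> as_ tb [ldf fdf]; split; first exact: L1_sub ldf.
by move=> u v su uv vt; apply: fdf => //; lra.
Qed.

(* Replaces differentiation almost everywhere in the proof of the product rule. *)
Lemma cst_of_small_increments a b (e L : R -> R) : a <= b ->
  (forall eps, 0 < eps -> forall t, a <= t <= b -> exists2 d : R, 0 < d &
     forall u v, a <= u -> u <= v -> v <= b -> `|u - t| < d -> `|v - t| < d ->
       `|e v - e u| <= eps * (L v - L u)) ->
  e b = e a.
Proof.
move=> ab small; apply/eqP; rewrite -subr_eq0 -normr_le0; apply/ler_addgt0Pl.
suff key eps : 0 < eps -> `|e b - e a| <= eps * (L b - L a).
  move=> eps eps0; have [Lab|Lab] := lerP (L b - L a) 0.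
    have := key _ ltr01; rewrite mul1r => /le_trans; apply.
    by rewrite addr0 (le_trans Lab) // ltW.
  have := key (eps / (L b - L a)) (divr_gt0 eps0 Lab).
  by rewrite divfK ?gt_eqF // addr0.
move=> eps0.
(* Induction along the real line: the supremum of [S] belongs to [S], and it could be exceeded if it
   were less than [b]. *)
pose S := [set t | a <= t <= b /\ `|e t - e a| <= eps * (L t - L a)].
have Sa : S a by split; rewrite ?lexx ?ab // !subrr normr0 mulr0.
have hS : has_sup S by split; [exists a | exists b => t [/andP[]]].
have [s sE] : { s | s = sup S } by exists (sup S).
have as_ : a <= s by rewrite sE; apply: ub_le_sup => //; case: hS.
have sb : s <= b by rewrite sE; apply: ge_sup; [exists a | move=> t [/andP[]]].
have sab : a <= s <= b by rewrite as_ sb.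
have [d d0 hd] := small _ eps0 s sab.
have [t St] := sup_adherent d0 hS; rewrite -sE => st.
have ts : t <= s by rewrite sE; apply: ub_le_sup => //; case: hS.
have [/andP[at_ tb] et] := St.
have ext v : s <= v -> v <= b -> v < s + d -> S v.
  move=> sv vb vd; split; first by rewrite vb (le_trans as_).
  have td : `|t - s| < d by rewrite ltr_distl; apply/andP; split; lra.
  have vd' : `|v - s| < d by rewrite ltr_distl; apply/andP; split; lra.
  have := hd t v at_ (le_trans ts sv) vb td vd'.
  have := ler_normD (e v - e t) (e t - e a).
  rewrite (_ : e v - e t + (e t - e a) = e v - e a); last by ring.
  move=> h1 h2; apply: (le_trans h1); apply: le_trans (lerD h2 et) _.
  by rewrite -mulrDr; apply: ler_wpM2l; [exact: ltW | lra].
have [sb'|sb'] := ltrP s b; last first.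
  have [] := ext b => //; first by lra.
pose v := Num.min b (s + d / 2).
have sv : s < v by rewrite lt_min sb' /=; lra.
have vb : v <= b by rewrite ge_min lexx.
have vd : v < s + d by rewrite gt_min; apply/orP; right; lra.
have : v <= s by rewrite sE; apply: ub_le_sup; [case: hS | exact: ext (ltW sv) vb vd].
by rewrite leNgt sv.
Qed.

Lemma rprim_cont a b f df : rprim a b f df -> {within `[a, b], continuous f}.
Proof.
move=> [ldf fdf]; have [ab|ba] := lerP a b; last first.
  by rewrite set_itv_ge ?bnd_simp -?ltNge //; exact: continuous_subspace0.
pose F x := f a + parameterized_integral mu a x df.
have cF : {within `[a, b], continuous F}.
  move=> x; apply: cvgD; first exact: cvg_cst.
  exact: parameterized_integral_continuous ldf x.
apply: subspace_eq_continuous cF => x; rewrite inE /= in_itv /= => /andP[ax xb].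
by rewrite /F /parameterized_integral /from_subspace -(fdf a x) //; ring.
Qed.

Lemma within_cont_eps a b f eps t : {within `[a, b], continuous f} ->
  0 < eps -> a <= t <= b -> exists2 d : R, 0 < d &
    forall u, a <= u <= b -> `|u - t| < d -> `|f u - f t| <= eps.
Proof.
move=> /subspace_continuousP cf e0 tab.
have /cvgrPdist_le /(_ _ e0) := cf t ltac:(by rewrite /= in_itv).
move=> /nbhs_ballP[d /= d0 hd]; exists d => // u uab ud.
rewrite distrC; apply: hd; last by rewrite /= in_itv.
by rewrite /ball /= distrC.
Qed.

Lemma rprim_eps a b f df eps t : rprim a b f df ->
  0 < eps -> a <= t <= b -> exists2 d : R, 0 < d &
    forall u v, a <= u <= b -> a <= v <= b ->
      `|u - t| < d -> `|v - t| < d -> `|f u - f v| <= eps.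
Proof.
move=> /rprim_cont cf e0 tab.
have e2 : 0 < eps / 2 by lra.
have [d d0 hd] := within_cont_eps cf e2 tab.
exists d => // u v uab vab ud vd.
rewrite (_ : f u - f v = (f u - f t) - (f v - f t)); last by ring.
by rewrite (le_trans (ler_normB _ _)) // [leRHS]splitr lerD ?hd.
Qed.

Lemma rprim_bounded a b f df : rprim a b f df -> 
  exists2 M, 0 <= M & forall t, a <= t <= b -> `|f t| <= M.
Proof.
move=> [ldf fdf]; exists (`|f a| + \int[mu]_(x in `[a, b]) `|df x|).
  by rewrite addr_ge0 // Rintegral_ge0.
move=> t /andP[at_ tb]; have lat : L1 a t df by apply: L1_sub ldf.
rewrite (_ : f t = f a + (f t - f a)); last by ring.
rewrite fdf // (le_trans (ler_normD _ _)) // lerD2l.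
rewrite (le_trans (le_normr_Rintegral _ lat)) //.
rewrite (Rint_split (L1_norm ldf) at_ tb (lexx b)) lerDl Rintegral_ge0 //.
Qed.

Lemma L1M_bounded a b f g M : measurable_fun `[a, b] f ->
  (forall t, a <= t <= b -> `|f t| <= M) -> L1 a b g ->
  L1 a b (fun t => f t * g t).
Proof.
move=> mf fM lg; have lMg := L1Z M (L1_norm lg).
apply: L1_dom lMg _; first by apply: measurable_funM => //; exact: L1_meas.
by move=> t tab; rewrite normrM ler_wpM2r // fM.
Qed.

Lemma rprim_meas a b f df : rprim a b f df -> measurable_fun `[a, b] f.
Proof.
by move=> /rprim_cont; apply: subspace_continuous_measurable_fun.
Qed.

Lemma L1M_rprim a b f df g : rprim a b f df -> L1 a b g ->
  L1 a b (fun t => f t * g t).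
Proof.
move=> pf lg; have [M _ fM] := rprim_bounded pf.
exact: L1M_bounded (rprim_meas pf) fM lg.
Qed.

Lemma rprimD a b f df g dg : rprim a b f df -> rprim a b g dg ->
  rprim a b (fun t => f t + g t) (fun t => df t + dg t).
Proof.
move=> [lf pf] [lg pg]; split; first exact: L1D.
move=> s t as_ st tb; rewrite RintegralD //; try exact: (L1_sub as_ tb).
by rewrite -pf // -pg //; ring.
Qed.

Lemma rprimZ a b k f df : rprim a b f df ->
  rprim a b (fun t => k * f t) (fun t => k * df t).
Proof.
move=> [lf pf]; split; first exact: L1Z.
move=> s t as_ st tb; rewrite RintegralZl //; try exact: (L1_sub as_ tb).
by rewrite -pf //; ring.
Qed.

Lemma rprim_cst a b k : rprim a b (fun=> k) (fun=> 0).
Proof.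
have E0 : EFin \o (fun=> 0 : R) = cst 0%E by [].
split; first by rewrite /L1 E0; exact: integrable0.
by move=> s t _ _ _; rewrite subrr /Rintegral integral0.
Qed.

Lemma L1_cst a b k : L1 a b (fun=> k).
Proof.
apply: measurable_bounded_integrable => //.
  by rewrite /= lebesgue_measure_itv /=; case: ifP => //; rewrite -EFinD ltry.
by exists `|k|; split => // y ky t _; exact: ltW.
Qed.

(* The defect [e] of the product rule has the increments
   [int (f v - f) dg + int (g u - g) df] between [u] and [v]. *)
Lemma rprimM a b f df g dg : rprim a b f df -> rprim a b g dg ->
  rprim a b (fun t => f t * g t) (fun t => f t * dg t + g t * df t).
Proof.
move=> pf pg; have [lf If] := pf; have [lg Ig] := pg.
have lh : L1 a b (fun t => f t * dg t + g t * df t).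
  by apply: L1D; [exact: L1M_rprim pf lg | exact: L1M_rprim pg lf].
split=> // s t as_ st tb.
pose h x := f x * dg x + g x * df x.
pose e x := f x * g x - \int[mu]_(y in `[s, x]) h y.
(* The control for the increments of [e]: near any point [f] and [g] oscillate by at most eps, so
   the defect grows at most eps times as fast as [L]. *)
pose L x := \int[mu]_(y in `[s, x]) (`|df y| + `|dg y|).
have lL : L1 a b (fun y => `|df y| + `|dg y|) by apply: L1D; exact: L1_norm.
suff : e t = e s.
  rewrite /e set_itv1 Rintegral_set1 subr0 => <-; ring.
apply: (cst_of_small_increments (L := L)) => // eps e0 x /andP[sx xt].
have xab : a <= x <= b by apply/andP; split; lra.
have [d1 d10 h1] := rprim_eps pf e0 xab.
have [d2 d20 h2] := rprim_eps pg e0 xab.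
exists (Num.min d1 d2); first by rewrite lt_min d10.
move=> u v su uv vt; rewrite !lt_min => /andP[u1 u2] /andP[v1 v2].
have inab y : u <= y -> y <= v -> a <= y <= b by move=> ? ?; apply/andP; split; lra.
have [au vb] : a <= u /\ v <= b by split; lra.
have Lst k : L1 a b k -> L1 s t k by apply: L1_sub.
have Luv k : L1 a b k -> L1 u v k by apply: L1_sub.
rewrite /e /L (Rint_split (Lst _ lh) su uv vt) (Rint_split (Lst _ lL) su uv vt).
rewrite [X in eps * X]addrC addKr.
have -> : f v * g v - (\int[mu]_(x0 in `[s, u]) h x0 + \int[mu]_(x0 in `[u, v]) h x0)
   - (f u * g u - \int[mu]_(x0 in `[s, u]) h x0) =
   \int[mu]_(y in `[u, v]) ((f v - f y) * dg y + (g u - g y) * df y).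
  transitivity (\int[mu]_(y in `[u, v]) (f v * dg y + g u * df y - h y)).
    rewrite (RintegralB _ _ (Luv _ lh)) //; last first.
      by apply: L1D; apply: L1Z; exact: Luv.
    rewrite (_ : \int[mu]_(y in `[u, v]) (f v * dg y + g u * df y) =
       f v * (g v - g u) + g u * (f v - f u)); first by ring.
    rewrite Ig // If // -!RintegralZl //; try exact: Luv.
    by rewrite -RintegralD //; apply: L1Z; exact: Luv.
  by apply: eq_Rintegral => y _; rewrite /h; ring.
have lI : L1 u v (fun y => (f v - f y) * dg y + (g u - g y) * df y).
  have -> : (fun y => (f v - f y) * dg y + (g u - g y) * df y) =
         (fun y => (f v * dg y + g u * df y) + (-1) * h y).
    by apply/funext => y; rewrite /h; ring.
  by apply: L1D; [apply: L1D; apply: L1Z | apply: L1Z]; exact: Luv.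
rewrite (le_trans (le_normr_Rintegral _ lI)) //.
rewrite -RintegralZl //; last exact: Luv.
apply: le_Rintegral => //; [exact: L1_norm | exact/L1Z/Luv |].
move=> y; rewrite /= in_itv /= => /andP[uy yv].
have yd d : `|u - x| < d -> `|v - x| < d -> `|y - x| < d.
  by rewrite !ltr_distl => /andP[? ?] /andP[? ?]; apply/andP; split; lra.
rewrite mulrDr [leRHS]addrC (le_trans (ler_normD _ _)) // !normrM.
by rewrite lerD // ler_wpM2r // ?h1 ?h2 ?inab // yd.
Qed.

End RealPrimitives.

(** * Local Lebesgue spaces of complex matrix functions *)

(** The three exponents of the data: 1 for [A], 2 for [B] and [C], infinity for [D]. The product
    exponent [lmul] is meaningful only for the pairs accepted by [lok]. *)
Inductive lexp := E1 | E2 | Eoo.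

Definition lmul p q := match p, q with Eoo, _ => q | _, Eoo => p | _, _ => E1 end.

(* The pairs of exponents for which the product of two locally p- and
   q-integrable functions is locally (lmul p q)-integrable. *)
Definition lok p q := match p, q with
  | Eoo, _ | _, Eoo | E2, E2 => true | _, _ => false end.

Section Lp.
Context {R : realType}.
Local Notation mu := (@lebesgue_measure R).
Implicit Types (a b c s t : R) (f g h df dg : R -> R).

Definition Lp p a b f := measurable_fun `[a, b] f /\ match p with
  | E1 => L1 a b f
  | E2 => L1 a b (fun t => f t ^+ 2)
  | Eoo => exists M : R, {ae mu, forall t, `[a, b]%classic t -> `|f t| <= M}
  end.

Lemma aeS (P Q : R -> Prop) : (forall x, P x -> Q x) ->
  {ae mu, forall x, P x} -> {ae mu, forall x, Q x}.
Proof. exact: (@filterS _ _ (ae_filter_ringOfSetsType mu) P Q). Qed.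

Lemma aeS2 (P Q S : R -> Prop) : (forall x, P x -> Q x -> S x) ->
  {ae mu, forall x, P x} -> {ae mu, forall x, Q x} -> {ae mu, forall x, S x}.
Proof. exact: (@filterS2 _ _ (ae_filter_ringOfSetsType mu)). Qed.

Lemma L1_Lp a b f : L1 a b f -> Lp E1 a b f.
Proof. by move=> lf; split => //; exact: L1_meas. Qed.

Lemma Rintegral_eq0 s t f : (forall x, f x = 0) ->
  \int[mu]_(x in `[s, t]) f x = 0.
Proof. by move=> f0; rewrite /Rintegral integral0_eq // => x _; rewrite f0. Qed.

Lemma L1_dom_ae a b f g : measurable_fun `[a, b] f -> L1 a b g ->
  {ae mu, forall t, `[a, b]%classic t -> `|f t| <= `|g t|} -> L1 a b f.
Proof.
move=> mf lg fg; apply/integrableP; split; first exact/measurable_EFinP.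
have /integrableP[mg ig] := lg.
apply: le_lt_trans ig; apply: ae_ge0_le_integral => //.
- by do 2 apply: measurableT_comp => //.
- by apply: measurableT_comp.
Qed.

Lemma LpZ p a b k f : Lp p a b f -> Lp p a b (fun t => k * f t).
Proof.
move=> [mf lf]; split; first by apply: measurable_funM.
case: p lf => [|| [M fM]]; first exact: L1Z.
  under [X in _ -> L1 _ _ X]eq_fun do rewrite exprMn.
  exact: L1Z.
exists (`|k| * M); apply: aeS fM => t + tab => /(_ tab) ?.
by rewrite normrM ler_wpM2l.
Qed.

Lemma L1_mul22 a b f g : Lp E2 a b f -> Lp E2 a b g ->
  L1 a b (fun t => f t * g t).
Proof.
move=> [mf lf] [mg lg]; apply: (L1_dom _ (L1D lf lg)).
  exact: measurable_funM.
move=> t _; rewrite normrM -(real_normK (num_real (f t))).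
rewrite -(real_normK (num_real (g t))).
have := normr_ge0 (f t); have := normr_ge0 (g t); nra.
Qed.

Lemma LpD p a b f g : Lp p a b f -> Lp p a b g -> Lp p a b (fun t => f t + g t).
Proof.
move=> lf lg; have [mf lf'] := lf; have [mg lg'] := lg.
split; first by apply: measurable_funD.
case: p lf lf' lg lg' => [lf lf' lg lg' | lf lf' lg lg' | _ [M fM] _ [N gN]].
- exact: L1D.
- under [X in L1 _ _ X]eq_fun do rewrite sqrrD.
  by apply: L1D => //; apply: L1D => //; apply: L1D; exact: L1_mul22.
- exists (M + N); apply: aeS2 fM gN => t ft gt tab.
  by rewrite (le_trans (ler_normD _ _)) // lerD ?ft ?gt.
Qed.

Lemma LpMC p q a b f g : Lp (lmul p q) a b (fun t => f t * g t) ->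
  Lp (lmul q p) a b (fun t => g t * f t).
Proof.
rewrite (_ : lmul q p = lmul p q); last by case: p; case: q.
by under [X in _ -> Lp _ _ _ X]eq_fun do rewrite mulrC.
Qed.

Lemma LpMoo q a b f g : Lp Eoo a b f -> Lp q a b g ->
  Lp q a b (fun t => f t * g t).
Proof.
move=> [mf [M fM]] [mg lg]; split; first by apply: measurable_funM.
case: q lg => [lg | lg | [N gN]].
- apply: (L1_dom_ae (g := fun t => `|M| * g t)); first by apply: measurable_funM.
    exact: L1Z.
  apply: aeS fM => t + tab => /(_ tab) ft.
  by rewrite !normrM normr_id ler_wpM2r // (le_trans ft) // ler_norm.
- apply: (L1_dom_ae (g := fun t => M ^+ 2 * g t ^+ 2)).
  + by apply: measurable_funX; apply: measurable_funM.
  + exact: L1Z.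
  apply: aeS fM => t + tab => /(_ tab) ft.
  have fM' : `|f t| <= `|M| by rewrite (le_trans ft) // ler_norm.
  rewrite !(exprMn, normrM, normrX) mulrACA ler_wpM2r ?mulr_ge0 //.
  by rewrite ler_pM.
- exists (M * N); apply: aeS2 fM gN => t ft gt tab.
  by rewrite normrM ler_pM ?ft ?gt.
Qed.

Lemma LpM p q a b f g : lok p q -> Lp p a b f -> Lp q a b g ->
  Lp (lmul p q) a b (fun t => f t * g t).
Proof.
case: p q => [] [] // _ lf lg; try exact: LpMoo; try exact/LpMC/LpMoo.
by split; [case: lf => [mf _]; case: lg => [mg _]; exact: measurable_funM
          | exact: L1_mul22].
Qed.

Lemma Lp_cst p a b k : Lp p a b (fun=> k).
Proof.
split => //; case: p; [exact: L1_cst | exact: L1_cst |].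
by exists `|k|; apply: aeW.
Qed.

Lemma Lp_oo p a b f : Lp Eoo a b f -> Lp p a b f.
Proof.
move=> lf; have := LpMoo lf (Lp_cst p a b 1).
by under [X in Lp _ _ _ X -> _]eq_fun do rewrite mulr1.
Qed.

Lemma rprim_Loo a b f df : rprim a b f df -> Lp Eoo a b f.
Proof.
move=> pf; split; first exact: rprim_meas pf.
have [M _ fM] := rprim_bounded pf.
by exists M; apply: aeW => t /=; rewrite in_itv; exact: fM.
Qed.

(** Serves to replace a derivative by an expression that agrees with it only where the system
    equations hold and [D + D^H] is invertible. *)
Lemma rprim_ae a b f df dg : rprim a b f df -> measurable_fun `[a, b] dg ->
  {ae mu, forall t, `[a, b]%classic t -> df t = dg t} -> rprim a b f dg.
Proof.
move=> [lf If] mg fg.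
have lg : L1 a b dg.
  apply: L1_dom_ae lf _ => //.
  by apply: aeS fg => t + tab => /(_ tab) ->.
split => // s t as_ st tb; rewrite If // /Rintegral; congr fine.
apply: ae_eq_integral => //.
- by have /integrableP[] := L1_sub as_ tb lf.
- by have /integrableP[] := L1_sub as_ tb lg.
- by apply: aeS fg => x /= + xst => ->//; exact: sub_itvcc xst.
Qed.

End Lp.

Section ComplexParts.
Context {R : realType}.
Implicit Types x y : R[i].

Lemma cReD x y : complex.Re (x + y) = complex.Re x + complex.Re y.
Proof. by case: x; case: y. Qed.
Lemma cImD x y : complex.Im (x + y) = complex.Im x + complex.Im y.
Proof. by case: x; case: y. Qed.
Lemma cReN x : complex.Re (- x) = - complex.Re x.
Proof. by case: x. Qed.
Lemma cReM x y :
  complex.Re (x * y) = complex.Re x * complex.Re y - complex.Im x * complex.Im y.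
Proof. by case: x; case: y. Qed.
Lemma cImM x y :
  complex.Im (x * y) = complex.Re x * complex.Im y + complex.Im x * complex.Re y.
Proof. by case: x; case: y. Qed.
Lemma cReJ x : complex.Re (Num.conj x) = complex.Re x.
Proof. by case: x. Qed.
Lemma cImJ x : complex.Im (Num.conj x) = - complex.Im x.
Proof. by case: x. Qed.
Lemma complexP x y : complex.Re x = complex.Re y ->
  complex.Im x = complex.Im y -> x = y.
Proof. by case: x; case: y => ? ? ? ? /= -> ->. Qed.

End ComplexParts.

Section ComplexFunctions.
Context {R : realType}.
Local Notation mu := (@lebesgue_measure R).
Implicit Types (a b s t : R) (f g df dg : R -> R[i]).

Definition cLp p a b f :=
  Lp p a b (fun t => complex.Re (f t)) /\ Lp p a b (fun t => complex.Im (f t)).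

Definition cprim a b f df :=
  rprim a b (fun t => complex.Re (f t)) (fun t => complex.Re (df t)) /\
  rprim a b (fun t => complex.Im (f t)) (fun t => complex.Im (df t)).

Lemma Lp_eq p a b (f g : R -> R) : (forall t, f t = g t) -> Lp p a b f -> Lp p a b g.
Proof. by move=> /funext ->. Qed.

Lemma rprim_eq a b (f g df dg : R -> R) : (forall t, f t = g t) ->
  (forall t, df t = dg t) -> rprim a b f df -> rprim a b g dg.
Proof. by move=> /funext -> /funext ->. Qed.

Lemma cLpD p a b f g : cLp p a b f -> cLp p a b g -> cLp p a b (fun t => f t + g t).
Proof.
move=> [f1 f2] [g1 g2]; split.
  by apply: Lp_eq (LpD f1 g1) => t; rewrite cReD.
by apply: Lp_eq (LpD f2 g2) => t; rewrite cImD.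
Qed.

Lemma cLp_cst p a b k : cLp p a b (fun=> k).
Proof. by split; exact: Lp_cst. Qed.

Lemma cLpM p q a b f g : lok p q -> cLp p a b f -> cLp q a b g ->
  cLp (lmul p q) a b (fun t => f t * g t).
Proof.
move=> pq [f1 f2] [g1 g2]; split.
  apply: Lp_eq (LpD (LpM pq f1 g1) (LpZ (-1) (LpM pq f2 g2))) => t.
  by rewrite cReM mulN1r.
by apply: Lp_eq (LpD (LpM pq f1 g2) (LpM pq f2 g1)) => t; rewrite cImM.
Qed.

Lemma cLpZ p a b k f : cLp p a b f -> cLp p a b (fun t => k * f t).
Proof.
move=> lf; have := cLpM (p := Eoo) (q := p) _ (cLp_cst Eoo a b k) lf.
by case: (p) => /(_ isT).
Qed.

Lemma cLpJ p a b f : cLp p a b f -> cLp p a b (fun t => Num.conj (f t)).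
Proof.
move=> [f1 f2]; split; first by apply: Lp_eq f1 => t; rewrite cReJ.
by apply: Lp_eq (LpZ (-1) f2) => t; rewrite cImJ mulN1r.
Qed.

Lemma cLp_sum p a b (I : finType) (F : I -> R -> R[i]) :
  (forall i, cLp p a b (F i)) -> cLp p a b (fun t => \sum_i F i t).
Proof.
move=> lF; elim: (index_enum I) => [|i r IH].
  under [X in cLp _ _ _ X]eq_fun do rewrite big_nil.
  exact: cLp_cst.
under [X in cLp _ _ _ X]eq_fun do rewrite big_cons.
exact: cLpD.
Qed.

Lemma cprim_sub a b s t f df : a <= s -> t <= b ->
  cprim a b f df -> cprim s t f df.
Proof. by move=> ? ? [? ?]; split; apply: rprim_sub; eassumption. Qed.

Lemma cprim_Loo a b f df : cprim a b f df -> cLp Eoo a b f.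
Proof. by move=> [pr pi]; split; [exact: rprim_Loo pr | exact: rprim_Loo pi]. Qed.

Lemma cprim_L1 a b f df : cprim a b f df -> cLp E1 a b df.
Proof. by move=> [[pr _] [pi _]]; split; exact: L1_Lp. Qed.

Lemma cprimD a b f df g dg : cprim a b f df -> cprim a b g dg ->
  cprim a b (fun t => f t + g t) (fun t => df t + dg t).
Proof.
move=> [f1 f2] [g1 g2]; split.
  by apply: rprim_eq (rprimD f1 g1) => t; rewrite cReD.
by apply: rprim_eq (rprimD f2 g2) => t; rewrite cImD.
Qed.

Lemma cprim_cst a b k : cprim a b (fun=> k) (fun=> 0).
Proof. by split; exact: rprim_cst. Qed.

Lemma cprimM a b f df g dg : cprim a b f df -> cprim a b g dg ->
  cprim a b (fun t => f t * g t) (fun t => df t * g t + f t * dg t).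
Proof.
move=> [f1 f2] [g1 g2]; split.
  apply: rprim_eq (rprimD (rprimM f1 g1) (rprimZ (-1) (rprimM f2 g2))) => t.
    by rewrite cReM mulN1r.
  by rewrite cReD !cReM; ring.
apply: rprim_eq (rprimD (rprimM f1 g2) (rprimM f2 g1)) => t.
  by rewrite cImM.
by rewrite cImD !cImM; ring.
Qed.

Lemma cprimJ a b f df : cprim a b f df ->
  cprim a b (fun t => Num.conj (f t)) (fun t => Num.conj (df t)).
Proof.
move=> [f1 f2]; split; first by apply: rprim_eq f1 => t; rewrite cReJ.
by apply: rprim_eq (rprimZ (-1) f2) => t; rewrite cImJ mulN1r.
Qed.

Lemma cprim_sum a b (I : finType) (F dF : I -> R -> R[i]) :
  (forall i, cprim a b (F i) (dF i)) ->
  cprim a b (fun t => \sum_i F i t) (fun t => \sum_i dF i t).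
Proof.
move=> lF; elim: (index_enum I) => [|i r IH].
  under [X in cprim _ _ X]eq_fun do rewrite big_nil.
  under [X in cprim _ _ _ X]eq_fun do rewrite big_nil.
  exact: cprim_cst.
under [X in cprim _ _ X]eq_fun do rewrite big_cons.
under [X in cprim _ _ _ X]eq_fun do rewrite big_cons.
exact: cprimD.
Qed.

Lemma cprim_eq a b f g df dg : (forall t, f t = g t) ->
  (forall t, df t = dg t) -> cprim a b f df -> cprim a b g dg.
Proof. by move=> /funext -> /funext ->. Qed.

End ComplexFunctions.

Section MatrixFunctions.
Context {R : realType}.
Local Notation mu := (@lebesgue_measure R).
Implicit Types (a b s t : R) (k l m : nat).

Definition mLp p a b k l (M : R -> 'M[R[i]]_(k, l)) :=
  forall i j, cLp p a b (fun t => M t i j).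

Definition mprim a b k l (M dM : R -> 'M[R[i]]_(k, l)) :=
  forall i j, cprim a b (fun t => M t i j) (fun t => dM t i j).

Lemma mLp_eq p a b k l (M N : R -> 'M[R[i]]_(k, l)) : (forall t, M t = N t) ->
  mLp p a b M -> mLp p a b N.
Proof. by move=> /funext ->. Qed.

Lemma mprim_eq a b k l (M dM N dN : R -> 'M[R[i]]_(k, l)) : (forall t, M t = N t) ->
  (forall t, dM t = dN t) -> mprim a b M dM -> mprim a b N dN.
Proof. by move=> /funext -> /funext ->. Qed.

Lemma mLpD p a b k l (M N : R -> 'M[R[i]]_(k, l)) : mLp p a b M -> mLp p a b N ->
  mLp p a b (fun t => M t + N t).
Proof.
move=> lM lN i j; under [X in cLp _ _ _ X]eq_fun do rewrite mxE.
exact: cLpD.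
Qed.

Lemma mLpZ p a b k l c (M : R -> 'M[R[i]]_(k, l)) : mLp p a b M ->
  mLp p a b (fun t => c *: M t).
Proof.
move=> lM i j; under [X in cLp _ _ _ X]eq_fun do rewrite mxE.
exact: cLpZ.
Qed.

Lemma mLpN p a b k l (M : R -> 'M[R[i]]_(k, l)) : mLp p a b M ->
  mLp p a b (fun t => - M t).
Proof.
by move=> lM; apply: mLp_eq (mLpZ (-1) lM) => t; rewrite scaleN1r.
Qed.

Lemma mLpB p a b k l (M N : R -> 'M[R[i]]_(k, l)) : mLp p a b M -> mLp p a b N ->
  mLp p a b (fun t => M t - N t).
Proof. by move=> lM lN; apply: mLpD => //; exact: mLpN. Qed.

Lemma mLp_cst p a b k l (M : 'M[R[i]]_(k, l)) : mLp p a b (fun=> M).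
Proof. by move=> i j; exact: cLp_cst. Qed.

Lemma mLpM p q a b k l m (M : R -> 'M[R[i]]_(k, l)) (N : R -> 'M[R[i]]_(l, m)) :
  lok p q -> mLp p a b M -> mLp q a b N ->
  mLp (lmul p q) a b (fun t => M t *m N t).
Proof.
move=> pq lM lN i j; under [X in cLp _ _ _ X]eq_fun do rewrite mxE.
by apply: cLp_sum => ?; exact: cLpM.
Qed.

Lemma mLpJ p a b k l (M : R -> 'M[R[i]]_(k, l)) : mLp p a b M ->
  mLp p a b (fun t => (M t) ^t*).
Proof.
move=> lM i j; under [X in cLp _ _ _ X]eq_fun do rewrite !mxE.
exact: cLpJ.
Qed.

Lemma mLp_block p a b k1 k2 l1 l2 (M11 : R -> 'M[R[i]]_(k1, l1))
    (M12 : R -> 'M[R[i]]_(k1, l2)) (M21 : R -> 'M[R[i]]_(k2, l1)) (M22 : R -> 'M[R[i]]_(k2, l2)) :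
  mLp p a b M11 -> mLp p a b M12 -> mLp p a b M21 -> mLp p a b M22 ->
  mLp p a b (fun t => block_mx (M11 t) (M12 t) (M21 t) (M22 t)).
Proof.
move=> h11 h12 h21 h22 i j.
under [X in cLp _ _ _ X]eq_fun do rewrite !mxE.
by case: splitP => i' _; under [X in cLp _ _ _ X]eq_fun do rewrite !mxE;
  case: splitP => j' _.
Qed.

Lemma mprim_sub a b s t k l (M dM : R -> 'M[R[i]]_(k, l)) : a <= s -> t <= b ->
  mprim a b M dM -> mprim s t M dM.
Proof. by move=> ? ? pM i j; apply: cprim_sub (pM i j). Qed.

Lemma mprim_Loo a b k l (M dM : R -> 'M[R[i]]_(k, l)) : mprim a b M dM -> mLp Eoo a b M.
Proof. by move=> pM i j; exact: cprim_Loo (pM i j). Qed.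

Lemma mprim_L1 a b k l (M dM : R -> 'M[R[i]]_(k, l)) : mprim a b M dM -> mLp E1 a b dM.
Proof. by move=> pM i j; exact: cprim_L1 (pM i j). Qed.

Lemma mprimD a b k l (M dM N dN : R -> 'M[R[i]]_(k, l)) :
  mprim a b M dM -> mprim a b N dN ->
  mprim a b (fun t => M t + N t) (fun t => dM t + dN t).
Proof.
by move=> pM pN i j; apply: cprim_eq (cprimD (pM i j) (pN i j)) => t; rewrite mxE.
Qed.

Lemma mprim_cst a b k l (M : 'M[R[i]]_(k, l)) : mprim a b (fun=> M) (fun=> 0).
Proof.
by move=> i j; apply: cprim_eq (cprim_cst a b (M i j)) => // t; rewrite mxE.
Qed.

Lemma mprimM a b k l m (M dM : R -> 'M[R[i]]_(k, l)) (N dN : R -> 'M[R[i]]_(l, m)) :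
  mprim a b M dM -> mprim a b N dN ->
  mprim a b (fun t => M t *m N t) (fun t => dM t *m N t + M t *m dN t).
Proof.
move=> pM pN i j.
apply: cprim_eq (cprim_sum (fun z => cprimM (pM i z) (pN z j))) => t.
  by rewrite mxE.
by rewrite !mxE big_split.
Qed.

Lemma mprimMl a b k l m (K : 'M[R[i]]_(k, l)) (N dN : R -> 'M[R[i]]_(l, m)) :
  mprim a b N dN -> mprim a b (fun t => K *m N t) (fun t => K *m dN t).
Proof.
move=> pN; apply: mprim_eq (mprimM (mprim_cst a b K) pN) => // t.
by rewrite mul0mx add0r.
Qed.

Lemma mprimMr a b k l m (M dM : R -> 'M[R[i]]_(k, l)) (K : 'M[R[i]]_(l, m)) :
  mprim a b M dM -> mprim a b (fun t => M t *m K) (fun t => dM t *m K).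
Proof.
move=> pM; apply: mprim_eq (mprimM pM (mprim_cst a b K)) => // t.
by rewrite mulmx0 addr0.
Qed.

Lemma mprimN a b k l (M dM : R -> 'M[R[i]]_(k, l)) :
  mprim a b M dM -> mprim a b (fun t => - M t) (fun t => - dM t).
Proof.
by move=> pM; apply: mprim_eq (mprimMl (- 1%:M) pM) => t; rewrite mulNmx mul1mx.
Qed.

Lemma mprimJ a b k l (M dM : R -> 'M[R[i]]_(k, l)) :
  mprim a b M dM -> mprim a b (fun t => (M t) ^t*) (fun t => (dM t) ^t*).
Proof.
by move=> pM i j; apply: cprim_eq (cprimJ (pM j i)) => t; rewrite !mxE.
Qed.

Lemma mprim_trmx a b k l (M dM : R -> 'M[R[i]]_(k, l)) :
  mprim a b M dM -> mprim a b (fun t => (M t)^T) (fun t => (dM t)^T).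
Proof. by move=> pM i j; apply: cprim_eq (pM j i) => t; rewrite !mxE. Qed.

Lemma mprim_const a b k l (M : R -> 'M[R[i]]_(k, l)) : mprim a b M (fun=> 0) ->
  forall s t, a <= s <= b -> a <= t <= b -> M s = M t.
Proof.
move=> pM.
have key s t : a <= s -> s <= t -> t <= b -> M t = M s.
  move=> as_ st tb; apply/matrixP => i j.
  have [[_ Hr] [_ Hi]] := pM i j.
  by apply: complexP; apply: subr0_eq; rewrite (Hr, Hi) // Rintegral_eq0 // => x;
    rewrite mxE.
move=> s t /andP[? ?] /andP[? ?]; have [st|/ltW ts] := lerP s t.
  by rewrite (key s t).
by rewrite (key t s).
Qed.

End MatrixFunctions.

(** * Exhaustion of open intervals *)

Section LocalSpaces.
Context {R : realType}.
Local Notation mu := (@lebesgue_measure R).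
Implicit Types (T K : set R) (a b c s t : R) (f g h df dg : R -> R).

Lemma is_interval_sub T a b : is_interval T -> T a -> T b -> `[a, b] `<=` T.
Proof. by move=> iT Ta Tb t /=; rewrite in_itv /=; exact: iT. Qed.

Lemma open_margin T t : open T -> T t ->
  exists2 e : R, 0 < e & forall s, `|s - t| < e -> T s.
Proof.
move=> oT Tt; have [e /= e0 he] := open_subball oT Tt.
exists (e / 2); first by lra.
move=> s st; apply: (he (e / 2)); [|lra|] => //.
  by rewrite /= sub0r normrN gtr0_norm; lra.
by rewrite /ball /= distrC.
Qed.

Lemma open_exists_lt T t : open T -> T t -> exists2 s, T s & s < t.
Proof.
move=> oT Tt; have [e e0 he] := open_margin oT Tt.
exists (t - e / 2); last by lra.
by apply: he; rewrite ltr_distl; apply/andP; split; lra.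
Qed.

Lemma open_exists_gt T t : open T -> T t -> exists2 s, T s & t < s.
Proof.
move=> oT Tt; have [e e0 he] := open_margin oT Tt.
exists (t + e / 2); last by lra.
by apply: he; rewrite ltr_distl; apply/andP; split; lra.
Qed.

(** A running maximum over an enumeration of the rationals in [T] treats bounded and unbounded
    intervals alike. *)
Lemma cofinal_seq T t0 : open T -> T t0 -> exists tau : nat -> R,
  [/\ forall k, T (tau k), {homo tau : k l / (k <= l)%N >-> k <= l}
    & forall t, T t -> exists k, t <= tau k].
Proof.
move=> oT Tt0.
pose q k : R := if unpickle k is Some p then ratr p else t0.
pose step s k := if `[< T (q k) >] then Num.max s (q k) else s.
pose tau := fix tau k := if k is k'.+1 then step (tau k') k' else t0.
have stau k : tau k <= tau k.+1.
  by rewrite /= /step; case: ifP; rewrite ?le_max lexx.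
exists tau; split.
- elim=> [//|k IH] /=; rewrite /step; case: ifP => // /asboolP Tq.
  by rewrite /Num.max; case: ifP.
- exact: (homo_leq (@lexx _ _) le_trans stau).
- move=> t Tt; have [e e0 he] := open_margin oT Tt.
  have [p] := @rat_in_itvoo R t (t + e) ltac:(lra).
  rewrite in_itv /= => /andP[tp pe].
  (* The rational with code j is examined when passing from stage j to stage j + 1. *)
  exists (pickle p).+1 => /=; rewrite /step /q pickleK.
  case: ifPn => [_|/asboolPn []]; first by rewrite le_max (ltW tp) orbT.
  by apply: he; rewrite ltr_distl; apply/andP; split; lra.
Qed.

Lemma coinitial_seq T t0 : open T -> T t0 -> exists sig : nat -> R,
  [/\ forall k, T (sig k), {homo sig : k l / (k <= l)%N >-> l <= k}
    & forall t, T t -> exists k, sig k <= t].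
Proof.
move=> oT Tt0.
have oN : open [set t | T (- t)].
  by apply: open_comp oT => t _; exact: opp_continuous.
have [|tau [Ttau mtau ctau]] := @cofinal_seq [set t | T (- t)] (- t0) oN.
  by rewrite /= opprK.
exists (fun k => - tau k); split => //.
- by move=> k l kl; rewrite lerN2 mtau.
- move=> t Tt; have [|k] := ctau (- t); first by rewrite /= opprK.
  by exists k; rewrite lerNl.
Qed.

Lemma interval_exhaust T : open T -> is_interval T -> T !=set0 ->
  exists sig tau : nat -> R, [/\ forall k, T (sig k), forall k, T (tau k),
    forall k, sig k <= tau k & T = \bigcup_k `[sig k, tau k]%classic].
Proof.
move=> oT iT [t0 Tt0].
have [sig [Ts ms cs]] := coinitial_seq oT Tt0.
have [tau [Tt mt ct]] := cofinal_seq oT Tt0.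
have [k0 k0s] := cs _ Tt0; have [k1 k1t] := ct _ Tt0.
(* From the index [k2] on, [t0] separates the two sequences, so that every interval of the
   exhaustion is nonempty. *)
pose k2 := maxn k0 k1.
exists (fun k => sig (k2 + k)%N), (fun k => tau (k2 + k)%N); split => //.
  move=> k; apply: (@le_trans _ _ t0).
    by apply: le_trans k0s; apply: ms; rewrite /k2; lia.
  by apply: le_trans k1t _; apply: mt; rewrite /k2; lia.
apply/seteqP; split => [t Tt'|t [k _]]; last exact: is_interval_sub.
have [i si] := cs _ Tt'; have [j tj] := ct _ Tt'.
exists (maxn i j) => //=; rewrite in_itv /=; apply/andP; split.
  by apply: le_trans si; apply: ms; lia.
by apply: le_trans tj _; apply: mt; lia.
Qed.

Lemma measurable_fun_exhaust T f : open T -> is_interval T ->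
  (forall a b, T a -> T b -> a <= b -> measurable_fun `[a, b] f) ->
  measurable_fun T f.
Proof.
move=> oT iT mf; have [->|/set0P nT] := eqVneq T set0.
  exact: measurable_fun_set0.
have [sig [tau [Ts Tt st ->]]] := interval_exhaust oT iT nT.
by apply/measurable_fun_bigcup => // k; apply: mf.
Qed.

Lemma ae_exhaust T (P : R -> Prop) : open T -> is_interval T ->
  (forall a b, T a -> T b -> a <= b ->
     {ae mu, forall t, `[a, b]%classic t -> P t}) ->
  {ae mu, forall t, T t -> P t}.
Proof.
move=> oT iT aeP; have [->|/set0P nT] := eqVneq T set0; first exact: aeW.
have [sig [tau [Ts Tt st ->]]] := interval_exhaust oT iT nT.
have := ae_foralln (fun k => aeP _ _ (Ts k) (Tt k) (st k)).
by apply: aeS => t Pt [k _ tk]; exact: Pt tk.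
Qed.

(** The strict margins make a test function supported in [K] vanish at both endpoints, which removes
    the boundary terms of integration by parts. *)
Lemma compact_sub_itv T K : open T -> is_interval T -> T !=set0 ->
  compact K -> K `<=` T ->
  exists a b, [/\ T a, T b, a < b & forall t, K t -> a < t < b].
Proof.
move=> oT iT [t0 Tt0] cK KT.
have [->|/set0P nK] := eqVneq K set0.
  have [a Ta at0] := open_exists_lt oT Tt0; have [b Tb tb] := open_exists_gt oT Tt0.
  by exists a, b; split => //; apply: lt_trans tb.
have cid : {within K, continuous (@id R)}.
  by apply: continuous_subspaceT => x; exact: cvg_id.
have [c [Kc hc]] : exists c, K c /\ forall t, K t -> t <= c.
  have [c /set_mem Kc hc] := compact_EVT_max nK cK cid.
  by exists c; split => // t Kt; apply: hc; exact/mem_set.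
have [d [Kd hd]] : exists d, K d /\ forall t, K t -> d <= t.
  have [d /set_mem Kd hd] := compact_EVT_min nK cK cid.
  by exists d; split => // t Kt; apply: hd; exact/mem_set.
have [a Ta ad] := open_exists_lt oT (KT _ Kd); have [b Tb cb] := open_exists_gt oT (KT _ Kc).
exists a, b; split => //.
  by apply: lt_le_trans ad (le_trans (hd _ Kc) (ltW cb)).
by move=> t Kt; rewrite (lt_le_trans ad (hd _ Kt)) (le_lt_trans (hc _ Kt) cb).
Qed.

Lemma L1_mkcond K f : measurable K -> mu.-integrable K (EFin \o f) <->
  mu.-integrable setT ((EFin \o f) \_ K).
Proof. by move=> mK; exact: integrable_mkcond. Qed.

Lemma finite_norm_L1 K f : compact K -> measurable_fun K f ->
  finite_norm mu 1 (f \_ K) <-> mu.-integrable K (EFin \o f).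
Proof.
move=> cK mf; have mK : measurable K by exact: compact_measurable.
rewrite /finite_norm Lnorm1 -restrict_EFin; split => [h|].
  apply/(L1_mkcond _ mK)/integrableP; split => //.
  by apply: (measurable_restrictT _ mK).1; exact/measurable_EFinP.
by move=> /(L1_mkcond _ mK)/integrableP[].
Qed.

Lemma finite_norm_L2 K f : compact K -> measurable_fun K f ->
  finite_norm mu 2%:E (f \_ K) <-> mu.-integrable K (EFin \o (fun t => f t ^+ 2)).
Proof.
move=> cK mf; have mK : measurable K by exact: compact_measurable.
have mfK : measurable_fun setT (f \_ K) by exact: (measurable_restrictT _ mK).1.
have EI : (\int[mu]_t (`| ((f \_ K) t)%:E | `^ 2) =
    \int[mu]_t `| ((EFin \o (fun t => (f t ^+ 2)%R)) \_ K) t |)%E.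
  apply: eq_integral => t _; rewrite !patchE; case: ifP => _ /=.
    by rewrite powR_mulrn // normrX.
  by rewrite normr0 powR0.
have m2 : measurable_fun setT ((EFin \o (fun t => f t ^+ 2)) \_ K).
  apply: (measurable_restrictT _ mK).1; apply/measurable_EFinP.
  exact: measurable_funX.
rewrite /finite_norm; split => [h|].
  apply/(L1_mkcond _ mK)/integrableP; split => //.
  by rewrite -EI -powR_Lnorm // poweR_lty.
move=> /(L1_mkcond _ mK)/integrableP[_]; rewrite -EI -powR_Lnorm //.
exact: lty_poweRy.
Qed.

Lemma Lploc_itv T a b f p : open T -> is_interval T -> T a -> T b -> Lploc p T f ->
  [/\ measurable_fun `[a, b] f, compact `[a, b]%classic
    & finite_norm mu p (f \_ `[a, b]%classic)].
Proof.
move=> oT iT Ta Tb [mf nf]; have sT := is_interval_sub iT Ta Tb.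
split; [|exact: segment_compact |].
  by apply: measurable_funS mf => //; exact: open_measurable.
by apply: nf => //; exact: segment_compact.
Qed.

Lemma LplocP1 T f : open T -> is_interval T -> Lploc 1 T f <->
  forall a b, T a -> T b -> a <= b -> Lp E1 a b f.
Proof.
move=> oT iT; split => [lf a b Ta Tb ab|lf].
  have [mf cab nf] := Lploc_itv oT iT Ta Tb lf.
  by apply/L1_Lp/finite_norm_L1.
have mf : measurable_fun T f.
  by apply: measurable_fun_exhaust => // a b Ta Tb ab; have [] := lf _ _ Ta Tb ab.
split=> // K KT cK.
have mK : measurable_fun K f.
  by apply: measurable_funS mf => //; exact: open_measurable.
apply/finite_norm_L1 => //.
have [T0|/set0P nT] := eqVneq T set0.
  have -> : K = set0 by apply/seteqP; split => // t /KT; rewrite T0.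
  exact: integrable_set0.
have [a [b [Ta Tb ab Kab]]] := compact_sub_itv oT iT nT cK KT.
have [_ lab] := lf _ _ Ta Tb (ltW ab).
apply: integrableS lab => //; first exact: compact_measurable.
by move=> t /Kab /andP[? ?]; rewrite /= in_itv /=; apply/andP; split; exact: ltW.
Qed.

Lemma LplocP2 T f : open T -> is_interval T -> Lploc 2%:E T f <->
  forall a b, T a -> T b -> a <= b -> Lp E2 a b f.
Proof.
move=> oT iT; split => [lf a b Ta Tb ab|lf].
  have [mf cab nf] := Lploc_itv oT iT Ta Tb lf.
  by split=> //; apply/finite_norm_L2.
have mf : measurable_fun T f.
  by apply: measurable_fun_exhaust => // a b Ta Tb ab; have [] := lf _ _ Ta Tb ab.
split=> // K KT cK.
have mK : measurable_fun K f.
  by apply: measurable_funS mf => //; exact: open_measurable.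
apply/finite_norm_L2 => //.
have [T0|/set0P nT] := eqVneq T set0.
  have -> : K = set0 by apply/seteqP; split => // t /KT; rewrite T0.
  exact: integrable_set0.
have [a [b [Ta Tb ab Kab]]] := compact_sub_itv oT iT nT cK KT.
have [_ lab] := lf _ _ Ta Tb (ltW ab).
apply: integrableS lab => //; first exact: compact_measurable.
by move=> t /Kab /andP[? ?]; rewrite /= in_itv /=; apply/andP; split; exact: ltW.
Qed.

Lemma Lploc_Loo T f a b : open T -> is_interval T -> T a -> T b -> Lploc +oo%E T f ->
  Lp Eoo a b f.
Proof.
move=> oT iT Ta Tb lf; have [mf _ nf] := Lploc_itv oT iT Ta Tb lf.
split=> //; move: nf; rewrite /finite_norm unlock; case: ifPn => [_ h|].
  have {}h : (ess_sup mu (EFin \o (fun t => `|(f \_ `[a, b]%classic) t|%R)) < +oo)%E.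
    exact: h.
  have [M hM] := ess_supr_bounded h.
  by exists M; apply: aeS hM => t + tab; rewrite patchE mem_set.
(* The remaining branch in the definition of the norm concerns a space of measure zero; the real
   line has infinite measure. *)
rewrite -leNgt /=; have := @lebesgue_measure_itv R `]-oo, +oo[.
by rewrite set_itvNyy /= => ->; rewrite leNgt ltry.
Qed.

End LocalSpaces.

(** * Weak derivatives *)

Section WeakDerivatives.
Context {R : realType}.
Local Notation mu := (@lebesgue_measure R).
Implicit Types (T K : set R) (a b c s t : R) (f g h df dg phi : R -> R).

Lemma rprim_C1 a b phi : a < b -> (forall t, derivable phi t 1) ->
  continuous (derive1 phi) -> rprim a b phi (derive1 phi).
Proof.
move=> ab dphi cphi; split.
  by apply: continuous_compact_integrable; [exact: segment_compact
    | exact: continuous_subspaceT].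
move=> s t _; rewrite le_eqVlt => /predU1P[-> _|st _].
  by rewrite subrr set_itv1 Rintegral_set1.
have cp : continuous phi.
  move=> x; have dx := (derivable1_diffP phi x).1 (dphi x).
  exact: (differentiable_continuous dx).
have dst : derivable_oo_LRcontinuous phi s t.
  split; first by move=> x _; exact: dphi.
    by apply: cvg_at_right_filter; exact: cp.
  by apply: cvg_at_left_filter; exact: cp.
have cst := continuous_subspaceT (A := `[s, t]%classic) cphi.
have E := continuous_FTC2 st cst dst (fun x _ => erefl).
by rewrite /Rintegral E.
Qed.

Lemma eq_Rint a b f g : (forall t, a <= t <= b -> f t = g t) ->
  \int[mu]_(t in `[a, b]) f t = \int[mu]_(t in `[a, b]) g t.
Proof. by move=> fg; apply: eq_Rintegral => t /set_mem; rewrite /= in_itv; exact: fg. Qed.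

Lemma Rint_supp T a b f : `[a, b] `<=` T ->
  (forall t, T t -> ~ `[a, b]%classic t -> f t = 0) ->
  \int[mu]_(t in T) f t = \int[mu]_(t in `[a, b]) f t.
Proof.
move=> sT f0; rewrite Rintegral_mkcond [RHS]Rintegral_mkcond.
congr (Rintegral _ _ _); apply/funext => t; rewrite !patchE.
have [/set_mem Tt|Tt] := boolP (t \in T);
  have [/set_mem tab|tab] := boolP (t \in `[a, b]%classic) => //.
- by apply: f0 => // h; move: tab; rewrite mem_set.
- by move: Tt; rewrite mem_set //; exact: sT.
Qed.

(** The weak identity is the product rule for [f] and the test function, integrated over an interval
    at whose endpoints the test function is zero. *)
Lemma W11loc_of_rprim T f df : open T -> is_interval T ->
  (forall a b, T a -> T b -> a <= b -> rprim a b f df) -> W11loc_deriv T f df.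
Proof.
move=> oT iT pf; split.
- have cf t : T t -> {for t, continuous f}.
    move=> Tt; apply/cvgrPdist_le => eps e0.
    have [a Ta at_] := open_exists_lt oT Tt; have [b Tb tb] := open_exists_gt oT Tt.
    have pab := pf _ _ Ta Tb (ltW (lt_trans at_ tb)).
    have tab : a <= t <= b by rewrite !ltW.
    have [d d0 hd] := within_cont_eps (rprim_cont pab) e0 tab.
    have m0 : 0 < Num.min d (Num.min (t - a) (b - t)).
      by rewrite !lt_min d0; apply/andP; split; lra.
    apply/nbhs_ballP; exists (Num.min d (Num.min (t - a) (b - t))) => // u.
    rewrite /ball /= distrC !lt_min => /and3P[ud].
    rewrite !ltr_distl => /andP[u1 u2] /andP[u3 u4].
    by rewrite distrC hd //; apply/andP; split; lra.
  apply/continuous_in_subspaceT => t /set_mem; exact: cf.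
- apply/LplocP1 => // a b Ta Tb ab; apply: Lp_oo.
  exact: rprim_Loo (pf _ _ Ta Tb ab).
- by apply/LplocP1 => // a b Ta Tb ab; apply: L1_Lp; have [] := pf _ _ Ta Tb ab.
- move=> phi [dphi cphi [K [cK KT phi0]]].
  have [T0|/set0P nT] := eqVneq T set0.
    by rewrite T0 !Rintegral_set0 oppr0.
  have [a [b [Ta Tb ab Kab]]] := compact_sub_itv oT iT nT cK KT.
  have oK : open (~` K) by apply: closed_openC; exact: compact_closed.
  have dphi0 t : ~ K t -> derive1 phi t = 0.
    move=> Kt; rewrite derive1E.
    rewrite (@near_eq_derive _ _ _ phi (cst 0)) ?derive_cst //.
    by near=> u; apply: phi0; near: u; exact: open_nbhs_nbhs.
  have Kcc t : ~ `[a, b]%classic t -> ~ K t.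
    by move=> tab /Kab/andP[? ?]; apply: tab; rewrite /= in_itv /= !ltW.
  have pab := pf _ _ Ta Tb (ltW ab).
  have sT := is_interval_sub iT Ta Tb.
  have pphi := rprim_C1 ab dphi cphi.
  have [_ /(_ a b (lexx _) (ltW ab) (lexx _))] := rprimM pab pphi.
  rewrite [phi a]phi0 ?[phi b]phi0; last 2 first.
  + by move=> /Kab; rewrite ltxx andbF.
  + by move=> /Kab; rewrite ltxx.
  rewrite !mulr0 subrr RintegralD //; last 2 first.
  + by apply: L1M_rprim pab _; case: pphi.
  + by apply: L1M_rprim pphi _; case: pab.
  move=> /esym/eqP; rewrite addr_eq0 => /eqP E.
  rewrite (Rint_supp sT) ?E; last first.
    by move=> t _ /Kcc/dphi0 ->; rewrite mulr0.
  rewrite (Rint_supp sT); last by move=> t _ /Kcc/phi0 ->; rewrite mulr0.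
  by congr (- _); apply: eq_Rintegral => t _; rewrite mulrC.
Unshelve. all: by end_near.
Qed.

Lemma Rint_ge0_eq0 a b f : {within `[a, b], continuous f} ->
  (forall t, a <= t <= b -> 0 <= f t) ->
  \int[mu]_(t in `[a, b]) f t = 0 -> forall t, a < t < b -> f t = 0.
Proof.
move=> cf f0 If t /andP[at_ tb].
have lf : L1 a b f.
  by apply: continuous_compact_integrable => //; exact: segment_compact.
have tab : a <= t <= b by rewrite !ltW.
apply/eqP; rewrite eq_le f0 // andbT leNgt; apply/negP => ft0.
have [d d0 hd] := within_cont_eps cf (divr_gt0 ft0 (ltr0n R 2)) tab.
(* On [[t, v]] the function stays above half its value at [t], which would already make the integral
   positive. *)
pose v := Num.min (t + d / 2) b.
have tv : t < v by rewrite lt_min tb andbT; lra.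
have vb : v <= b by rewrite ge_min lexx orbT.
have vd : v <= t + d / 2 by rewrite ge_min lexx.
have : \int[mu]_(x in `[t, v]) f x >= f t / 2 * (v - t).
  rewrite -[_ * (v - t)](_ : \int[mu]_(x in `[t, v]) (f t / 2) = _).
    apply: le_Rintegral => //; [exact: L1_cst | exact: (L1_sub (ltW at_) vb lf) |].
    move=> x; rewrite /= in_itv /= => /andP[tx xv].
    have : `|f x - f t| <= f t / 2.
      apply: hd; first by apply/andP; split; lra.
      by rewrite ltr_distl; apply/andP; split; lra.
    by rewrite ler_distl => /andP[]; lra.
  rewrite Rintegral_cst //= lebesgue_measure_itv /= lte_fin tv //.
have : 0 < f t / 2 * (v - t) by rewrite mulr_gt0 ?divr_gt0 ?subr_gt0.
have := Rint_split lf (lexx a) (ltW at_) (ltW tb).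
have := Rint_split lf (ltW at_) (ltW tv) vb.
have := Rint_split lf (le_trans (ltW at_) (ltW tv)) vb (lexx b).
have : 0 <= \int[mu]_(x in `[a, t]) f x.
  by apply: Rintegral_ge0 => x; rewrite /= in_itv /= => /andP[? ?]; apply: f0;
    apply/andP; split; lra.
have : 0 <= \int[mu]_(x in `[v, b]) f x.
  by apply: Rintegral_ge0 => x; rewrite /= in_itv /= => /andP[? ?]; apply: f0;
    apply/andP; split; lra.
rewrite If; lra.
Qed.

Lemma continuous_extend0 a b h : {within `[a, b], continuous h} ->
  a <= b -> h a = 0 -> h b = 0 -> continuous (h \_ `[a, b]%classic).
Proof.
move=> ch ab ha hb x; apply/cvgrPdist_le => eps e0.
have inE u : (u \in `[a, b]%classic) = (a <= u <= b).
  by apply/idP/idP => [/set_mem|h']; rewrite ?mem_set //= in_itv.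
have [xab|xab] := boolP (a <= x <= b).
  have [d d0 hd] := within_cont_eps ch e0 xab.
  apply/nbhs_ballP; exists d => // u; rewrite /ball /= distrC => ud.
  rewrite !patchE !inE xab distrC; case: ifPn => uab; first exact: hd.
  move: xab uab; rewrite negb_and -!ltNge => /andP[ax xb] /orP[ua|bu].
    (* The restriction takes the default value [point] outside the interval, and this is 0 in
       [R]. *)
    rewrite -[point]/(0 : R) -ha; apply: hd; first by rewrite lexx.
    by move: ud; rewrite !ltr_distl => /andP[? ?]; apply/andP; split; lra.
  rewrite -[point]/(0 : R) -hb; apply: hd; first by rewrite lexx ab.
  by move: ud; rewrite !ltr_distl => /andP[? ?]; apply/andP; split; lra.
have [d d0 hd] : exists2 d : R, 0 < d & forall u, `|u - x| < d -> ~~ (a <= u <= b).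
  move: xab; rewrite negb_and -!ltNge => /orP[xa|bx].
    exists (a - x) => [|u]; first by lra.
    by rewrite ltr_distl => /andP[? ?]; rewrite negb_and -!ltNge; apply/orP; left; lra.
  exists (x - b) => [|u]; first by lra.
  by rewrite ltr_distl => /andP[? ?]; rewrite negb_and -!ltNge; apply/orP; right; lra.
apply/nbhs_ballP; exists d => // u; rewrite /ball /= distrC => /hd uab.
by rewrite !patchE !inE (negbTE uab) (negbTE xab) subrr normr0 ltW.
Qed.

Lemma rprim_Rint a b f : L1 a b f ->
  rprim a b (fun x => \int[mu]_(t in `[a, x]) f t) f.
Proof.
move=> lf; split => // s t as_ st tb; rewrite (Rint_split lf as_ st tb); ring.
Qed.

(* du Bois-Reymond: with [G] a primitive of [df], testing against the primitive
   of [(f - G - c) w], where [w] is a bump function and [c] is the [w]-average of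
   [f - G], shows that the integral of [(f - G - c)^2 w] vanishes. *)
Lemma rprim_of_W11loc T f df a b : open T -> is_interval T ->
  W11loc_deriv T f df -> T a -> T b -> a <= b -> rprim a b f df.
Proof.
move=> oT iT [cf _ ldf ibp] Ta Tb ab.
(* The equality of [f] and [G + c] is obtained only inside an open interval, so [[a, b]] is first
   enlarged. *)
have [al Tal ala] := open_exists_lt oT Ta.
have [be Tbe bbe] := open_exists_gt oT Tb.
have albe : al < be by lra.
have sT := is_interval_sub iT Tal Tbe.
have [_ ld] := (LplocP1 _ oT iT).1 ldf _ _ Tal Tbe (ltW albe).
pose G x := \int[mu]_(t in `[al, x]) df t.
have pG : rprim al be G df by exact: rprim_Rint.
have cG := rprim_cont pG.
have cf' : {within `[al, be], continuous f} by exact: continuous_subspaceW cf.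
pose w x := (x - al) * (be - x).
have cw : {within `[al, be], continuous w}.
  apply: continuous_subspaceT => x; apply: cvgM.
    by apply: cvgB; [exact: cvg_id | exact: cvg_cst].
  by apply: cvgB; [exact: cvg_cst | exact: cvg_id].
have cint k : {within `[al, be], continuous k} -> L1 al be k.
  by move=> ck; apply: continuous_compact_integrable => //; exact: segment_compact.
have w0 x : al <= x <= be -> 0 <= w x.
  by move=> /andP[? ?]; rewrite mulr_ge0 // subr_ge0.
have wpos x : al < x < be -> 0 < w x.
  by move=> /andP[? ?]; rewrite mulr_gt0 // subr_gt0.
have Iw0 : \int[mu]_(x in `[al, be]) w x != 0.
  apply/eqP => Iw; have mid : al < (al + be) / 2 < be by apply/andP; split; lra.
  by have := wpos _ mid; rewrite (Rint_ge0_eq0 cw w0 Iw mid) ltxx.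
have cgw : {within `[al, be], continuous (fun x => (f x - G x) * w x)}.
  move=> x; apply: cvgM; last exact: cw.
  by apply: cvgB; [exact: cf' | exact: cG].
pose c := (\int[mu]_(x in `[al, be]) ((f x - G x) * w x)) /
          \int[mu]_(x in `[al, be]) w x.
pose h x := (f x - G x - c) * w x.
have cgc : {within `[al, be], continuous (fun x => f x - G x - c)}.
  move=> x; apply: cvgB; last exact: cvg_cst.
  by apply: cvgB; [exact: cf' | exact: cG].
have ch : {within `[al, be], continuous h}.
  by move=> x; apply: cvgM; [exact: cgc | exact: cw].
have hal : h al = 0 by rewrite /h /w subrr mul0r mulr0.
have hbe : h be = 0 by rewrite /h /w subrr !mulr0.
have Ih : \int[mu]_(x in `[al, be]) h x = 0.
  rewrite (@eq_Rint _ _ h (fun x => (f x - G x) * w x + - c * w x));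
    last by move=> x _; rewrite /h; ring.
  rewrite RintegralD //; [|exact: cint | by apply: L1Z; exact: cint].
  rewrite RintegralZl; [|by [] | exact: cint].
  by rewrite /c mulNr divfK // subrr.
pose psi := h \_ `[al, be]%classic.
have psiE x : al <= x <= be -> psi x = h x.
  by move=> xab; rewrite /psi patchE mem_set //= in_itv.
have cpsi : continuous psi by apply: continuous_extend0 => //; exact: ltW.
have lpsi (E : set R) : measurable E -> mu.-integrable E (EFin \o psi).
  move=> mE; rewrite /psi -restrict_EFin; apply/integrable_restrict => //.
  apply: integrableS (cint _ ch) => //; exact: measurableI.
(* Integrating from minus infinity gives a primitive on the whole line. It returns to 0 at [be]
   precisely because [c] was chosen to make the integral of [h] vanish. *)
pose phi x := \int[mu]_(t in `]-oo, x]) psi t.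
have dphi x : derivable phi x 1 /\ phi^`()%classic x = psi x.
  have xx1 : x < x + 1 by lra.
  have lx : mu.-integrable [set` Interval -oo%O (BRight (x + 1))] (EFin \o psi).
    exact: lpsi.
  have Z := continuous_FTC1 xx1 lx; apply: Z; [exact: ltNyr | exact: cpsi].
have phi' : phi^`()%classic = psi by apply/funext => x; have [] := dphi x.
have psi0 x : ~~ (al < x < be) -> psi x = 0.
  move=> xab; rewrite /psi patchE; case: ifPn => // /set_mem; rewrite /= in_itv /=.
  move: xab; rewrite negb_and -!leNgt => /orP[xa|bx] /andP[ax xb].
    by rewrite (_ : x = al) //; apply/le_anti/andP; split.
  by rewrite (_ : x = be) //; apply/le_anti/andP; split.
have phi0 x : ~~ (al < x < be) -> phi x = 0.
  rewrite negb_and -!leNgt => /orP[xa|bx].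
    rewrite /phi /Rintegral integral0_eq // => t.
    rewrite /= in_itv /= => tx; rewrite psi0 //.
    by rewrite negb_and -!leNgt (le_trans tx).
  rewrite /phi (@Rint_supp _ al be).
  - by rewrite -[RHS]Ih; apply: eq_Rint.
  - by move=> t; rewrite /= !in_itv /= => /andP[_ tb]; exact: le_trans bx.
  - move=> t _ tab; rewrite /psi patchE; case: ifPn => // /set_mem.
    by move/tab.
have tphi : test_fun T phi.
  split; first by move=> x; have [] := dphi x.
    by rewrite phi'.
  exists `[al, be]%classic; split => //; first exact: segment_compact.
  move=> t tab; apply: phi0; apply/negP => /andP[? ?]; apply: tab.
  by rewrite /= in_itv /= !ltW.
have := ibp _ tphi; rewrite phi'.
have out t : ~ `[al, be]%classic t -> ~~ (al < t < be).
  move=> tab; apply/negP => /andP[? ?]; apply: tab.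
  by rewrite /= in_itv /= !ltW.
rewrite (Rint_supp sT); last by move=> t _ /out/psi0 ->; rewrite mulr0.
rewrite (Rint_supp sT); last by move=> t _ /out/phi0 ->; rewrite mulr0.
move=> E1.
have pphi : rprim al be phi psi.
  by rewrite -phi'; apply: rprim_C1; rewrite ?phi' // => x; have [] := dphi x.
have lfpsi : L1 al be (fun x => f x * psi x).
  apply: cint => x; apply: cvgM; first exact: cf'.
  exact: (continuous_subspaceT cpsi).
have lGpsi : L1 al be (fun x => G x * psi x) by apply: L1M_rprim pG _; exact: lpsi.
have lphid : L1 al be (fun x => phi x * df x) by apply: L1M_rprim pphi _.
have [_ /(_ al be (lexx _) (ltW albe) (lexx _))] := rprimM pG pphi.
rewrite [phi al]phi0 ?ltxx // [phi be]phi0 ?ltxx ?andbF //.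
rewrite !mulr0 subrr RintegralD // => E2.
(* The weak identity for [f] ([E1]) and the product rule for [G] ([E2]) give the integrals of
   [f psi] and [G psi] the same value, and [psi] has integral 0. *)
have I2 : \int[mu]_(x in `[al, be]) ((f x - G x - c) ^+ 2 * w x) = 0.
  rewrite (@eq_Rint _ _ _
     (fun x => (f x * psi x + - 1 * (G x * psi x)) + - c * psi x)).
    rewrite RintegralD //; last 2 first.
    - by apply: L1D => //; exact: L1Z.
    - by apply: L1Z; exact: lpsi.
    rewrite RintegralD //; last exact: L1Z.
    rewrite !RintegralZl //; last exact: lpsi.
    rewrite E1 (@eq_Rint _ _ (fun x => df x * phi x) (fun x => phi x * df x)); last first.
      by move=> x _; rewrite mulrC.
    rewrite (@eq_Rint _ _ psi h); last by move=> x /psiE.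
    by rewrite Ih; move: E2; lra.
  by move=> x /psiE ->; rewrite /h; ring.
have g0 x : al < x < be -> f x = G x + c.
  move=> xab.
  have cg2 : {within `[al, be], continuous (fun x => (f x - G x - c) ^+ 2 * w x)}.
    move=> y; apply: cvgM; last exact: cw.
    by apply: cvgM; exact: cgc.
  have g2 y : al <= y <= be -> 0 <= (f y - G y - c) ^+ 2 * w y.
    by move=> yab; rewrite mulr_ge0 ?sqr_ge0 // w0.
  have /eqP := Rint_ge0_eq0 cg2 g2 I2 xab.
  rewrite mulf_eq0 [w x == 0]gt_eqF ?wpos // orbF sqrf_eq0 => /eqP; lra.
split; first by apply: L1_sub ld; exact: ltW.
move=> s t as_ st tb; rewrite !g0; last 2 first.
- by apply/andP; split; lra.
- by apply/andP; split; lra.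
rewrite (_ : G t + c - (G s + c) = G t - G s); last by ring.
by case: pG => _ ->//; lra.
Qed.

End WeakDerivatives.

(** * Linear differential equations *)

Section OrientedIntegrals.
Context {R : realType}.
Local Notation mu := (@lebesgue_measure R).
Implicit Types (a b c s t : R) (f g df dg : R -> R).

(** Initial times lie inside the interval, so solutions extend both ways from [c]; a set integral
    over a reversed interval would be 0, hence the explicit sign. *)
Definition oint c f t : R := if c <= t then \int[mu]_(x in `[c, t]) f x
                             else - \int[mu]_(x in `[t, c]) f x.

Lemma rprim_oint a b c f : a <= c <= b -> L1 a b f -> rprim a b (oint c f) f.
Proof.
move=> /andP[ac cb] lf; split => // s t as_ st tb; rewrite /oint.
have [cs|sc] := lerP c s.
  by rewrite (le_trans cs st) (Rint_split (L1_sub ac (lexx b) lf) cs st tb); ring.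
have ls : L1 s b f by exact: (L1_sub as_ (lexx b) lf).
have [ct|tc] := lerP c t; first by rewrite (Rint_split ls (ltW sc) ct tb); ring.
by rewrite (Rint_split ls st (ltW tc) cb); ring.
Qed.

Lemma ointcc c f : oint c f c = 0.
Proof. by rewrite /oint lexx set_itv1 Rintegral_set1. Qed.

Lemma rprim_oint_eq a b c f df t : a <= c <= b -> rprim a b f df -> f c = 0 ->
  a <= t <= b -> f t = oint c df t.
Proof.
move=> /andP[ac cb] [_ pf] fc /andP[at_ tb]; rewrite /oint.
by have [ct|/ltW tc] := lerP c t; rewrite -pf // fc; ring.
Qed.

Lemma oint_norm_le a b c f g t : a <= c <= b -> a <= t <= b -> L1 a b f ->
  L1 a b g -> (forall x, a <= x <= b -> `|f x| <= g x) ->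
  `|oint c f t| <= `|oint c g t|.
Proof.
move=> /andP[ac cb] /andP[at_ tb] lf lg fg.
have key s u : a <= s -> u <= b ->
   `|\int[mu]_(x in `[s, u]) f x| <= `|\int[mu]_(x in `[s, u]) g x|.
  move=> as_ ub; have lf' : L1 s u f by exact: L1_sub lf.
  have lg' : L1 s u g by exact: L1_sub lg.
  rewrite (le_trans (le_normr_Rintegral _ lf')) //.
  rewrite (le_trans _ (ler_norm _)) //; apply: le_Rintegral => //.
    exact: L1_norm.
  by move=> x; rewrite /= in_itv /= => /andP[? ?]; apply: fg; apply/andP; split; lra.
by rewrite /oint; case: ifP => _; rewrite ?normrN; exact: key.
Qed.

Lemma ointD a b c f g t : a <= c <= b -> a <= t <= b -> L1 a b f -> L1 a b g ->
  oint c (fun x => f x + g x) t = oint c f t + oint c g t.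
Proof.
move=> cab tab lf lg.
rewrite -(rprim_oint_eq cab (rprimD (rprim_oint cab lf) (rprim_oint cab lg))) //.
by rewrite !ointcc addr0.
Qed.

Lemma oint_ge0 c f t : (forall x, 0 <= f x) -> c <= t -> 0 <= oint c f t.
Proof. by move=> f0 ct; rewrite /oint ct; exact: Rintegral_ge0. Qed.

Lemma oint_le0 c f t : (forall x, 0 <= f x) -> t <= c -> oint c f t <= 0.
Proof.
move=> f0; rewrite le_eqVlt => /predU1P[->|tc]; first by rewrite ointcc.
by rewrite /oint (lt_geF tc) oppr_le0; exact: Rintegral_ge0.
Qed.

(** An equality, not just a bound: integrals of nonnegative functions from [c] to the same [t] have
    a common sign. It lets the entrywise norm pass through the integral. *)
Lemma oint_normD a b c f g t : a <= c <= b -> a <= t <= b ->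
  L1 a b f -> L1 a b g -> (forall x, 0 <= f x) -> (forall x, 0 <= g x) ->
  `|oint c (fun x => f x + g x) t| = `|oint c f t| + `|oint c g t|.
Proof.
move=> cab tab lf lg f0 g0; rewrite (ointD cab tab lf lg).
have [ct|/ltW tc] := lerP c t.
  by rewrite !ger0_norm ?addr_ge0 ?oint_ge0.
by rewrite !ler0_norm ?oint_le0 //; [ring | rewrite -oppr_ge0 opprD addr_ge0 // oppr_ge0 oint_le0].
Qed.

Lemma rprimX a b f df n : rprim a b f df ->
  rprim a b (fun t => f t ^+ n.+1) (fun t => n.+1%:R * f t ^+ n * df t).
Proof.
move=> pf; elim: n => [|n IH].
  by apply: rprim_eq pf => t; rewrite ?expr1 // expr0 mulr1 mul1r.
apply: rprim_eq (rprimM pf IH) => t; first by rewrite [RHS]exprS.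
by rewrite -[in RHS](addn1 n.+1) natrD (exprS (f t) n); ring.
Qed.

(* The iterated-integral bound behind the convergence of the Peano-Baker
   series. *)
Lemma oint_pow_le a b c f h K j t : a <= c <= b -> a <= t <= b ->
  L1 a b f -> L1 a b h -> (forall x, 0 <= h x) -> 0 <= K ->
  (forall x, a <= x <= b -> `|f x| <= h x * (K * (`|oint c h x| ^+ j / j`!%:R))) ->
  `|oint c f t| <= K * (`|oint c h t| ^+ j.+1 / j.+1`!%:R).
Proof.
move=> cab tab lf lh h0 K0 fh.
pose L := oint c h; have pL : rprim a b L h by exact: rprim_oint.
have [M M0 LM] := rprim_bounded pL.
have pX := rprimZ (K / j.+1`!%:R) (rprimX j pL).
pose g x := K / j.+1`!%:R * (j.+1%:R * L x ^+ j * h x).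
have lg : L1 a b g by case: pX.
have -> : K * (`|oint c h t| ^+ j.+1 / j.+1`!%:R) = `|oint c g t|.
  rewrite -(rprim_oint_eq cab pX _ tab); last by rewrite /L ointcc expr0n mulr0.
  by rewrite normrM normrX normf_div (ger0_norm K0) [`|j.+1`!%:R|]ger0_norm //;
    rewrite mulrAC mulrA.
(* On one side of [c] the sign of [L] is fixed, so [|L| ^+ j] is a constant sign times [L ^+ j] and
   can be integrated by the power rule. *)
have key s u sg : a <= s -> u <= b -> s <= c <= u -> s <= t <= u -> `|sg| = 1 ->
    (forall x, s <= x <= u -> `|L x| ^+ j = sg * L x ^+ j) ->
    `|oint c f t| <= `|oint c g t|.
  move=> as_ ub csu tsu sg1 sgL.
  have pX' := rprim_sub as_ ub (rprimZ sg pX).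
  have -> : `|oint c g t| = `|oint c (fun x => sg * g x) t|.
    rewrite -(rprim_oint_eq csu pX' _ tsu); last first.
      by rewrite /L ointcc expr0n /= !mulr0.
    rewrite -(rprim_oint_eq csu (rprim_sub as_ ub pX) _ tsu); last first.
      by rewrite /L ointcc expr0n /= !mulr0.
    by rewrite [RHS]normrM sg1 mul1r.
  apply: (oint_norm_le csu tsu); [exact: (L1_sub as_ ub lf) | by case: pX' |].
  move=> x /andP[sx xu]; have xab : a <= x <= b by apply/andP; split; lra.
  rewrite (le_trans (fh _ xab)) // -/L sgL ?sx // /g.
  have j0 : (j.+1%:R : R) != 0 by rewrite pnatr_eq0.
  have f0 : (j`!%:R : R) != 0 by rewrite pnatr_eq0 -lt0n fact_gt0.
  rewrite factS natrM le_eqVlt; apply/orP; left; apply/eqP; field.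
  by rewrite f0 addrC natr1 j0.
have [/andP[ac cb] /andP[at_ tb]] := (cab, tab).
have [ct|/ltW tc] := lerP c t.
  apply: (key c t 1); rewrite ?lexx ?ct ?normr1 // => x /andP[cx _].
  by rewrite mul1r ger0_norm // oint_ge0.
apply: (key t c ((-1) ^+ j)); rewrite ?lexx ?tc ?normrX ?normrN1 ?expr1n //.
by move=> x /andP[_ xc]; rewrite ler0_norm ?oint_le0 // -exprNn.
Qed.

End OrientedIntegrals.

Section EntrywiseNorm.
Context {R : realType}.
Implicit Types (x y : R[i]) (k l m : nat).

(** A norm with values in [R] rather than in [R[i]], so that bounds can be integrated; it is
    submultiplicative and dominates both real and imaginary parts. *)
Definition nC x : R := `|complex.Re x| + `|complex.Im x|.

Lemma nC_ge0 x : 0 <= nC x. Proof. exact: addr_ge0. Qed.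

Lemma nCD x y : nC (x + y) <= nC x + nC y.
Proof.
rewrite /nC cReD cImD addrACA; apply: lerD; exact: ler_normD.
Qed.

Lemma nCM x y : nC (x * y) <= nC x * nC y.
Proof.
rewrite /nC cReM cImM.
apply: (le_trans (lerD (ler_normB _ _) (ler_normD _ _))).
by rewrite !normrM le_eqVlt; apply/orP; left; apply/eqP; ring.
Qed.

Lemma nC0 : nC 0 = 0. Proof. by rewrite /nC /= normr0 addr0. Qed.

Definition nM k l (M : 'M[R[i]]_(k, l)) : R := \sum_i \sum_j nC (M i j).

Lemma nM_ge0 k l (M : 'M[R[i]]_(k, l)) : 0 <= nM M.
Proof. by do 2 apply: sumr_ge0 => ? _; exact: nC_ge0. Qed.

Lemma nC_sum (I : finType) (F : I -> R[i]) : nC (\sum_i F i) <= \sum_i nC (F i).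
Proof.
elim/big_ind2: _ => [|x a y b xa yb|//]; first by rewrite nC0.
by apply: le_trans (nCD _ _) _; exact: lerD.
Qed.

Lemma nM_entry k l (M : 'M[R[i]]_(k, l)) i j : nC (M i j) <= nM M.
Proof.
rewrite /nM (bigD1 i) //= (bigD1 j) //= -addrA lerDl addr_ge0 //.
  by apply: sumr_ge0 => ? _; exact: nC_ge0.
by do 2 apply: sumr_ge0 => ? _; exact: nC_ge0.
Qed.

Lemma nMD k l (M N : 'M[R[i]]_(k, l)) : nM (M + N) <= nM M + nM N.
Proof.
rewrite -big_split; apply: ler_sum => i _; rewrite -big_split.
by apply: ler_sum => j _; rewrite mxE nCD.
Qed.

Lemma nM_mul k l m (M : 'M[R[i]]_(k, l)) (N : 'M[R[i]]_(l, m)) :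
  nM (M *m N) <= nM M * nM N.
Proof.
rewrite /nM mulr_suml; apply: ler_sum => i _.
have H z : \sum_j nC (M i z) * nC (N z j) <= nC (M i z) * nM N.
  rewrite -mulr_sumr ler_wpM2l ?nC_ge0 // /nM (bigD1 z) //= lerDl.
  by do 2 apply: sumr_ge0 => ? _; exact: nC_ge0.
rewrite mulr_suml; apply: le_trans (ler_sum _ (fun z _ => H z)).
rewrite exchange_big; apply: ler_sum => j _; rewrite mxE.
apply: le_trans (nC_sum _) _; apply: ler_sum => z _; exact: nCM.
Qed.

End EntrywiseNorm.

(** * Entrywise limits of complex matrix sequences *)

Section MatrixLimits.
Context {R : realType}.
Implicit Types (k l m : nat) (x y : R[i]).

Definition ccvg (u : nat -> R[i]) x :=
  (complex.Re (u n) @[n --> \oo] --> complex.Re x) /\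
  (complex.Im (u n) @[n --> \oo] --> complex.Im x).

Lemma ccvg_cst x : ccvg (fun=> x) x.
Proof. by split; exact: cvg_cst. Qed.

Lemma ccvg_eq u v x : (forall n, u n = v n) -> ccvg u x -> ccvg v x.
Proof. by move=> /funext ->. Qed.

Lemma ccvgD u v x y : ccvg u x -> ccvg v y -> ccvg (fun n => u n + v n) (x + y).
Proof.
move=> [u1 u2] [v1 v2]; split.
  by rewrite cReD; under eq_cvg do rewrite cReD; exact: cvgD.
by rewrite cImD; under eq_cvg do rewrite cImD; exact: cvgD.
Qed.

Lemma ccvgM u v x y : ccvg u x -> ccvg v y -> ccvg (fun n => u n * v n) (x * y).
Proof.
move=> [u1 u2] [v1 v2]; split.
  by rewrite cReM; under eq_cvg do rewrite cReM; apply: cvgB; exact: cvgM.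
by rewrite cImM; under eq_cvg do rewrite cImM; apply: cvgD; exact: cvgM.
Qed.

Lemma ccvg_sum (I : finType) (u : I -> nat -> R[i]) (x : I -> R[i]) :
  (forall i, ccvg (u i) (x i)) -> ccvg (fun n => \sum_i u i n) (\sum_i x i).
Proof.
move=> ux; elim: (index_enum I) => [|i r IH].
  by rewrite big_nil; apply: ccvg_eq (ccvg_cst 0) => n; rewrite big_nil.
by rewrite big_cons; apply: ccvg_eq (ccvgD (ux i) IH) => n; rewrite big_cons.
Qed.

Lemma ccvg_unique u x y : ccvg u x -> ccvg u y -> x = y.
Proof.
move=> [u1 u2] [v1 v2]; apply: complexP.
  by rewrite -(cvg_lim _ u1) // -(cvg_lim _ v1).
by rewrite -(cvg_lim _ u2) // -(cvg_lim _ v2).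
Qed.

Definition mcvg k l (u : nat -> 'M[R[i]]_(k, l)) (M : 'M[R[i]]_(k, l)) :=
  forall i j, ccvg (fun n => u n i j) (M i j).

Lemma mcvg_cst k l (M : 'M[R[i]]_(k, l)) : mcvg (fun=> M) M.
Proof. by move=> i j; exact: ccvg_cst. Qed.

Lemma mcvgM k l m (u : nat -> 'M[R[i]]_(k, l)) (v : nat -> 'M[R[i]]_(l, m)) M N :
  mcvg u M -> mcvg v N -> mcvg (fun n => u n *m v n) (M *m N).
Proof.
move=> uM vN i j; rewrite mxE.
apply: ccvg_eq (ccvg_sum (fun z => ccvgM (uM i z) (vN z j))) => n.
by rewrite mxE.
Qed.

Lemma mcvg_unique k l (u : nat -> 'M[R[i]]_(k, l)) M N :
  mcvg u M -> mcvg u N -> M = N.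
Proof. by move=> uM uN; apply/matrixP => i j; exact: ccvg_unique (uM i j) (uN i j). Qed.

Lemma ccvgJ u x : ccvg u x -> ccvg (fun n => Num.conj (u n)) (Num.conj x).
Proof.
move=> [u1 u2]; split.
  by rewrite cReJ; under eq_cvg do rewrite cReJ.
by rewrite cImJ; under eq_cvg do rewrite cImJ; exact: cvgN.
Qed.

Lemma mcvgJ k l (u : nat -> 'M[R[i]]_(k, l)) M : mcvg u M ->
  mcvg (fun n => (u n) ^t*) (M ^t*).
Proof.
move=> uM i j; rewrite !mxE.
by apply: ccvg_eq (ccvgJ (uM j i)) => n; rewrite !mxE.
Qed.

Lemma mcvgD k l (u v : nat -> 'M[R[i]]_(k, l)) M N : mcvg u M -> mcvg v N ->
  mcvg (fun n => u n + v n) (M + N).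
Proof.
move=> uM vN i j; rewrite mxE.
by apply: ccvg_eq (ccvgD (uM i j) (vN i j)) => n; rewrite mxE.
Qed.

Lemma mcvg_shift k l (u : nat -> 'M[R[i]]_(k, l)) M n0 :
  mcvg (fun n => u (n + n0)%N) M <-> mcvg u M.
Proof.
split=> uM i j; have [u1 u2] := uM i j; split.
- by rewrite -(cvg_shiftn n0).
- by rewrite -(cvg_shiftn n0).
- by rewrite (cvg_shiftn n0 (fun n => complex.Re (u n i j))).
- by rewrite (cvg_shiftn n0 (fun n => complex.Im (u n i j))).
Qed.

(** Passes to the limit in identities that hold only from some index on, namely once the horizon
    exceeds the time considered. *)
Lemma mcvg_unique_from k l (u v : nat -> 'M[R[i]]_(k, l)) M N n0 :
  (forall n, (n0 <= n)%N -> u n = v n) -> mcvg u M -> mcvg v N -> M = N.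
Proof.
move=> uv /(mcvg_shift _ _ n0).2 uM /(mcvg_shift _ _ n0).2 vN.
apply: mcvg_unique uM _.
by rewrite (_ : (fun n => _) = (fun n => v (n + n0)%N)) //;
  apply/funext => n; rewrite uv // leq_addl.
Qed.

End MatrixLimits.


(** * Peano-Baker series and existence for linear equations *)

Section PeanoBaker.
Context {R : realType}.
Local Notation mu := (@lebesgue_measure R).
Implicit Types (a b c s t : R) (k l : nat).

Lemma L1_nC a b (f : R -> R[i]) : cLp E1 a b f -> L1 a b (fun t => nC (f t)).
Proof. by move=> [[_ lr] [_ li]]; apply: L1D; exact: L1_norm. Qed.

Lemma L1_sum a b (I : finType) (F : I -> R -> R) :
  (forall i, L1 a b (F i)) -> L1 a b (fun t => \sum_i F i t).
Proof.
move=> lF; elim: (index_enum I) => [|i r IH].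
  under [X in L1 _ _ X]eq_fun do rewrite big_nil.
  exact: L1_cst.
under [X in L1 _ _ X]eq_fun do rewrite big_cons.
exact: L1D.
Qed.

Lemma L1_nM a b k l (M : R -> 'M[R[i]]_(k, l)) : mLp E1 a b M ->
  L1 a b (fun t => nM (M t)).
Proof. by move=> lM; do 2 apply: L1_sum => ?; exact: L1_nC. Qed.

Definition moint c k l (M : R -> 'M[R[i]]_(k, l)) t : 'M[R[i]]_(k, l) :=
  \matrix_(i, j) (oint c (fun x => complex.Re (M x i j)) t +i*
                  oint c (fun x => complex.Im (M x i j)) t).

Lemma mprim_moint a b c k l (M : R -> 'M[R[i]]_(k, l)) : a <= c <= b ->
  mLp E1 a b M -> mprim a b (moint c M) M.
Proof.
move=> cab lM i j; have [[_ lr] [_ li]] := lM i j.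
by split; [apply: rprim_eq (rprim_oint cab lr) | apply: rprim_eq (rprim_oint cab li)]
  => // t; rewrite mxE.
Qed.

Lemma mointcc c k l (M : R -> 'M[R[i]]_(k, l)) : moint c M c = 0.
Proof. by apply/matrixP => i j; rewrite !mxE !ointcc. Qed.

Lemma oint_norm_sum a b c (I : finType) (F : I -> R -> R) t :
  a <= c <= b -> a <= t <= b ->
  (forall i, L1 a b (F i)) -> (forall i x, 0 <= F i x) ->
  `|oint c (fun x => \sum_i F i x) t| = \sum_i `|oint c (F i) t|.
Proof.
move=> cab tab lF F0.
suff [-> _ _] : [/\ `|oint c (fun x => \sum_i F i x) t| = \sum_i `|oint c (F i) t|,
  L1 a b (fun x => \sum_i F i x) & forall x, 0 <= \sum_i F i x] by [].
elim: (index_enum I) => [|i r [IH lr r0]].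
  rewrite big_nil; under [X in oint _ X]eq_fun do rewrite big_nil.
  under [X in L1 _ _ X]eq_fun do rewrite big_nil.
  split; [|exact: L1_cst | by move=> x; rewrite big_nil].
  by rewrite -(rprim_oint_eq cab (rprim_cst a b 0)) ?normr0.
rewrite big_cons; under [X in oint _ X]eq_fun do rewrite big_cons.
under [X in L1 _ _ X]eq_fun do rewrite big_cons.
split; [|exact: L1D | by move=> x; rewrite big_cons addr_ge0].
by rewrite (oint_normD cab tab) // IH.
Qed.

Lemma nM_moint_le a b c k l (M : R -> 'M[R[i]]_(k, l)) t :
  a <= c <= b -> a <= t <= b -> mLp E1 a b M ->
  nM (moint c M t) <= `|oint c (fun x => nM (M x)) t|.
Proof.
move=> cab tab lM.
rewrite (oint_norm_sum cab tab) => [|i|i x]; last 2 first.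
- by apply: L1_sum => j; exact: L1_nC.
- by apply: sumr_ge0 => j _; exact: nC_ge0.
apply: ler_sum => i _; rewrite (oint_norm_sum cab tab) => [|j|j x]; last 2 first.
- exact: L1_nC.
- exact: nC_ge0.
apply: ler_sum => j _; have [[_ lr] [_ li]] := lM i j.
rewrite mxE /nC /= (oint_normD cab tab) //; try exact: L1_norm.
by apply: lerD; apply: (oint_norm_le cab tab) => //; exact: L1_norm.
Qed.

(** Dominated convergence of the derivatives carries the increment formula to the limit; uniform
    convergence of the functions is not involved. *)
Lemma rprim_lim a b (F dF : nat -> R -> R) (f df g : R -> R) :
  (forall n, rprim a b (F n) (dF n)) -> L1 a b g ->
  (forall n t, a <= t <= b -> `|dF n t| <= g t) ->
  (forall t, a <= t <= b -> F n t @[n --> \oo] --> f t) ->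
  (forall t, a <= t <= b -> dF n t @[n --> \oo] --> df t) ->
  rprim a b f df.
Proof.
move=> pF lg Fg Ff dFdf.
have dct s t : a <= s -> t <= b -> L1 s t df /\
    (\int[mu]_(x in `[s, t]) dF n x) @[n --> \oo] --> \int[mu]_(x in `[s, t]) df x.
  move=> as_ tb.
  have in_ab x : `[s, t]%classic x -> a <= x <= b.
    by rewrite /= in_itv /= => /andP[? ?]; apply/andP; split; lra.
  have mdF n : measurable_fun `[s, t] (EFin \o dF n).
    by have [ld _] := pF n; have /integrableP[] := L1_sub as_ tb ld.
  have cdF x : `[s, t]%classic x -> (dF n x)%:E @[n --> \oo] --> (df x)%:E.
    by move=> xst; apply: cvg_EFin; [exact: nearW | apply: dFdf; exact: in_ab].
  have mdf : measurable_fun `[s, t] (EFin \o df).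
    by apply: (emeasurable_fun_cvg (fun n x => (dF n x)%:E)).
  have lg' : mu.-integrable `[s, t] (EFin \o g) by exact: (L1_sub as_ tb lg).
  have adF : {ae mu, forall x, `[s, t]%classic x ->
      (dF n x)%:E @[n --> \oo] --> (EFin \o df) x} by exact: aeW.
  have bdF : {ae mu, forall x, forall n, `[s, t]%classic x ->
      (`|(dF n x)%:E| <= (EFin \o g) x)%E}.
    by apply: aeW => x n xst; rewrite /= lee_fin Fg // in_ab.
  have [ldf _ cv] := @dominated_convergence _ _ _ mu _ (measurable_itv _)
    (fun n x => (dF n x)%:E) (EFin \o df) (EFin \o g) mdF mdf adF lg' bdF.
  split => //; apply: fine_cvg.
  by rewrite fineK //; exact: integrable_fin_num.
have [lab _] := dct a b (lexx _) (lexx _).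
split => // s t as_ st tb; have [_ cv] := dct s t as_ tb.
have tab : a <= t <= b by rewrite tb (le_trans as_).
have sab : a <= s <= b by rewrite as_ (le_trans st).
have cFF : (F n t - F n s) @[n --> \oo] --> f t - f s.
  by apply: cvgB; exact: Ff.
have E : (fun n => F n t - F n s) = (fun n => \int[mu]_(x in `[s, t]) dF n x).
  by apply/funext => n; have [_ ->] := pF n.
rewrite E in cFF.
by rewrite -(cvg_lim _ cFF) // -(cvg_lim _ cv).
Qed.

Lemma nC_Re (x : R[i]) : `|complex.Re x| <= nC x.
Proof. by rewrite lerDl. Qed.

Lemma nC_Im (x : R[i]) : `|complex.Im x| <= nC x.
Proof. by rewrite lerDr. Qed.

Lemma mprim_lim a b k l (F dF : nat -> R -> 'M[R[i]]_(k, l))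
    (f df : R -> 'M[R[i]]_(k, l)) (g : R -> R) :
  (forall n, mprim a b (F n) (dF n)) -> L1 a b g ->
  (forall n t, a <= t <= b -> nM (dF n t) <= g t) ->
  (forall t, a <= t <= b -> mcvg (fun n => F n t) (f t)) ->
  (forall t, a <= t <= b -> mcvg (fun n => dF n t) (df t)) ->
  mprim a b f df.
Proof.
move=> pF lg Fg Ff dFdf i j; split.
  apply: (rprim_lim (fun n => (pF n i j).1) lg).
  - move=> n t tab; apply: le_trans (nC_Re _) (le_trans (nM_entry _ _ _) (Fg n t tab)).
  - by move=> t tab; have [] := Ff t tab i j.
  - by move=> t tab; have [] := dFdf t tab i j.
apply: (rprim_lim (fun n => (pF n i j).2) lg).
- move=> n t tab; apply: le_trans (nC_Im _) (le_trans (nM_entry _ _ _) (Fg n t tab)).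
- by move=> t tab; have [] := Ff t tab i j.
- by move=> t tab; have [] := dFdf t tab i j.
Qed.

Lemma Re_sum (I : Type) (r : seq I) (F : I -> R[i]) :
  complex.Re (\sum_(i <- r) F i) = \sum_(i <- r) complex.Re (F i).
Proof. by elim/big_ind2: _ => // x a y b <- <-; rewrite cReD. Qed.

Lemma Im_sum (I : Type) (r : seq I) (F : I -> R[i]) :
  complex.Im (\sum_(i <- r) F i) = \sum_(i <- r) complex.Im (F i).
Proof. by elim/big_ind2: _ => // x a y b <- <-; rewrite cImD. Qed.

(** The solution is chosen before the interval: all terms of the series are integrals from [c], so a
    single [Z] serves every interval around [c] and no gluing occurs. *)
Theorem linear_ode k l (M : R -> 'M[R[i]]_k) (Z0 : 'M[R[i]]_(k, l)) c :
  exists Z, Z c = Z0 /\ forall a b, a <= c <= b -> mLp E1 a b M ->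
    mprim a b Z (fun t => M t *m Z t).
Proof.
(* The terms of the Peano-Baker series. *)
pose W := fix W j : R -> 'M[R[i]]_(k, l) :=
  if j is j'.+1 then moint c (fun t => M t *m W j' t) else fun=> Z0.
pose S n t := \sum_(j < n) W j t.
pose re t p q j := complex.Re (W j t p q).
pose im t p q j := complex.Im (W j t p q).
pose Z t : 'M[R[i]]_(k, l) :=
  \matrix_(p, q) (limn (series (re t p q)) +i* limn (series (im t p q))).
have Wc j : W j c = if j is 0%N then Z0 else 0.
  by case: j => [//|j]; rewrite /= mointcc.
have Zc : Z c = Z0.
  have E (u : nat -> R) x : u 0%N = x -> (forall j, u j.+1 = 0) -> limn (series u) = x.
    move=> u0 uS; apply: cvg_lim => //; rewrite -(cvg_shiftn 1) /=.
    rewrite (_ : (fun n => series u (n + 1)%N) = fun=> x); first exact: cvg_cst.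
    apply/funext => n; rewrite /series /= addn1 big_nat_recl // u0 big1 ?addr0 //.
  apply/matrixP => p q; rewrite mxE; apply: complexP => /=.
    by apply: E => [|j]; rewrite /re Wc // mxE.
  by apply: E => [|j]; rewrite /im Wc // mxE.
exists Z; split => // a b cab lM.
pose h t := nM (M t); pose L := oint c h.
have lh : L1 a b h by exact: L1_nM.
have pL : rprim a b L h by exact: rprim_oint.
have pW j : exists dW, mprim a b (W j) dW.
  elim: j => [|j [dW pW]]; first by exists (fun=> 0); exact: mprim_cst.
  exists (fun t => M t *m W j t); apply: mprim_moint => //.
  exact: (mLpM (p := E1) (q := Eoo) isT lM (mprim_Loo pW)).
have lMW j : mLp E1 a b (fun t => M t *m W j t).
  have [dW pWj] := pW j.
  exact: (mLpM (p := E1) (q := Eoo) isT lM (mprim_Loo pWj)).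
have pWS j : mprim a b (W j.+1) (fun t => M t *m W j t) by exact: mprim_moint.
have K0 : 0 <= nM Z0 by exact: nM_ge0.
have bW j t : a <= t <= b -> nM (W j t) <= nM Z0 * (`|L t| ^+ j / j`!%:R).
  elim: j t => [|j IH] t tab; first by rewrite expr0 fact0 divr1 mulr1.
  apply: le_trans (nM_moint_le cab tab (lMW j)) _.
  apply: (oint_pow_le cab tab) => //; first exact: L1_nM.
    by move=> x; exact: nM_ge0.
  move=> x xab; rewrite ger0_norm ?nM_ge0 //.
  by apply: le_trans (nM_mul _ _) _; rewrite ler_wpM2l ?nM_ge0 // IH.
(* A bound [B] for [|L|] dominates the terms of the series, uniformly in time, by those of [nM Z0]
   times the exponential series at [B]. *)
have [B B0 LB] := rprim_bounded pL.
pose e := series (exp_coeff B).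
have ce : cvgn e by exact: is_cvg_series_exp_coeff.
have bW' j t : a <= t <= b -> nM (W j t) <= nM Z0 * exp_coeff B j.
  move=> tab; apply: le_trans (bW j t tab) _; rewrite ler_wpM2l //.
  rewrite /exp_coeff /= ler_wpM2r ?invr_ge0 //.
  by rewrite lerXn2r ?nnegrE // LB.
have cvW t (u : nat -> R) : a <= t <= b -> (forall j, `|u j| <= nM (W j t)) ->
    cvgn (series u).
  move=> tab uW; apply: normed_cvg.
  apply: (@series_le_cvg _ _ (fun j => nM Z0 * exp_coeff B j)) => [j|j|j|].
  - exact: normr_ge0.
  - by rewrite mulr_ge0 // exp_coeff_ge0.
  - exact: le_trans (uW j) (bW' j t tab).
  - exact: is_cvg_seriesZ.
have cS t : a <= t <= b -> mcvg (fun n => S n t) (Z t).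
  move=> tab p q; split; rewrite mxE /=.
    rewrite (_ : (fun n => _) = series (re t p q)).
      apply: (cvW t (re t p q) tab) => j; exact: le_trans (nC_Re _) (nM_entry _ _ _).
    by apply/funext => n; rewrite /S summxE Re_sum /series /= big_mkord.
  rewrite (_ : (fun n => _) = series (im t p q)).
    apply: (cvW t (im t p q) tab) => j; exact: le_trans (nC_Im _) (nM_entry _ _ _).
  by apply/funext => n; rewrite /S summxE Im_sum /series /= big_mkord.
have bS n t : a <= t <= b -> nM (S n t) <= nM Z0 * limn e.
  move=> tab; apply: (@le_trans _ _ (nM Z0 * e n)).
    rewrite /S /e /series /= big_mkord mulr_sumr.
    elim: n => [|n IH].
      by rewrite !big_ord0 /nM big1 // => i _; rewrite big1 // => j _; rewrite mxE nC0.
    by rewrite !big_ord_recr /= (le_trans (nMD _ _)) // lerD // bW'.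
  rewrite ler_wpM2l // nondecreasing_cvgn_le //.
  by apply: nondecreasing_series => j _ _; exact: exp_coeff_ge0.
have pS n : mprim a b (S n.+1) (fun t => M t *m S n t).
  elim: n => [|n IH].
    apply: mprim_eq (mprim_cst a b Z0) => t; rewrite /S ?big_ord1 //.
    by rewrite big_ord0 mulmx0.
  apply: mprim_eq (mprimD IH (pWS n)) => t; rewrite /S ?[RHS]big_ord_recr //.
  by rewrite [in RHS]big_ord_recr mulmxDr.
(* Each partial sum has [M] times the preceding one as derivative, and [limn e] is the exponential
   of [B], so [nM Z0 * limn e * nM (M t)] dominates all these derivatives. *)
apply: (mprim_lim (F := fun n => S n.+1) pS
   (g := fun t => nM Z0 * limn e * nM (M t))).
- exact: L1Z.
- move=> n t tab; rewrite mulrC; apply: le_trans (nM_mul _ _) _.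
  by rewrite ler_wpM2l ?nM_ge0 // bS.
- move=> t tab p q; have [c1 c2] := cS t tab p q; split.
    by rewrite (cvg_shiftS (fun n => complex.Re (S n t p q))).
  by rewrite (cvg_shiftS (fun n => complex.Im (S n t p q))).
- by move=> t tab; apply: mcvgM (mcvg_cst _) (cS t tab).
Qed.

End PeanoBaker.

(** * Inverses of matrix functions *)

Section Inverses.
Context {R : realType}.
Local Notation mu := (@lebesgue_measure R).
Implicit Types (a b c s t : R) (f g : R -> R[i]) (k l : nat).

Definition sqn (x : R[i]) : R := complex.Re x ^+ 2 + complex.Im x ^+ 2.

Lemma sqn_ge0 (x : R[i]) : 0 <= sqn x.
Proof. by rewrite addr_ge0 // sqr_ge0. Qed.

Lemma sqn_eq0 (x : R[i]) : (sqn x == 0) = (x == 0).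
Proof.
rewrite /sqn paddr_eq0 ?sqr_ge0 // !sqrf_eq0.
by case: x => x y; rewrite eq_complex.
Qed.

Lemma cReV (x : R[i]) : complex.Re x^-1 = complex.Re x / sqn x.
Proof. by case: x. Qed.

Lemma cImV (x : R[i]) : complex.Im x^-1 = - (complex.Im x / sqn x).
Proof. by case: x. Qed.

(** The inverse is written as a real power, whose measurability is known; at 0 both expressions take
    the value 0. *)
Lemma measurable_sqnV a b f : cLp Eoo a b f ->
  measurable_fun `[a, b] (fun t => (sqn (f t))^-1).
Proof.
move=> [[mr _] [mi _]].
have -> : (fun t => (sqn (f t))^-1) = (fun t => sqn (f t) `^ (-1)).
  by apply/funext => t; rewrite powR_inv1 ?sqn_ge0.
apply: (measurableT_comp (measurable_powR _)).
by apply: measurable_funD; apply: measurable_funX.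
Qed.

Lemma cLp_prod a b (I : finType) (F : I -> R -> R[i]) :
  (forall i, cLp Eoo a b (F i)) -> cLp Eoo a b (fun t => \prod_i F i t).
Proof.
move=> lF; elim: (index_enum I) => [|i r IH].
  under [X in cLp _ _ _ X]eq_fun do rewrite big_nil.
  exact: cLp_cst.
under [X in cLp _ _ _ X]eq_fun do rewrite big_cons.
exact: (cLpM (p := Eoo) (q := Eoo)).
Qed.

Lemma cLp_det a b k (M : R -> 'M[R[i]]_k) :
  mLp Eoo a b M -> cLp Eoo a b (fun t => \det (M t)).
Proof.
move=> lM; apply: cLp_sum => s; apply: (cLpM (p := Eoo) (q := Eoo)) => //.
  exact: cLp_cst.
by apply: cLp_prod => i; exact: lM.
Qed.

Lemma mLp_adj a b k (M : R -> 'M[R[i]]_k) :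
  mLp Eoo a b M -> mLp Eoo a b (fun t => \adj (M t)).
Proof.
move=> lM i j; under [X in cLp _ _ _ X]eq_fun do rewrite mxE.
apply: (cLpM (p := Eoo) (q := Eoo)) => //; first exact: cLp_cst.
apply: cLp_det => p q; under [X in cLp _ _ _ X]eq_fun do rewrite !mxE.
exact: lM.
Qed.

Definition cAC a b f := exists df, cprim a b f df.

Lemma cAC_sum a b (I : finType) (F : I -> R -> R[i]) :
  (forall i, cAC a b (F i)) -> cAC a b (fun t => \sum_i F i t).
Proof.
move=> /choice[dF pF]; exists (fun t => \sum_i dF i t); exact: cprim_sum.
Qed.

Lemma cAC_prod a b (I : finType) (F : I -> R -> R[i]) :
  (forall i, cAC a b (F i)) -> cAC a b (fun t => \prod_i F i t).
Proof.
move=> aF; elim: (index_enum I) => [|i r [dg pg]].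
  under [X in cAC _ _ X]eq_fun do rewrite big_nil.
  by exists (fun=> 0); exact: cprim_cst.
under [X in cAC _ _ X]eq_fun do rewrite big_cons.
have [df pf] := aF i; eexists; exact: cprimM pf pg.
Qed.

Lemma cAC_det a b k (M dM : R -> 'M[R[i]]_k) :
  mprim a b M dM -> cAC a b (fun t => \det (M t)).
Proof.
move=> pM; apply: cAC_sum => s.
have [dp pp] : cAC a b (fun t => \prod_i M t i (perm.fun_of_perm s i)).
  by apply: cAC_prod => i; exists (fun t => dM t i (perm.fun_of_perm s i)); exact: pM.
by eexists; exact: cprimM (cprim_cst a b _) pp.
Qed.

(** The squared modulus is continuous on a compact interval and nowhere 0, so its minimum is
    positive and bounds the inverse. *)
Lemma cLpV_cAC a b f : a <= b -> cAC a b f -> (forall t, a <= t <= b -> f t != 0) ->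
  cLp Eoo a b (fun t => (f t)^-1).
Proof.
move=> ab [df pf] f0; have lf := cprim_Loo pf; have mV := measurable_sqnV lf.
have [pr pi] := pf; have ps := rprimD (rprimX 1 pr) (rprimX 1 pi).
have [c cab sqc] := EVT_min ab (rprim_cont ps).
have sc : 0 < sqn (f c).
  rewrite lt_neqAle sqn_ge0 andbT eq_sym sqn_eq0 f0 //.
have lV : Lp Eoo a b (fun t => (sqn (f t))^-1).
  split => //; exists (sqn (f c))^-1; apply: aeW => t tab.
  have le_ct : sqn (f c) <= sqn (f t) by exact: sqc.
  by rewrite ger0_norm ?invr_ge0 ?sqn_ge0 // lef_pV2 ?posrE // (lt_le_trans sc).
have [lr li] := lf; split.
  by apply: Lp_eq (LpMoo lr lV) => t; rewrite cReV.
by apply: Lp_eq (LpZ (-1) (LpMoo li lV)) => t; rewrite cImV mulN1r.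
Qed.

Lemma rprim_eq_on a b (f g df dg : R -> R) :
  (forall t, a <= t <= b -> f t = g t) ->
  (forall t, a <= t <= b -> df t = dg t) -> rprim a b f df -> rprim a b g dg.
Proof.
move=> fg dfg [ld pf]; split.
  apply: eq_integrable ld => // t; rewrite inE /= in_itv /= => tab.
  by rewrite /= dfg.
move=> s t as_ st tb; rewrite -!fg; last 2 first.
- by apply/andP; split; lra.
- by apply/andP; split; lra.
by rewrite pf //; apply: eq_Rint => x /andP[? ?]; apply: dfg; apply/andP; split; lra.
Qed.

Lemma mprim_eq_on a b k l (M N dM dN : R -> 'M[R[i]]_(k, l)) :
  (forall t, a <= t <= b -> M t = N t) ->
  (forall t, a <= t <= b -> dM t = dN t) -> mprim a b M dM -> mprim a b N dN.
Proof.
move=> MN dMN pM i j; have [pr pi] := pM i j; split.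
  by apply: rprim_eq_on pr => t tab; rewrite ?MN ?dMN.
by apply: rprim_eq_on pi => t tab; rewrite ?MN ?dMN.
Qed.

Lemma Lp_eq_on p a b (f g : R -> R) : (forall t, a <= t <= b -> f t = g t) ->
  Lp p a b f -> Lp p a b g.
Proof.
move=> fg [mf lf]; split.
  apply: eq_measurable_fun mf => t; rewrite inE /= in_itv /=; exact: fg.
case: p lf => [lf|lf|[M fM]].
- by apply: eq_integrable lf => // t; rewrite inE /= in_itv /= => tab; rewrite /= fg.
- by apply: eq_integrable lf => // t; rewrite inE /= in_itv /= => tab; rewrite /= fg.
- exists M; apply: aeS fM => t + tab => /(_ tab).
  by rewrite fg //; move: tab; rewrite /= in_itv.
Qed.

Lemma mLp_eq_on p a b k l (M N : R -> 'M[R[i]]_(k, l)) :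
  (forall t, a <= t <= b -> M t = N t) -> mLp p a b M -> mLp p a b N.
Proof.
move=> MN lM i j; have [lr li] := lM i j; split.
  by apply: Lp_eq_on lr => t tab; rewrite MN.
by apply: Lp_eq_on li => t tab; rewrite MN.
Qed.

Lemma mLp_inv a b k (X dX : R -> 'M[R[i]]_k) : a <= b -> mprim a b X dX ->
  (forall t, a <= t <= b -> X t \in unitmx) ->
  mLp Eoo a b (fun t => invmx (X t)).
Proof.
move=> ab pX uX.
apply: (mLp_eq_on (M := fun t => (\det (X t))^-1 *: \adj (X t))).
  by move=> t tab; rewrite /invmx uX.
move=> i j; under [X in cLp _ _ _ X]eq_fun do rewrite mxE.
have lV : cLp Eoo a b (fun t => (\det (X t))^-1).
  apply: cLpV_cAC ab (cAC_det pX) _ => t /uX.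
  by rewrite unitmxE unitfE.
exact: (cLpM (p := Eoo) (q := Eoo) isT lV (mLp_adj (mprim_Loo pX) i j)).
Qed.

(* [Y] solves the linear equation [Y' = - Y (X' X^-1)] with [Y a = (X a)^-1],
   so that [Y X] is constant. *)
Lemma mprim_inv a b k (X dX : R -> 'M[R[i]]_k) : a <= b -> mprim a b X dX ->
  (forall t, a <= t <= b -> X t \in unitmx) ->
  mprim a b (fun t => invmx (X t)) (fun t => - (invmx (X t) *m dX t *m invmx (X t))).
Proof.
move=> ab pX uX; pose M t := dX t *m invmx (X t).
have lM : mLp E1 a b M.
  exact: (mLpM (p := E1) (q := Eoo) isT (mprim_L1 pX) (mLp_inv ab pX uX)).
have aab : a <= a <= b by rewrite lexx.
have [Y' [Y'a pY']] := linear_ode (fun t => - (M t)^T) (invmx (X a))^T a.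
have lMT : mLp E1 a b (fun t => - (M t)^T).
  apply: mLpN => i j; under [X in cLp _ _ _ X]eq_fun do rewrite mxE.
  exact: lM.
pose Y t := (Y' t)^T.
have pY : mprim a b Y (fun t => - (Y t *m M t)).
  apply: mprim_eq (mprim_trmx (pY' a b aab lMT)) => // t.
  by rewrite mulNmx linearN /= trmx_mul trmxK.
have YX t : a <= t <= b -> Y t *m X t = 1%:M.
  move=> tab; have p0 := mprimM pY pX.
  have p0' : mprim a b (fun t => Y t *m X t) (fun=> 0).
    apply: mprim_eq_on p0 => // u uab.
    by rewrite mulNmx /M -!mulmxA mulVmx ?uX // mulmx1 addNr.
  rewrite (mprim_const p0' tab aab) /Y Y'a trmxK mulVmx // uX //.
have YE t : a <= t <= b -> Y t = invmx (X t).
  by move=> tab; rewrite -[LHS](mulmxK (uX t tab)) YX // mul1mx.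
apply: mprim_eq_on pY => // t tab.
by rewrite YE // /M mulmxA.
Qed.

End Inverses.

(** * Fundamental solutions and uniqueness *)

Section Fundamental.
Context {R : realType}.
Implicit Types (T : set R) (a b c s t : R) (k l : nat).

Definition mLpT p T k l (M : R -> 'M[R[i]]_(k, l)) :=
  forall a b, T a -> T b -> a <= b -> mLp p a b M.

Definition mprimT T k l (M dM : R -> 'M[R[i]]_(k, l)) :=
  forall a b, T a -> T b -> a <= b -> mprim a b M dM.

Lemma linear_odeT T k l (M : R -> 'M[R[i]]_k) (Z0 : 'M[R[i]]_(k, l)) c : T c ->
  mLpT E1 T M -> exists Z, Z c = Z0 /\ mprimT T Z (fun t => M t *m Z t).
Proof.
move=> Tc lM; have [Z [Zc pZ]] := linear_ode M Z0 c; exists Z; split => //.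
move=> a b Ta Tb ab.
(* [linear_ode] asks for an interval containing the initial time, so [[a, b]] is enlarged to reach
   [c]. *)
have Tm : T (Num.min a c) by rewrite /Num.min; case: ifP.
have TM : T (Num.max b c) by rewrite /Num.max; case: ifP.
have ma : Num.min a c <= a by rewrite ge_min lexx.
have bM : b <= Num.max b c by rewrite le_max lexx.
apply: (mprim_sub ma bM); apply: pZ.
  by rewrite ge_min lexx orbT le_max lexx orbT.
by apply: lM => //; exact: le_trans (le_trans ma ab) bM.
Qed.

Lemma mprimT_const T k l (M : R -> 'M[R[i]]_(k, l)) s t : T s -> T t ->
  mprimT T M (fun=> 0) -> M s = M t.
Proof.
move=> Ts Tt pM; have [st|/ltW ts] := lerP s t.
  by apply: (mprim_const (pM s t Ts Tt st)); rewrite lexx st.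
by apply: (mprim_const (pM t s Tt Ts ts)); rewrite lexx ts.
Qed.

(** [Y] is the transpose of a solution of the adjoint equation, not an inverse taken pointwise.
    Invertibility of [Psi] is then a conclusion: [Y Psi] is constant, and a left inverse of a square
    matrix is two-sided. *)
Lemma fundamental_solution T k c (M : R -> 'M[R[i]]_k) : T c -> mLpT E1 T M ->
  exists Psi Y : R -> 'M[R[i]]_k, [/\ mprimT T Psi (fun t => M t *m Psi t),
    mprimT T Y (fun t => - (Y t *m M t)), forall t, T t -> Y t *m Psi t = 1%:M
    & forall t, T t -> Psi t *m Y t = 1%:M].
Proof.
move=> Tc lM.
have [Psi [Psic pPsi]] := linear_odeT 1%:M Tc lM.
have lMT : mLpT E1 T (fun t => - (M t)^T).
  move=> a b Ta Tb ab; apply: mLpN => i j.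
  under [X in cLp _ _ _ X]eq_fun do rewrite mxE.
  exact: lM.
have [Y' [Y'c pY']] := linear_odeT (1%:M : 'M[R[i]]_k) Tc lMT.
pose Y t := (Y' t)^T.
have pY : mprimT T Y (fun t => - (Y t *m M t)).
  move=> a b Ta Tb ab; apply: mprim_eq (mprim_trmx (pY' a b Ta Tb ab)) => // t.
  by rewrite mulNmx linearN /= trmx_mul trmxK.
have YPsi t : T t -> Y t *m Psi t = 1%:M.
  move=> Tt; have p0 : mprimT T (fun t => Y t *m Psi t) (fun=> 0).
    move=> a b Ta Tb ab.
    apply: mprim_eq (mprimM (pY a b Ta Tb ab) (pPsi a b Ta Tb ab)) => // u.
    by rewrite mulNmx mulmxA addNr.
  by rewrite (mprimT_const Tt Tc p0) Psic /Y Y'c trmx1 mulmx1.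
by exists Psi, Y; split => // t Tt; apply/mulmx1C/YPsi.
Qed.

(* The inverse [Y] of a fundamental solution makes [Y Z] constant. *)
Lemma linear_ode_unique T k l (M : R -> 'M[R[i]]_k) (Z : R -> 'M[R[i]]_(k, l)) c :
  T c -> mLpT E1 T M -> mprimT T Z (fun t => M t *m Z t) -> Z c = 0 ->
  forall t, T t -> Z t = 0.
Proof.
move=> Tc lM pZ Zc t Tt.
have [Psi [Y [_ pY YPsi PsiY]]] := fundamental_solution Tc lM.
have p0 : mprimT T (fun t => Y t *m Z t) (fun=> 0).
  move=> a b Ta Tb ab.
  apply: mprim_eq (mprimM (pY a b Ta Tb ab) (pZ a b Ta Tb ab)) => // u.
  by rewrite mulNmx mulmxA addNr.
have := mprimT_const Tt Tc p0; rewrite Zc mulmx0 => YZ.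
by rewrite -[LHS]mul1mx -(PsiY t Tt) -mulmxA YZ mulmx0.
Qed.

End Fundamental.

(** * Hermitian matrices *)

Section ConjugateTranspose.
Context {R : realType}.
Implicit Types (k l m : nat).

Lemma ctrmxM k l m (M : 'M[R[i]]_(k, l)) (N : 'M[R[i]]_(l, m)) :
  (M *m N) ^t* = N ^t* *m M ^t*.
Proof. by rewrite trmx_mul map_mxM. Qed.

Lemma ctrmxD k l (M N : 'M[R[i]]_(k, l)) : (M + N) ^t* = M ^t* + N ^t*.
Proof. by rewrite linearD /= map_mxD. Qed.

Lemma ctrmxN k l (M : 'M[R[i]]_(k, l)) : (- M) ^t* = - M ^t*.
Proof. by rewrite linearN /= map_mxN. Qed.

Lemma ctrmxB k l (M N : 'M[R[i]]_(k, l)) : (M - N) ^t* = M ^t* - N ^t*.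
Proof. by rewrite ctrmxD ctrmxN. Qed.

Lemma ctrmxK k l (M : 'M[R[i]]_(k, l)) : M ^t* ^t* = M.
Proof. by apply/matrixP => i j; rewrite !mxE conjCK. Qed.

Lemma ctrmx0 k l : (0 : 'M[R[i]]_(k, l)) ^t* = 0.
Proof. by rewrite trmx0 map_mx0. Qed.

Lemma ctrmx_inv k (M : 'M[R[i]]_k) : (invmx M) ^t* = invmx (M ^t*).
Proof. by rewrite trmx_inv map_invmx. Qed.

Lemma hermsymmxP k (M : 'M[R[i]]_k) : M \is hermsymmx <-> M ^t* = M.
Proof.
split => [/is_hermitianmxP|h]; first by rewrite expr0 scale1r => {1}->; rewrite ctrmxK.
by apply/is_hermitianmxP; rewrite expr0 scale1r h.
Qed.

Definition re00 (M : 'M[R[i]]_1) : R := complex.Re (M 0 0).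

Lemma re00D M N : re00 (M + N) = re00 M + re00 N.
Proof. by rewrite /re00 mxE cReD. Qed.

Lemma re00N M : re00 (- M) = - re00 M.
Proof. by rewrite /re00 mxE cReN. Qed.

Lemma re00_ctr M : re00 (M ^t*) = re00 M.
Proof. by rewrite /re00 !mxE cReJ. Qed.

Lemma re00_0 : re00 0 = 0.
Proof. by rewrite /re00 mxE. Qed.

Lemma re00Z (r : R) M : re00 (r%:C *: M) = r * re00 M.
Proof. by rewrite /re00 mxE cReM /= mul0r subr0. Qed.

Definition normsq k (v : 'cV[R[i]]_k) : R := re00 (v ^t* *m v).

Lemma normsqE k (v : 'cV[R[i]]_k) : normsq v = \sum_i sqn (v i 0).
Proof.
rewrite /normsq /re00 mxE Re_sum; apply: eq_bigr => i _.
by rewrite !mxE cReM cReJ cImJ /sqn; ring.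
Qed.

Lemma normsq_ge0 k (v : 'cV[R[i]]_k) : 0 <= normsq v.
Proof. by rewrite normsqE; apply: sumr_ge0 => i _; exact: sqn_ge0. Qed.

Lemma normsq_eq0 k (v : 'cV[R[i]]_k) : normsq v = 0 -> v = 0.
Proof.
rewrite normsqE => /eqP; rewrite psumr_eq0; last by move=> i _; exact: sqn_ge0.
move=> /allP h; apply/colP => i; rewrite mxE.
by apply/eqP; rewrite -sqn_eq0; apply: (h i); rewrite mem_index_enum.
Qed.

Lemma unitmx_inj k (M : 'M[R[i]]_k) :
  (forall v : 'cV[R[i]]_k, M *m v = 0 -> v = 0) -> M \in unitmx.
Proof.
move=> inj; rewrite -unitmx_tr -row_free_unit -kermx_eq0.
apply/eqP/row_matrixP => i; rewrite row0; apply: trmx_inj; rewrite trmx0.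
apply: inj; apply: trmx_inj; rewrite trmx_mul trmxK trmx0 -row_mul.
by rewrite mulmx_ker row0.
Qed.

Definition qf k (Q : 'M[R[i]]_k) (x : 'cV[R[i]]_k) : R := re00 (x ^t* *m Q *m x).

(** For a Hermitian matrix the form [x^H M x] is a Hermitian 1 by 1 matrix, hence real, so only its
    real part has to be tested. *)
Lemma psdP k (M : 'M[R[i]]_k) :
  psd M <-> M ^t* = M /\ forall x, 0 <= qf M x.
Proof.
split => [[/hermsymmxP hM pM]|[hM pM]].
  by split => // x; have := pM x; rewrite lecE => /andP[_].
split; first exact/hermsymmxP.
move=> x; rewrite lecE; apply/andP; split; last exact: pM.
have : (x ^t* *m M *m x) ^t* = x ^t* *m M *m x.
  by rewrite !ctrmxM ctrmxK hM mulmxA.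
move=> /matrixP/(_ 0 0); rewrite mxE [X in Num.conj X]mxE.
by case: ((x ^t* *m M *m x) 0 0) => u v [vv]; apply/eqP => /=; lra.
Qed.

Lemma re00_sum4 (M1 M2 M3 M4 : 'M[R[i]]_1) : re00 M2 = re00 M3 ->
  re00 (M1 + M2 + (M3 + M4)) = re00 M1 + 2 * re00 M3 + re00 M4.
Proof. by rewrite !re00D => ->; ring. Qed.

Lemma qfD k (Q : 'M[R[i]]_k) x y : Q ^t* = Q ->
  qf Q (x + y) = qf Q x + 2 * re00 (y ^t* *m Q *m x) + qf Q y.
Proof.
move=> hQ.
have S : re00 (x ^t* *m Q *m y) = re00 (y ^t* *m Q *m x).
  by rewrite -re00_ctr ctrmxM; congr re00; rewrite ctrmxM ctrmxK hQ mulmxA.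
apply: etrans (re00_sum4 _ _ S); congr re00.
by rewrite ctrmxD 2!mulmxDl !(mulmxDr _ x y).
Qed.

Lemma delta_ctr_mul k (Q : 'M[R[i]]_k) (p q : 'I_k) :
  (delta_mx p 0 : 'cV[R[i]]_k) ^t* *m Q *m delta_mx q 0 = (Q p q)%:M.
Proof.
rewrite trmx_delta map_delta_mx -rowE -colE.
by apply/matrixP => i j; rewrite !ord1 !mxE eqxx.
Qed.

(** Together with its companion for imaginary parts, where the conjugate of ['i] rotates the cross
    term, this recovers the entries from the quadratic form. Monotone bounded forms therefore give
    convergent matrices. *)
Lemma qf_polarization_Re k (Q : 'M[R[i]]_k) p q : Q ^t* = Q ->
  complex.Re (Q p q) = 2^-1 * (qf Q (delta_mx q 0 + delta_mx p 0) -
    qf Q (delta_mx q 0) - qf Q (delta_mx p 0)).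
Proof.
move=> hQ; rewrite (qfD _ _ hQ) delta_ctr_mul.
move: (qf _ _) (qf _ _) => a b; rewrite /re00 mxE mulr1n.
by move: (complex.Re _) => r; field.
Qed.

Lemma qf_polarization_Im k (Q : 'M[R[i]]_k) p q : Q ^t* = Q ->
  complex.Im (Q p q) = 2^-1 * (qf Q (delta_mx q 0 + 'i *: delta_mx p 0) -
    qf Q (delta_mx q 0) - qf Q ('i *: delta_mx p 0)).
Proof.
move=> hQ; rewrite (qfD _ _ hQ) [('i *: delta_mx p 0)^T]linearZ /= map_mxZ.
rewrite -!scalemxAl delta_ctr_mul.
move: (qf _ _) (qf _ _) => a b; rewrite /re00 2!mxE mulr1n cReM cReJ cImJ.
have [-> ->] : complex.Re ('i : R[i]) = 0 /\ complex.Im ('i : R[i]) = 1 by [].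
by move: (complex.Re _) (complex.Im _) => r r'; field.
Qed.

End ConjugateTranspose.


(** * Inverses of coercive Hermitian matrices *)

Section Coercive.
Context {R : realType}.
Implicit Types (k : nat) (c : R).

Lemma loewner_qf k (M : 'M[R[i]]_k) c v : loewner_ge M (c%:C)%:M ->
  c * normsq v <= qf M v.
Proof.
move=> /psdP[_ /(_ v)]; rewrite /qf mulmxBr mulmxBl re00D re00N subr_ge0.
by rewrite mul_mx_scalar -scalemxAl re00Z.
Qed.

Lemma loewner_unitmx k (M : 'M[R[i]]_k) c : 0 < c -> loewner_ge M (c%:C)%:M ->
  M \in unitmx.
Proof.
move=> c0 cM; apply: unitmx_inj => v Mv; apply: normsq_eq0.
have := loewner_qf v cM; rewrite /qf -mulmxA Mv mulmx0 re00_0 pmulr_rle0 //.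
by move=> h; apply/le_anti; rewrite h normsq_ge0.
Qed.

(** Let w be column j of the inverse. Then c |w|^2 is at most Re(w^H M w) = Re w_j, which is at most
    |w|, so |w| is at most 1/c. *)
Lemma loewner_inv_bound k (M : 'M[R[i]]_k) c i j : 0 < c ->
  loewner_ge M (c%:C)%:M ->
  `|complex.Re (invmx M i j)| <= c^-1 /\ `|complex.Im (invmx M i j)| <= c^-1.
Proof.
move=> c0 cM; have uM := loewner_unitmx c0 cM.
pose w : 'cV[R[i]]_k := invmx M *m delta_mx j 0.
have Mw : M *m w = delta_mx j 0 by rewrite /w mulmxA mulmxV // mul1mx.
have := loewner_qf w cM.
have -> : qf M w = complex.Re (w j 0).
  rewrite /qf -mulmxA Mw /re00 mxE (bigD1 j) //= big1 ?addr0 => [|z zj].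
    by rewrite !mxE eqxx mulr1 cReJ.
  by rewrite !mxE (negbTE zj) mulr0.
have sqw z : sqn (w z 0) <= normsq w.
  rewrite normsqE (bigD1 z) //= lerDl; apply: sumr_ge0 => ? _; exact: sqn_ge0.
have wE z : w z 0 = invmx M z j by rewrite /w -colE mxE.
move=> cw; have wj := sqw j; rewrite /sqn in wj.
have := sqw i; rewrite /sqn !wE => wi.
set r := normsq w in cw wj wi.
have r0 : 0 <= r by exact: normsq_ge0.
have cr : c * r <= c^-1.
  set x := complex.Re _ in cw wj.
  have x2 : x ^+ 2 <= r by have := sqr_ge0 (complex.Im (w j 0)); lra.
  have xc : x <= c^-1.
    rewrite leNgt; apply/negP => cx.
    have : 1 < c * x by rewrite mulrC -ltr_pdivrMr // div1r.
    by move=> ?; nra.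
  exact: le_trans cw xc.
have rc : r <= c^-1 ^+ 2.
  by rewrite expr2 -ler_pdivrMl ?invr_gt0 // invrK.
have key x : x ^+ 2 <= r -> `|x| <= c^-1.
  move=> xr; rewrite -(@ler_sqr _ `|x|) ?nnegrE ?invr_ge0 ?(ltW c0) //.
  by rewrite real_normK ?num_real // (le_trans xr).
split; apply: key.
  by have := sqr_ge0 (complex.Im (invmx M i j)); lra.
by have := sqr_ge0 (complex.Re (invmx M i j)); lra.
Qed.

End Coercive.

(** * The Hamiltonian system of a passive system *)

Section Passive.
Context {R : realType} {n m : nat}.
Local Notation mu := (@lebesgue_measure R).
Context (T : set R) (A : R -> 'M[R[i]]_(n, n)) (B : R -> 'M[R[i]]_(n, m))
  (C : R -> 'M[R[i]]_(m, n)) (D : R -> 'M[R[i]]_(m, m)).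
Context (oT : open T) (iT : is_interval T) (lA : mLpT E1 T A) (lB : mLpT E2 T B)
  (lC : mLpT E2 T C) (lD : mLpT Eoo T D).
Context (coercive : forall t0 t1 : R, T t0 -> T t1 -> t0 <= t1 ->
  exists c : R, 0 < c /\ {ae mu, forall t : R, `[t0, t1]%classic t ->
    loewner_ge (D t + (D t) ^t*) (c%:C)%:M}).
Implicit Types (a b c s t : R) (k l : nat).

Definition symD t := D t + (D t) ^t*.

(* Equals [invmx (symD t)] when [symD t] is invertible, hence almost everywhere, and
   is [0] otherwise; unlike [invmx (symD t)] it has measurable entries. *)
Definition symDinv t := (\det (symD t))^-1 *: \adj (symD t).

Lemma symD_herm t : (symD t) ^t* = symD t.
Proof. by rewrite /symD ctrmxD ctrmxK addrC. Qed.

Lemma symDinv_herm t : (symDinv t) ^t* = symDinv t.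
Proof.
have [uW|nW] := boolP (symD t \in unitmx).
  have -> : symDinv t = invmx (symD t) by rewrite /invmx uW.
  by rewrite ctrmx_inv symD_herm.
rewrite /symDinv; move: nW; rewrite unitmxE unitfE negbK => /eqP ->.
by rewrite invr0 !scale0r ctrmx0.
Qed.

Lemma symDinvE t : symD t \in unitmx -> symDinv t = invmx (symD t).
Proof. by move=> uW; rewrite /invmx uW. Qed.

Lemma symD_unit_ae : {ae mu, forall t, T t -> symD t \in unitmx}.
Proof.
apply: ae_exhaust => // a b Ta Tb ab; have [c [c0 cW]] := coercive Ta Tb ab.
by apply: aeS cW => t + tab => /(_ tab); exact: loewner_unitmx.
Qed.

Lemma symD_Loo : mLpT Eoo T symD.
Proof. by move=> a b Ta Tb ab; apply: mLpD; [|apply: mLpJ]; exact: lD. Qed.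

Lemma measurable_itv_eq a b (f g : R -> R) : (forall t, f t = g t) ->
  measurable_fun `[a, b] f -> measurable_fun `[a, b] g.
Proof. by move=> /funext ->. Qed.

(** [D] is not continuous, so no minimum of the determinant is available: the cofactor formula
    supplies measurability, and the coercivity constant supplies the essential bound. *)
Lemma symDinv_Loo : mLpT Eoo T symDinv.
Proof.
move=> a b Ta Tb ab i j; have [c [c0 cW]] := coercive Ta Tb ab.
have lW := symD_Loo Ta Tb ab.
have [[mr _] [mi _]] := mLp_adj lW i j.
have ld := cLp_det lW; have [[mdr _] [mdi _]] := ld; have mV := measurable_sqnV ld.
have mdvr : measurable_fun `[a, b] (fun t => complex.Re ((\det (symD t))^-1)).
  apply: measurable_itv_eq (fun t => esym (cReV _)) _; exact: measurable_funM.
have mdvi : measurable_fun `[a, b] (fun t => complex.Im ((\det (symD t))^-1)).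
  apply: measurable_itv_eq (fun t => esym (cImV _)) _.
  by apply: measurableT_comp => //; exact: measurable_funM.
have bnd : {ae mu, forall t, `[a, b]%classic t ->
    `|complex.Re (symDinv t i j)| <= c^-1 /\ `|complex.Im (symDinv t i j)| <= c^-1}.
  apply: aeS cW => t + tab => /(_ tab) cWt.
  rewrite symDinvE; last exact: loewner_unitmx cWt.
  exact: loewner_inv_bound.
split; split.
- apply: (measurable_itv_eq (f := fun t =>
    complex.Re ((\det (symD t))^-1) * complex.Re (\adj (symD t) i j) -
    complex.Im ((\det (symD t))^-1) * complex.Im (\adj (symD t) i j))).
    by move=> t; rewrite -cReM [in RHS]mxE.
  by apply: measurable_funB; exact: measurable_funM.
- by exists c^-1; apply: aeS bnd => t + tab => /(_ tab)[].
- apply: (measurable_itv_eq (f := fun t =>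
    complex.Re ((\det (symD t))^-1) * complex.Im (\adj (symD t) i j) +
    complex.Im ((\det (symD t))^-1) * complex.Re (\adj (symD t) i j))).
    by move=> t; rewrite -cImM [in RHS]mxE.
  by apply: measurable_funD; exact: measurable_funM.
- by exists c^-1; apply: aeS bnd => t + tab => /(_ tab)[].
Qed.

(** These coefficients result from inserting u = - [symDinv] (C x - B^H p) into x' = A x + B u and
    p' = C^H u - A^H p. They are integrable because a product of two square-integrable factors with
    a bounded one is. *)
Definition hamF t := A t - B t *m symDinv t *m C t.
Definition hamG t := B t *m symDinv t *m (B t) ^t*.
Definition hamS t := (C t) ^t* *m symDinv t *m C t.

Lemma hamF_L1 : mLpT E1 T hamF.
Proof.
move=> a b Ta Tb ab; apply: mLpB; first exact: lA.
apply: (mLpM (p := E2) (q := E2)) => //; last exact: lC.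
by apply: (mLpM (p := E2) (q := Eoo)) => //; [exact: lB | exact: symDinv_Loo].
Qed.

Lemma hamG_L1 : mLpT E1 T hamG.
Proof.
move=> a b Ta Tb ab; apply: (mLpM (p := E2) (q := E2)) => //; last exact/mLpJ/lB.
by apply: (mLpM (p := E2) (q := Eoo)) => //; [exact: lB | exact: symDinv_Loo].
Qed.

Lemma hamS_L1 : mLpT E1 T hamS.
Proof.
move=> a b Ta Tb ab; apply: (mLpM (p := E2) (q := E2)) => //; last exact: lC.
by apply: (mLpM (p := E2) (q := Eoo)) => //; [exact/mLpJ/lC | exact: symDinv_Loo].
Qed.

Lemma hamG_herm t : (hamG t) ^t* = hamG t.
Proof. by rewrite /hamG !ctrmxM ctrmxK symDinv_herm mulmxA. Qed.

Lemma hamS_herm t : (hamS t) ^t* = hamS t.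
Proof. by rewrite /hamS !ctrmxM ctrmxK symDinv_herm mulmxA. Qed.

(* The Hamiltonian system of the problem of maximising the extracted supply, with
   the sign convention that the costate of an optimal trajectory is [P = Q X]. *)
Definition ham k (X P : R -> 'M[R[i]]_(n, k)) :=
  mprimT T X (fun t => hamF t *m X t + hamG t *m P t) /\
  mprimT T P (fun t => - (hamS t *m X t) - (hamF t) ^t* *m P t).

Lemma hamMr k l X P (K : 'M[R[i]]_(k, l)) : ham X P ->
  ham (fun t => X t *m K) (fun t => P t *m K).
Proof.
move=> [hX hP]; split=> a b Ta Tb ab.
  apply: mprim_eq (mprimMr K (hX a b Ta Tb ab)) => // t.
  by rewrite mulmxDl !mulmxA.
apply: mprim_eq (mprimMr K (hP a b Ta Tb ab)) => // t.
by rewrite mulmxBl mulNmx !mulmxA.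
Qed.

Lemma hamD k (X1 X2 P1 P2 : R -> 'M[R[i]]_(n, k)) : ham X1 P1 -> ham X2 P2 ->
  ham (fun t => X1 t + X2 t) (fun t => P1 t + P2 t).
Proof.
move=> [hX hP] [hX2 hP2]; split=> a b Ta Tb ab.
  apply: mprim_eq (mprimD (hX a b Ta Tb ab) (hX2 a b Ta Tb ab)) => // t.
  by rewrite !mulmxDr addrACA.
apply: mprim_eq (mprimD (hP a b Ta Tb ab) (hP2 a b Ta Tb ab)) => // t.
by rewrite !mulmxDr !opprD addrACA.
Qed.

Definition hamH t := block_mx (hamF t) (hamG t) (- hamS t) (- (hamF t) ^t*).

Lemma hamH_L1 : mLpT E1 T hamH.
Proof.
move=> a b Ta Tb ab; apply: mLp_block; first exact: hamF_L1.
- exact: hamG_L1.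
- by apply: mLpN; exact: hamS_L1.
- by apply: mLpN; apply: mLpJ; exact: hamF_L1.
Qed.

Lemma ham_col k (X P : R -> 'M[R[i]]_(n, k)) : ham X P <->
  mprimT T (fun t => col_mx (X t) (P t)) (fun t => hamH t *m col_mx (X t) (P t)).
Proof.
split => [h|h].
  case: h => hX hP a b Ta Tb ab i j.
  have E t : hamH t *m col_mx (X t) (P t) = col_mx (hamF t *m X t + hamG t *m P t)
      (- (hamS t *m X t) - (hamF t) ^t* *m P t).
    by rewrite mul_block_col !mulNmx.
  have := hX a b Ta Tb ab; have := hP a b Ta Tb ab.
  case: (splitP i) => i' ii' pP pX.
    have -> : i = lshift n i' by exact: val_inj.
    apply: cprim_eq (pX i' j) => t; first by rewrite col_mxEu.
    by rewrite E col_mxEu.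
  have -> : i = rshift n i' by exact: val_inj.
  apply: cprim_eq (pP i' j) => t; first by rewrite col_mxEd.
  by rewrite E col_mxEd.
split=> a b Ta Tb ab i j.
  apply: cprim_eq (h a b Ta Tb ab (lshift n i) j) => t; first by rewrite col_mxEu.
  by rewrite mul_block_col col_mxEu.
apply: cprim_eq (h a b Ta Tb ab (rshift n i) j) => t; first by rewrite col_mxEd.
by rewrite mul_block_col col_mxEd !mulNmx.
Qed.

Lemma ham_exists k s (X0 P0 : 'M[R[i]]_(n, k)) : T s ->
  exists X P, [/\ ham X P, X s = X0 & P s = P0].
Proof.
move=> Ts; have [Z [Zs pZ]] := linear_odeT (col_mx X0 P0) Ts hamH_L1.
exists (fun t => usubmx (Z t)), (fun t => dsubmx (Z t)).
rewrite Zs col_mxKu col_mxKd; split => //; apply/ham_col => a b Ta Tb ab.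
by apply: mprim_eq (pZ a b Ta Tb ab) => t; rewrite vsubmxK.
Qed.

Lemma ham_eq0 k s (X P : R -> 'M[R[i]]_(n, k)) : T s -> ham X P -> X s = 0 ->
  P s = 0 -> forall t, T t -> X t = 0 /\ P t = 0.
Proof.
move=> Ts /ham_col h Xs Ps t Tt.
have /eq_col_mx : col_mx (X t) (P t) = col_mx 0 0.
  rewrite col_mx0; apply: (linear_ode_unique Ts hamH_L1 h) => //.
  by rewrite Xs Ps col_mx0.
by [].
Qed.

Lemma ham_unique k s (X1 P1 X2 P2 : R -> 'M[R[i]]_(n, k)) : T s ->
  ham X1 P1 -> ham X2 P2 -> X1 s = X2 s -> P1 s = P2 s ->
  forall t, T t -> X1 t = X2 t /\ P1 t = P2 t.
Proof.
move=> Ts h1 h2 Xs Ps t Tt.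
have h : ham (fun t => X1 t + X2 t *m (- 1%:M)) (fun t => P1 t + P2 t *m (- 1%:M)).
  exact: hamD h1 (hamMr (- 1%:M) h2).
have [] := ham_eq0 Ts h _ _ Tt.
- by rewrite Xs mulmxN mulmx1 subrr.
- by rewrite Ps mulmxN mulmx1 subrr.
by rewrite !mulmxN !mulmx1 => /subr0_eq -> /subr0_eq ->.
Qed.

Lemma ham_symm_alg k (F0 G0 S0 : 'M[R[i]]_n) (X P : 'M[R[i]]_(n, k)) :
  G0 ^t* = G0 -> S0 ^t* = S0 ->
  ((F0 *m X + G0 *m P) ^t* *m P + X ^t* *m (- (S0 *m X) - F0 ^t* *m P)) +
  - ((- (S0 *m X) - F0 ^t* *m P) ^t* *m X + P ^t* *m (F0 *m X + G0 *m P)) = 0.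
Proof.
move=> hG hS.
have E1 : (F0 *m X + G0 *m P) ^t* = X ^t* *m F0 ^t* + P ^t* *m G0.
  by rewrite ctrmxD !ctrmxM hG.
have E2 : (- (S0 *m X) - F0 ^t* *m P) ^t* = - (X ^t* *m S0) - P ^t* *m F0.
  by rewrite ctrmxB ctrmxN !ctrmxM hS ctrmxK.
rewrite E1 E2 2!mulmxDl 2!mulmxDr !mulmxN !mulNmx !mulmxA.
move: (X ^t* *m F0 ^t* *m P) (P ^t* *m G0 *m P) (X ^t* *m S0 *m X)
  (P ^t* *m F0 *m X) => a g s f.
by apply/matrixP => i j; rewrite !mxE; ring.
Qed.

(** Conservation of the symplectic form, due to [hamG] and [hamS] being Hermitian. Since it vanishes
    where [P] does, it yields the Hermitian symmetry of [P X^-1]. *)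
Lemma ham_symm k (X P : R -> 'M[R[i]]_(n, k)) s t : T s -> T t -> ham X P ->
  (X s) ^t* *m P s - (P s) ^t* *m X s = (X t) ^t* *m P t - (P t) ^t* *m X t.
Proof.
move=> Ts Tt [hX hP].
apply: (mprimT_const (M := fun t => (X t) ^t* *m P t - (P t) ^t* *m X t) Ts Tt).
move=> a b Ta Tb ab; have pX := hX a b Ta Tb ab; have pP := hP a b Ta Tb ab.
apply: mprim_eq (mprimD (mprimM (mprimJ pX) pP) (mprimN (mprimM (mprimJ pP) pX)))
  => // u.
exact: ham_symm_alg (hamG_herm u) (hamS_herm u).
Qed.

(* [sio_solution] in terms of primitives, without the test functions. *)
Definition sioL (x : R -> 'cV[R[i]]_n) (u y : R -> 'cV[R[i]]_m) :=
  [/\ mLpT E2 T u, mLpT E2 T y & exists dx, mprimT T x dx /\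
    {ae mu, forall t, T t ->
       dx t = A t *m x t + B t *m u t /\ y t = C t *m x t + D t *m u t}].

Lemma Lploc2_mxP k l (M : R -> 'M[R[i]]_(k, l)) :
  Lploc_mx 2%:E T M <-> mLpT E2 T M.
Proof.
split=> [lM a b Ta Tb ab i j|lM i j].
  have [lr li] := lM i j.
  by split; [exact: (LplocP2 _ oT iT).1 lr _ _ Ta Tb ab
           | exact: (LplocP2 _ oT iT).1 li _ _ Ta Tb ab].
by split; apply/LplocP2 => // a b Ta Tb ab; have [] := lM a b Ta Tb ab i j.
Qed.

Lemma W11loc_mxP k l (M dM : R -> 'M[R[i]]_(k, l)) :
  W11loc_deriv_mx T M dM <-> mprimT T M dM.
Proof.
split=> [pM a b Ta Tb ab i j|pM i j].
  have [pr pi] := pM i j.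
  by split; [exact: (rprim_of_W11loc oT iT pr) | exact: (rprim_of_W11loc oT iT pi)].
by split; apply: W11loc_of_rprim => // a b Ta Tb ab; have [] := pM a b Ta Tb ab i j.
Qed.

Lemma sioLP x u y : sio_solution T A B C D x u y <-> sioL x u y.
Proof.
split=> [[lu ly [dx [px ae]]]|[lu ly [dx [px ae]]]].
  by split; [exact/Lploc2_mxP | exact/Lploc2_mxP | exists dx; split => //; exact/W11loc_mxP].
by split; [exact/Lploc2_mxP | exact/Lploc2_mxP | exists dx; split => //; exact/W11loc_mxP].
Qed.

Lemma sioLD x u y z w v : sioL x u y -> sioL z w v ->
  sioL (fun t => x t + z t) (fun t => u t + w t) (fun t => y t + v t).
Proof.
move=> [lu ly [dx [px hx]]] [lw lv [dz [pz hz]]]; split.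
- by move=> a b Ta Tb ab; apply: mLpD; [exact: lu | exact: lw].
- by move=> a b Ta Tb ab; apply: mLpD; [exact: ly | exact: lv].
exists (fun t => dx t + dz t); split.
  by move=> a b Ta Tb ab; exact: mprimD (px _ _ Ta Tb ab) (pz _ _ Ta Tb ab).
apply: aeS2 hx hz => t hx hz Tt; have [-> ->] := hx Tt; have [-> ->] := hz Tt.
by rewrite !mulmxDr; split; rewrite addrACA.
Qed.

Lemma sioLN x u y : sioL x u y ->
  sioL (fun t => - x t) (fun t => - u t) (fun t => - y t).
Proof.
move=> [lu ly [dx [px hx]]]; split.
- by move=> a b Ta Tb ab; apply: mLpN; exact: lu.
- by move=> a b Ta Tb ab; apply: mLpN; exact: ly.
exists (fun t => - dx t); split.
  by move=> a b Ta Tb ab; exact: mprimN (px _ _ Ta Tb ab).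
apply: aeS hx => t hx Tt; have [-> ->] := hx Tt.
by rewrite !mulmxN !opprD.
Qed.

(** A trajectory with zero input exchanges no supply: it reaches a prescribed state at time [s] for
    free, and bounds extractable supply from below by 0. *)
Lemma sioL_uncontrolled s (z0 : 'cV[R[i]]_n) : T s -> exists z,
  z s = z0 /\ sioL z (fun=> 0) (fun t => C t *m z t).
Proof.
move=> Ts; have [z [zs pz]] := linear_odeT z0 Ts lA; exists z; split => //; split.
- by move=> a b _ _ _; exact: mLp_cst.
- move=> a b Ta Tb ab.
  exact: (mLpM (p := E2) (q := Eoo) isT (lC Ta Tb ab) (mprim_Loo (pz a b Ta Tb ab))).
exists (fun t => A t *m z t); split => //; apply: aeW => t _.
by rewrite !mulmx0 !addr0.
Qed.

Definition uctl (x p : R -> 'cV[R[i]]_n) t := - (symDinv t *m (C t *m x t - (B t) ^t* *m p t)).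
Definition yctl (x p : R -> 'cV[R[i]]_n) t := C t *m x t + D t *m uctl x p t.

Lemma uctl_L2 (x p : R -> 'cV[R[i]]_n) : ham x p -> mLpT E2 T (uctl x p).
Proof.
move=> [px pp] a b Ta Tb ab; apply: mLpN.
apply: (mLpM (p := Eoo) (q := E2)) => //; first exact: symDinv_Loo.
have lx := mprim_Loo (px a b Ta Tb ab); have lp := mprim_Loo (pp a b Ta Tb ab).
apply: mLpB.
  exact: (mLpM (p := E2) (q := Eoo) isT (lC Ta Tb ab) lx).
exact: (mLpM (p := E2) (q := Eoo) isT (mLpJ (lB Ta Tb ab)) lp).
Qed.

Lemma ham_sioL (x p : R -> 'cV[R[i]]_n) : ham x p ->
  sioL x (uctl x p) (yctl x p).
Proof.
move=> h; have lu := uctl_L2 h; have [px pp] := h; split => //.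
  move=> a b Ta Tb ab; apply: mLpD.
    exact: (mLpM (p := E2) (q := Eoo) isT (lC Ta Tb ab) (mprim_Loo (px a b Ta Tb ab))).
  exact: (mLpM (p := Eoo) (q := E2) isT (lD Ta Tb ab) (lu a b Ta Tb ab)).
exists (fun t => hamF t *m x t + hamG t *m p t); split => //; apply: aeW => t _.
split => //; rewrite /uctl /hamF /hamG mulmxN mulmxBl !mulmxBr opprB -!mulmxA.
by rewrite addrAC -addrA.
Qed.

Lemma L1_re00 a b (M : R -> 'M[R[i]]_1) : mLp E1 a b M -> L1 a b (fun t => re00 (M t)).
Proof. by move=> lM; have [[_]] := lM 0 0. Qed.

Definition srate (u y : R -> 'cV[R[i]]_m) t : R := re00 ((y t) ^t* *m u t).

Lemma srate_L1 u y a b : mLpT E2 T u -> mLpT E2 T y -> T a -> T b -> a <= b ->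
  L1 a b (srate u y).
Proof.
move=> lu ly Ta Tb ab; apply: L1_re00.
exact: (mLpM (p := E2) (q := E2) isT (mLpJ (ly a b Ta Tb ab)) (lu a b Ta Tb ab)).
Qed.

Lemma supply_srate u y a b : supply u y a b = \int[mu]_(t in `[a, b]) srate u y t.
Proof. by []. Qed.

(** Stationarity replaces B^H p by C x + D u + D^H u: the part with D u completes the output paired
    with [w], the part with D^H u completes the output paired with [u], and the terms in A
    cancel. *)
Lemma cross_alg (A0 : 'M[R[i]]_n) (B0 : 'M[R[i]]_(n, m)) (C0 : 'M[R[i]]_(m, n))
    (D0 : 'M[R[i]]_m) (x p z : 'cV[R[i]]_n) (u w : 'cV[R[i]]_m) :
  (D0 + D0 ^t*) *m u = - (C0 *m x - B0 ^t* *m p) ->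
  re00 ((A0 *m z + B0 *m w) ^t* *m p + z ^t* *m (C0 ^t* *m u - A0 ^t* *m p)) =
  re00 ((C0 *m x + D0 *m u) ^t* *m w) + re00 ((C0 *m z + D0 *m w) ^t* *m u).
Proof.
move=> hu.
have E1 : (A0 *m z + B0 *m w) ^t* = z ^t* *m A0 ^t* + w ^t* *m B0 ^t*.
  by rewrite ctrmxD !ctrmxM.
have E2 : re00 ((C0 *m x + D0 *m u) ^t* *m w) = re00 (w ^t* *m (C0 *m x + D0 *m u)).
  by rewrite -re00_ctr ctrmxM ctrmxK.
have E3 : (C0 *m z + D0 *m w) ^t* = z ^t* *m C0 ^t* + w ^t* *m D0 ^t*.
  by rewrite ctrmxD !ctrmxM.
rewrite E2; apply: etrans (re00D _ _).
have E4 : B0 ^t* *m p = C0 *m x + (D0 + D0 ^t*) *m u by rewrite hu opprB subrKC.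
congr re00; rewrite E1 E3 mulmxDl -[w ^t* *m _ *m p]mulmxA E4.
rewrite !mulmxDr !mulmxDl !mulmxDr mulmxN !mulmxA.
move: (_ *m p) (w ^t* *m C0 *m x) (w ^t* *m D0 *m u) (w ^t* *m D0 ^t* *m u)
  (z ^t* *m C0 ^t* *m u) => M1 M2 M3 M4 M5.
by apply/matrixP => i j; rewrite !mxE; ring.
Qed.

Lemma symD_mulV_ae : {ae mu, forall t, T t -> symD t *m symDinv t = 1%:M}.
Proof. by apply: aeS symD_unit_ae => t + Tt => /(_ Tt) uW; rewrite symDinvE // mulmxV. Qed.

(* Along a Hamiltonian trajectory the bilinear supply against any solution is an
   exact derivative: this is the first-order optimality condition. *)
Lemma ham_cross (x p : R -> 'cV[R[i]]_n) z w v a b : ham x p -> sioL z w v ->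
  T a -> T b -> a <= b ->
  \int[mu]_(t in `[a, b]) (srate w (yctl x p) t + srate (uctl x p) v t) =
  re00 ((z b) ^t* *m p b) - re00 ((z a) ^t* *m p a).
Proof.
move=> h [lw lv [dz [pz hz]]] Ta Tb ab; have [_ pp] := h.
have [lu ly _] := ham_sioL h.
have [pr _] := mprimM (mprimJ (pz a b Ta Tb ab)) (pp a b Ta Tb ab) 0 0.
have lr : L1 a b (fun t => srate w (yctl x p) t + srate (uctl x p) v t).
  by apply: L1D; exact: srate_L1.
have hae : {ae mu, forall t, `[a, b]%classic t ->
    complex.Re (((dz t) ^t* *m p t +
      (z t) ^t* *m (- (hamS t *m x t) - (hamF t) ^t* *m p t)) 0 0) =
    srate w (yctl x p) t + srate (uctl x p) v t}.
  apply: aeS2 hz symD_mulV_ae => t hz hW tab.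
  have Tt : T t by exact: is_interval_sub iT Ta Tb _ tab.
  have [-> hv] := hz Tt; rewrite /srate hv /yctl.
  have hu : (D t + (D t) ^t*) *m uctl x p t = - (C t *m x t - (B t) ^t* *m p t).
    by rewrite /uctl mulmxN mulmxA -/(symD t) hW // mul1mx.
  rewrite -(cross_alg (A t) (z t) (w t) hu) /re00.
  have -> // : - (hamS t *m x t) - (hamF t) ^t* *m p t =
     (C t) ^t* *m uctl x p t - (A t) ^t* *m p t.
  rewrite /uctl /hamF ctrmxB !ctrmxM symDinv_herm /hamS mulmxBl mulmxN mulmxBr mulmxBr !mulmxA.
  move: (_ *m x t) (_ *m p t) (_ *m p t) => M1 M2 M3.
  by apply/matrixP => i j; rewrite !mxE; ring.
have [_ pI] := rprim_ae pr (L1_meas lr) hae.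
by rewrite -(pI a b).
Qed.

Lemma srate_add (u w y v : 'cV[R[i]]_m) :
  re00 ((y + v) ^t* *m (u + w)) =
  re00 (y ^t* *m u) + (re00 (y ^t* *m w) + re00 (v ^t* *m u)) + re00 (v ^t* *m w).
Proof.
have -> : (y + v) ^t* *m (u + w) =
    (y ^t* *m u + (y ^t* *m w + v ^t* *m u)) + v ^t* *m w.
  by rewrite ctrmxD mulmxDl !mulmxDr !addrA.
move: (y ^t* *m u) (y ^t* *m w) (v ^t* *m u) (v ^t* *m w) => M1 M2 M3 M4.
by rewrite !re00D.
Qed.

(** The trajectory is paired with itself in [ham_cross]; both cross rates are then its own rate,
    which is the origin of the factor 2. *)
Lemma ham_supply (x p : R -> 'cV[R[i]]_n) a b : ham x p -> T a -> T b -> a <= b ->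
  2 * supply (uctl x p) (yctl x p) a b =
  re00 ((x b) ^t* *m p b) - re00 ((x a) ^t* *m p a).
Proof.
move=> h Ta Tb ab; rewrite -(ham_cross h (ham_sioL h) Ta Tb ab).
have [lu ly _] := ham_sioL h.
rewrite RintegralD //; try exact: srate_L1.
by rewrite supply_srate; ring.
Qed.

Lemma ham_supply_add (x p : R -> 'cV[R[i]]_n) z w v a b : ham x p -> sioL z w v ->
  T a -> T b -> a <= b ->
  supply (fun t => uctl x p t + w t) (fun t => yctl x p t + v t) a b =
  supply (uctl x p) (yctl x p) a b +
  (re00 ((z b) ^t* *m p b) - re00 ((z a) ^t* *m p a)) + supply w v a b.
Proof.
move=> h hz Ta Tb ab; rewrite -(ham_cross h hz Ta Tb ab) !supply_srate.
have [lu ly _] := ham_sioL h; have [lw lv _] := hz.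
have lc : L1 a b (fun t => srate w (yctl x p) t + srate (uctl x p) v t).
  by apply: L1D; exact: srate_L1.
have l1 := srate_L1 lu ly Ta Tb ab; have l2 := srate_L1 lw lv Ta Tb ab.
rewrite -RintegralD // -RintegralD //; last exact: L1D.
by apply: eq_Rint => t _; exact: srate_add.
Qed.

Lemma supply0 (y : R -> 'cV[R[i]]_m) a b : supply (fun=> 0) y a b = 0.
Proof.
rewrite supply_srate Rintegral_eq0 // => t.
by rewrite /srate mulmx0 re00_0.
Qed.

(** * Consequences of a storage function *)

Context (V : R -> 'cV[R[i]]_n -> R) (sV : storage_function T A B C D V).

Lemma storage_le x u y a b : sioL x u y -> T a -> T b -> a <= b ->
  V b (x b) - V a (x a) <= supply u y a b.
Proof. by move=> /sioLP h Ta Tb ab; case: sV => _ _ hV; exact: hV. Qed.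

Lemma storage_ge0 t x : T t -> 0 <= V t x.
Proof. by case: sV => hV _ _; exact: hV. Qed.

(* Otherwise the supply extracted from a state at time [s] could be made
   arbitrarily large by scaling the trajectory [x]. *)
Lemma ham_costate_eq0 (x p : R -> 'cV[R[i]]_n) s b : T s -> T b -> s <= b ->
  ham x p -> x s = 0 -> p b = 0 -> p s = 0.
Proof.
move=> Ts Tb sb h xs pb; apply: normsq_eq0.
have [z [zs hz]] := sioL_uncontrolled (p s) Ts.
have key (r : R) : r * normsq (p s) <= V s (p s).
  pose K : 'M[R[i]]_1 := (r%:C)%:M.
  have hK := hamMr K h; have sK := ham_sioL hK.
  (* Since [x s = 0] and [p b = 0], the scaled trajectory has no supply of its own. Against the free
     trajectory [z] from [p s] only the cross term - r |p s|^2 remains. *)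
  have := storage_le (sioLD sK hz) Ts Tb sb.
  rewrite (ham_supply_add hK hz Ts Tb sb) supply0 addr0 pb xs !mul0mx add0r mulmx0 re00_0.
  have := ham_supply hK Ts Tb sb.
  rewrite pb xs !mul0mx mulmx0 ctrmx0 mul0mx re00_0 subrr zs => /eqP.
  rewrite mulf_eq0 pnatr_eq0 /= => /eqP ->.
  have -> : re00 ((p s) ^t* *m (p s *m K)) = r * normsq (p s).
    by rewrite /K mul_mx_scalar -scalemxAr re00Z.
  have := storage_ge0 (x b *m K + z b) Tb; lra.
apply/eqP; rewrite eq_le normsq_ge0 andbT leNgt; apply/negP => ps0.
have := key ((V s (p s) + 1) / normsq (p s)).
by rewrite divfK ?gt_eqF //; lra.
Qed.

Lemma ham_unit (X P : R -> 'M[R[i]]_n) s b : T s -> T b -> s <= b -> ham X P ->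
  X b = 1%:M -> P b = 0 -> X s \in unitmx.
Proof.
move=> Ts Tb sb h Xb Pb; apply: unitmx_inj => v Xv.
have hv := hamMr v h.
have Pv : P s *m v = 0.
  by apply: (ham_costate_eq0 Ts Tb sb hv Xv); rewrite Pb mul0mx.
by have [] := ham_eq0 Ts hv Xv Pv Tb; rewrite Xb mul1mx.
Qed.

(* [Q] induces the available storage up to the horizon [b]. *)
Definition horizon_mx b (Q : R -> 'M[R[i]]_n) := exists X P, [/\ ham X P, X b = 1%:M,
  P b = 0 & forall s, T s -> s <= b -> X s \in unitmx /\ Q s = P s *m invmx (X s)].

Lemma horizon_mx_exists b : T b -> exists Q, horizon_mx b Q.
Proof.
move=> Tb; have [X [P [h Xb Pb]]] := ham_exists (1%:M : 'M[R[i]]_n) 0 Tb.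
exists (fun s => P s *m invmx (X s)), X, P; split => // s Ts sb; split => //.
exact: ham_unit h Xb Pb.
Qed.

(** * Optimal control on a finite horizon *)

Section Horizon.
Context (b : R) (Q : R -> 'M[R[i]]_n) (Tb : T b) (hQ : horizon_mx b Q).

Lemma horizon_herm s : T s -> s <= b -> (Q s) ^t* = Q s.
Proof.
move=> Ts sb; have [X [P [h Xb Pb hX]]] := hQ; have [uX ->] := hX s Ts sb.
have := ham_symm Ts Tb h; rewrite Pb mulmx0 ctrmx0 mul0mx subrr => /subr0_eq XP.
have uX' : (X s) ^t* \in unitmx by rewrite map_unitmx unitmx_tr.
rewrite ctrmxM ctrmx_inv -[LHS]mulmx1 -(mulmxV uX) !mulmxA; congr (_ *m _).
by rewrite -mulmxA -XP mulmxA mulVmx // mul1mx.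
Qed.

Lemma horizon_traj s (x0 : 'cV[R[i]]_n) : T s -> s <= b ->
  exists x p : R -> 'cV[R[i]]_n, [/\ ham x p, x s = x0,
  p b = 0 & forall t, T t -> t <= b -> p t = Q t *m x t].
Proof.
move=> Ts sb; have [X [P [h Xb Pb hX]]] := hQ; have [uX _] := hX s Ts sb.
exists (fun t => X t *m (invmx (X s) *m x0)), (fun t => P t *m (invmx (X s) *m x0)).
split; first exact: hamMr.
- by rewrite mulmxA mulmxV // mul1mx.
- by rewrite Pb mul0mx.
- move=> t Tt tb; have [uXt ->] := hX t Tt tb.
  by rewrite -mulmxA (mulmxA (invmx (X t))) mulVmx // mul1mx.
Qed.

Lemma horizon_opt s (x0 : 'cV[R[i]]_n) : T s -> s <= b -> exists x u y, [/\ sioL x u y, x s = x0 &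
  - 2 * supply u y s b = qf (Q s) x0].
Proof.
move=> Ts sb; have [x [p [h xs pb hp]]] := horizon_traj x0 Ts sb.
exists x, (uctl x p), (yctl x p); split => //; first exact: ham_sioL.
rewrite mulNr (ham_supply h Ts Tb sb) pb mulmx0 re00_0 sub0r opprK hp // xs.
by rewrite mulmxA.
Qed.

Lemma horizon_le_storage s x0 : T s -> s <= b -> qf (Q s) x0 <= 2 * V s x0.
Proof.
move=> Ts sb; have [x [u [y [h xs <-]]]] := horizon_opt x0 Ts sb.
have := storage_le h Ts Tb sb; rewrite xs; have := storage_ge0 (x b) Tb; lra.
Qed.

(** Compare with the optimal trajectory z from the same state, and put d = x - z. As d starts at 0,
    passivity and [horizon_le_storage] make twice its supply at least the form of [Q t1] at d. Added
    to the cross term this completes the form at z + d = x, whose nonnegativity is the assumption on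
    [Q t1]. *)
Lemma horizon_bound_aux t0 t1 x u y : T t0 -> T t1 -> t0 <= t1 -> t1 <= b ->
  (forall v, 0 <= qf (Q t1) v) -> sioL x u y ->
  - 2 * supply u y t0 t1 <= qf (Q t0) (x t0).
Proof.
move=> Tt0 Tt1 t01 t1b Q1 h; have t0b := le_trans t01 t1b.
have [z [p [hz zs pb hp]]] := horizon_traj (x t0) Tt0 t0b.
have hd := sioLD h (sioLN (ham_sioL hz)).
have eu : u = (fun t => uctl z p t + (u t - uctl z p t)).
  by apply/funext => t; rewrite subrKC.
have ey : y = (fun t => yctl z p t + (y t - yctl z p t)).
  by apply/funext => t; rewrite subrKC.
rewrite {1}eu {1}ey (ham_supply_add hz hd Tt0 Tt1 t01).
have := ham_supply hz Tt0 Tt1 t01.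
have := storage_le hd Tt0 Tt1 t01.
set sd := supply (fun t => u t - _) _ _ _.
rewrite zs subrr ctrmx0 mul0mx re00_0 subr0 hp // hp // zs.
have -> : V t0 0 = 0 by case: sV => _ V0 _; exact: V0.
have := horizon_le_storage (x t1 - z t1) Tt1 t1b.
have := Q1 (z t1 + (x t1 - z t1)).
rewrite (qfD (z t1) (x t1 - z t1) (horizon_herm Tt1 t1b)).
rewrite !mulmxA -/(qf (Q t1) (z t1)) -/(qf (Q t0) (x t0)).
move: (re00 _) (qf _ _) (qf _ _) (qf _ _) (V _ _) sd (supply _ _ _ _) => c1 c2 c3 c4 c5 c6 c7.
lra.
Qed.

(** The preceding bound is used first with final time [b], where [Q b = 0] makes its assumption
    trivial, along a trajectory without supply; this then frees the bound from the assumption at all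
    times. *)
Lemma horizon_ge0 s v : T s -> s <= b -> 0 <= qf (Q s) v.
Proof.
move=> Ts sb; have [z [zs hz]] := sioL_uncontrolled v Ts.
have Qb : Q b = 0.
  by have [X [P [h Xb Pb hX]]] := hQ; have [_ ->] := hX b Tb (lexx _); rewrite Pb mul0mx.
have Q0 w : 0 <= qf (Q b) w by rewrite Qb /qf mulmx0 mul0mx re00_0.
by have := horizon_bound_aux Ts Tb sb (lexx b) Q0 hz; rewrite supply0 mulr0 zs.
Qed.

Lemma horizon_bound t0 t1 x u y : T t0 -> T t1 -> t0 <= t1 -> t1 <= b ->
  sioL x u y -> - 2 * supply u y t0 t1 <= qf (Q t0) (x t0).
Proof.
by move=> Tt0 Tt1 t01 t1b; apply: horizon_bound_aux => // v; exact: horizon_ge0.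
Qed.

End Horizon.

(** The optimal trajectory of the shorter horizon competes in the longer one. *)
Lemma horizon_mono b1 b2 Q1 Q2 s v : T b1 -> T b2 -> horizon_mx b1 Q1 ->
  horizon_mx b2 Q2 -> T s -> s <= b1 -> b1 <= b2 -> qf (Q1 s) v <= qf (Q2 s) v.
Proof.
move=> Tb1 Tb2 h1 h2 Ts sb1 b12.
have [x [u [y [h xs <-]]]] := horizon_opt Tb1 h1 v Ts sb1.
by rewrite -xs; exact: (horizon_bound Tb2 h2 Ts Tb1 sb1 b12 h).
Qed.

Lemma herm_mcvg k (u : nat -> 'M[R[i]]_k) : (forall j, (u j) ^t* = u j) ->
  (forall v, cvgn (fun j => qf (u j) v)) -> exists M, mcvg u M.
Proof.
move=> hu cu.
exists (\matrix_(p, q) (limn (fun j => complex.Re (u j p q)) +i*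
                        limn (fun j => complex.Im (u j p q)))).
have cpol v w z : cvgn (fun j => 2^-1 * (qf (u j) v - qf (u j) w - qf (u j) z)).
  by apply: is_cvgMr; apply: is_cvgB; [apply: is_cvgB|].
move=> p q; rewrite mxE; split => /=.
  rewrite (_ : (fun _ => _) = (fun j => 2^-1 * (qf (u j) (delta_mx q 0 + delta_mx p 0) -
    qf (u j) (delta_mx q 0) - qf (u j) (delta_mx p 0)))); first exact: cpol.
  by apply/funext => j; rewrite qf_polarization_Re.
rewrite (_ : (fun _ => _) = (fun j => 2^-1 * (qf (u j) (delta_mx q 0 + 'i *: delta_mx p 0) -
    qf (u j) (delta_mx q 0) - qf (u j) ('i *: delta_mx p 0)))); first exact: cpol.
by apply/funext => j; rewrite qf_polarization_Im.
Qed.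

Lemma mcvg_qf k (u : nat -> 'M[R[i]]_k) M v : mcvg u M ->
  qf (u j) v @[j --> \oo] --> qf M v.
Proof.
move=> uM; have c := mcvgM (mcvgM (mcvg_cst (v ^t*)) uM) (mcvg_cst v).
by have [] := c 0 0.
Qed.

(** * The limit of growing horizons *)

Section Limit.
Context (tau : nat -> R) (Qk : nat -> R -> 'M[R[i]]_n) (Ttau : forall k, T (tau k))
  (mtau : {homo tau : k l / (k <= l)%N >-> k <= l})
  (ctau : forall t, T t -> exists k, t <= tau k)
  (hQk : forall k, horizon_mx (tau k) (Qk k)).

Lemma horizon_limit t : T t -> exists M, mcvg (fun k => Qk k t) M.
Proof.
move=> Tt; have [k0 k0t] := ctau Tt.
have tk k : t <= tau (k + k0)%N by apply: le_trans k0t (mtau _); rewrite leq_addl.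
(* The sequence is shifted past [k0] because [horizon_mx] says nothing about [Qk k t] when the
   horizon precedes [t]. *)
have [|v|M cM] := @herm_mcvg _ (fun k => Qk (k + k0)%N t).
- by move=> k; exact: (horizon_herm (Ttau _) (hQk _) Tt (tk k)).
- apply: nondecreasing_is_cvgn.
    move=> k l kl; apply: (horizon_mono v (Ttau _) (Ttau _) (hQk _) (hQk _) Tt (tk k)).
    by apply: mtau; rewrite leq_add2r.
  exists (2 * V t v) => _ [k _ <-].
  exact: (horizon_le_storage (Ttau _) (hQk _) v Tt (tk k)).
- by exists M; apply/(mcvg_shift _ _ k0).
Qed.

Context (Qa : R -> 'M[R[i]]_n) (cQa : forall t, T t -> mcvg (fun k => Qk k t) (Qa t)).

Lemma limit_herm t : T t -> (Qa t) ^t* = Qa t.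
Proof.
move=> Tt; have [k0 k0t] := ctau Tt.
apply: (mcvg_unique_from (n0 := k0) _ (mcvgJ (cQa Tt)) (cQa Tt)) => k k0k.
apply: (horizon_herm (Ttau k) (hQk k) Tt); exact: le_trans k0t (mtau k0k).
Qed.

Lemma limit_qf_ge k t v : T t -> t <= tau k -> qf (Qk k t) v <= qf (Qa t) v.
Proof.
move=> Tt tk; have cv := mcvg_qf (v := v) (cQa Tt).
rewrite -(cvg_lim _ cv) //; apply: limr_ge; first by apply/cvg_ex; eexists; exact: cv.
exists k; first by [].
move=> l /= kl.
exact: (horizon_mono v (Ttau k) (Ttau l) (hQk k) (hQk l) Tt tk (mtau kl)).
Qed.

Lemma limit_ge0 t v : T t -> 0 <= qf (Qa t) v.
Proof.
move=> Tt; have [k tk] := ctau Tt.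
by apply: le_trans (limit_qf_ge v Tt tk); exact: (horizon_ge0 (Ttau k) (hQk k) v Tt tk).
Qed.

(* The values [Qk k] at the time [b] determine them at [t <= b] through the
   Hamiltonian flow, an algebraic relation that passes to the limit. *)
Lemma limit_ham b : T b -> exists U L, ham U L /\
  forall t, T t -> t <= b -> U t \in unitmx /\ Qa t = L t *m invmx (U t).
Proof.
move=> Tb.
have [X1 [P1 [h1 X1b P1b]]] := ham_exists (1%:M : 'M[R[i]]_n) 0 Tb.
have [X2 [P2 [h2 X2b P2b]]] := ham_exists (0 : 'M[R[i]]_n) 1%:M Tb.
(* By superposition [(U K, L K)] is the Hamiltonian solution with value [(1, K)] at [b]. It is
   affine in [K], which makes its dependence on [Qk k b] continuous at each fixed [t]. *)
pose U (K : 'M[R[i]]_n) t := X1 t + X2 t *m K.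
pose L (K : 'M[R[i]]_n) t := P1 t + P2 t *m K.
have hK K : ham (U K) (L K) by apply: hamD h1 (hamMr K h2).
have Ub K : U K b = 1%:M by rewrite /U X1b X2b mul0mx addr0.
have Lb K : L K b = K by rewrite /L P1b P2b mul1mx add0r.
have [kb kbP] := ctau Tb.
have QUL t : T t -> t <= b -> Qa t *m U (Qa b) t = L (Qa b) t.
  move=> Tt tb.
  have cU : mcvg (fun k => U (Qk k b) t) (U (Qa b) t).
    by apply: mcvgD (mcvg_cst _) (mcvgM (mcvg_cst _) (cQa Tb)).
  have cL : mcvg (fun k => L (Qk k b) t) (L (Qa b) t).
    by apply: mcvgD (mcvg_cst _) (mcvgM (mcvg_cst _) (cQa Tb)).
  apply: (mcvg_unique_from (n0 := kb) _ (mcvgM (cQa Tt) cU) cL) => k kbk.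
  have bk : b <= tau k by exact: le_trans kbP (mtau kbk).
  have [X [P [h Xt Pt hX]]] := hQk k.
  have [uXb Qb] := hX b Tb bk; have [uX Qt] := hX t Tt (le_trans tb bk).
  (* Multiplying the solution for horizon [tau k] by the inverse of [X b] normalises its state at
     [b] to 1 and turns its costate there into [Qk k b]. *)
  have [] := ham_unique Tb (hK (Qk k b)) (hamMr (invmx (X b)) h) _ _ Tt.
  - by rewrite Ub (mulmxV uXb).
  - by rewrite Lb.
  by move=> -> ->; rewrite Qt mulmxA mulmxKV.
exists (U (Qa b)), (L (Qa b)); split; first exact: hK.
move=> t Tt tb.
(* Invertibility cannot be inherited from the approximants. Instead [QUL] shows that the costate
   vanishes with the state, and uniqueness excludes this. *)
have uU : U (Qa b) t \in unitmx.
  apply: unitmx_inj => v Uv; have hv := hamMr v (hK (Qa b)).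
  have Lv : L (Qa b) t *m v = 0 by rewrite -QUL // -mulmxA Uv mulmx0.
  by have [] := ham_eq0 Tt hv Uv Lv Tb; rewrite Ub mul1mx.
by split; [exact: uU | rewrite -QUL // mulmxK].
Qed.

(** The derivative of L U^-1 rewritten through [Qa]. The pair (U, L) changes with the right
    endpoint, but this expression does not, so one derivative serves all intervals. *)
Definition ric_deriv t :=
  - hamS t - (hamF t) ^t* *m Qa t - (Qa t *m hamF t + Qa t *m hamG t *m Qa t).

Lemma ric_deriv_alg (F0 G0 S0 Q U0 : 'M[R[i]]_n) : U0 \in unitmx ->
  (- (S0 *m U0) - F0 ^t* *m (Q *m U0)) *m invmx U0 +
  Q *m U0 *m - (invmx U0 *m (F0 *m U0 + G0 *m (Q *m U0)) *m invmx U0) =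
  - S0 - F0 ^t* *m Q - (Q *m F0 + Q *m G0 *m Q).
Proof.
move=> uU; rewrite mulmxN mulmxBl mulNmx (mulmxA _ Q) !mulmxK //.
congr (_ - _); rewrite !mulmxA mulmxK // mulmxDr mulmxDl !mulmxA !mulmxK //.
Qed.

Lemma limit_prim : mprimT T Qa ric_deriv.
Proof.
move=> a b Ta Tb ab; have [U [L [[hU hL] hQ]]] := limit_ham Tb.
have sT := is_interval_sub iT Ta Tb.
have inT t : a <= t <= b -> T t by move=> tab; apply: sT; rewrite /= in_itv.
have hQ' t : a <= t <= b -> U t \in unitmx /\ Qa t = L t *m invmx (U t).
  by move=> tab; apply: hQ; [exact: inT | case/andP: tab].
have pU := hU a b Ta Tb ab; have pL := hL a b Ta Tb ab.
have uU t : a <= t <= b -> U t \in unitmx by move=> /hQ'[].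
apply: mprim_eq_on (mprimM pL (mprim_inv ab pU uU)).
  by move=> t /hQ'[_ ->].
move=> t tab; have [uUt Qt] := hQ' t tab.
have -> : L t = Qa t *m U t by rewrite Qt mulmxKV.
exact: ric_deriv_alg.
Qed.

Lemma riccati_alg (A0 Q : 'M[R[i]]_n) (B0 : 'M[R[i]]_(n, m)) (C0 : 'M[R[i]]_(m, n))
    (W0 : 'M[R[i]]_m) : W0 ^t* = W0 ->
  A0 ^t* *m Q + Q *m A0 +
  (- (C0 ^t* *m W0 *m C0) - (A0 - B0 *m W0 *m C0) ^t* *m Q -
   (Q *m (A0 - B0 *m W0 *m C0) + Q *m (B0 *m W0 *m B0 ^t*) *m Q)) +
  (C0 ^t* - Q *m B0) *m W0 *m (C0 - B0 ^t* *m Q) = 0.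
Proof.
move=> hW.
have E1 : (A0 - B0 *m W0 *m C0) ^t* *m Q =
    A0 ^t* *m Q - C0 ^t* *m W0 *m B0 ^t* *m Q.
  by rewrite ctrmxB !ctrmxM hW mulmxBl !mulmxA.
have E2 : Q *m (A0 - B0 *m W0 *m C0) = Q *m A0 - Q *m B0 *m W0 *m C0.
  by rewrite mulmxBr !mulmxA.
have E3 : Q *m (B0 *m W0 *m B0 ^t*) *m Q = Q *m B0 *m W0 *m B0 ^t* *m Q.
  by rewrite !mulmxA.
have E4 : (C0 ^t* - Q *m B0) *m W0 *m (C0 - B0 ^t* *m Q) =
    C0 ^t* *m W0 *m C0 - C0 ^t* *m W0 *m B0 ^t* *m Q -
    (Q *m B0 *m W0 *m C0 - Q *m B0 *m W0 *m B0 ^t* *m Q).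
  rewrite (mulmxBl (C0 ^t*) (Q *m B0)) (mulmxBl (C0 ^t* *m W0)).
  by rewrite (mulmxBr (C0 ^t* *m W0) C0) (mulmxBr (Q *m B0 *m W0) C0) !mulmxA.
have zE (M1 M2 M3 M4 M5 M6 : 'M[R[i]]_n) :
    M1 + M2 + (- M3 - (M1 - M4) - (M2 - M5 + M6)) + (M3 - M4 - (M5 - M6)) = 0.
  by apply/matrixP => i j; rewrite !mxE; ring.
rewrite E1 E2 E3 E4; exact: zE.
Qed.

Lemma limit_riccati : riccati_solution T A B C D Qa.
Proof.
exists ric_deriv; split; first exact/W11loc_mxP/limit_prim.
apply: aeS symD_unit_ae => t + Tt => /(_ Tt) uW.
rewrite -/(symD t) -(symDinvE uW); exact: riccati_alg (symDinv_herm t).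
Qed.

Lemma symD_psd_ae : {ae mu, forall t, T t -> forall v, 0 <= qf (symD t) v}.
Proof.
apply: ae_exhaust => // a b Ta Tb ab; have [c [c0 cW]] := coercive Ta Tb ab.
apply: aeS cW => t + tab v => /(_ tab) cWt.
by apply: le_trans (loewner_qf v cWt); rewrite mulr_ge0 ?normsq_ge0 // ltW.
Qed.

(** The Riccati equation says that the Schur complement of [D + D^H] in the block matrix vanishes,
    so the block matrix is a congruence of [D + D^H] and inherits its positivity. *)
Lemma kyp_alg (K : 'M[R[i]]_(n, m)) (W0 W1 : 'M[R[i]]_m) : W1 ^t* = W1 ->
  W0 *m W1 = 1%:M ->
  block_mx (K *m W1 *m K ^t*) K (K ^t*) W0 =
  (row_mx (W1 *m K ^t*) 1%:M) ^t* *m W0 *m row_mx (W1 *m K ^t*) 1%:M.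
Proof.
move=> hW W01; have W10 := mulmx1C W01.
rewrite tr_row_mx map_col_mx ctrmxM ctrmxK hW trmx1 map_mx1.
rewrite mul_col_mx mul_col_row !mul1mx !mulmx1 -(mulmxA K W1 W0) W10 mulmx1.
by rewrite !mulmxA W01 mul1mx.
Qed.

Lemma limit_kyp : kyp_solution T A B C D Qa.
Proof.
exists ric_deriv; split; first exact/W11loc_mxP/limit_prim.
apply: aeS2 symD_psd_ae symD_mulV_ae => t hW hW1 Tt.
have W1 := hW1 Tt; have Wpos := hW Tt.
rewrite /loewner_ge subr0.
pose K := (C t) ^t* - Qa t *m B t.
have KE : K ^t* = C t - (B t) ^t* *m Qa t.
  by rewrite /K ctrmxB ctrmxM ctrmxK limit_herm.
have -> : - ((A t) ^t* *m Qa t) - Qa t *m A t - ric_deriv t = K *m symDinv t *m K ^t*.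
  have := riccati_alg (A t) (Qa t) (B t) (C t) (symDinv_herm t).
  rewrite -/(hamF t) -/(hamG t) -/(hamS t) -/(ric_deriv t) -KE -/K.
  move: (K *m _ *m _) (ric_deriv t) (_ *m Qa t) (Qa t *m _) => M1 M2 M3 M4 M0.
  by rewrite -[RHS]subr0 -M0; apply/matrixP => i j; rewrite !mxE; ring.
rewrite -KE -/K -/(symD t) (kyp_alg K (symDinv_herm t) W1); apply/psdP; split.
  by rewrite !ctrmxM ctrmxK symD_herm mulmxA.
move=> x; set N := row_mx _ _.
have -> : qf (N ^t* *m symD t *m N) x = qf (symD t) (N *m x) by rewrite /qf ctrmxM !mulmxA.
exact: Wpos.
Qed.

(** Every competitor ends before some [tau k], whose form lies below the limit; conversely the
    optimal competitors for the horizons [tau k] have values that tend to the limit. *)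
Lemma limit_available_storage t x : T t ->
  available_storage T A B C D t x = (2^-1 * qf (Qa t) x)%:E.
Proof.
move=> Tt; apply/le_anti/andP; split.
  apply: ge_ereal_sup => _ [t1 [z [u [y [Tt1 tt1 /sioLP h <- ->]]]]].
  rewrite lee_fin; have [k t1k] := ctau Tt1.
  have := horizon_bound (Ttau k) (hQk k) Tt Tt1 tt1 t1k h.
  have := limit_qf_ge (z t) Tt (le_trans tt1 t1k); lra.
have [k0 k0t] := ctau Tt.
have lb k : (k0 <= k)%N -> ((2^-1 * qf (Qk k t) x)%:E <= available_storage T A B C D t x)%E.
  move=> k0k; have tk := le_trans k0t (mtau k0k).
  have [z [u [y [h zt E]]]] := horizon_opt (Ttau k) (hQk k) x Tt tk.
  apply: ereal_sup_ubound; exists (tau k), z, u, y; split => //; first exact/sioLP.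
  by congr EFin; rewrite -E; field.
have cv : 2^-1 * qf (Qk k t) x @[k --> \oo] --> 2^-1 * qf (Qa t) x.
  by apply: cvgMr; exact: mcvg_qf (cQa Tt).
(* The supremum is an extended real: plus infinity satisfies the lower bound trivially, and minus
   infinity is excluded by a single competitor. *)
case E : (available_storage T A B C D t x) => [r| |]; last 2 first.
- by rewrite leey.
- by have := lb k0 (leqnn _); rewrite E.
rewrite lee_fin -(cvg_lim _ cv) //; apply: limr_le.
  by apply/cvg_ex; eexists; exact: cv.
by exists k0 => // k /= /lb; rewrite E lee_fin.
Qed.

End Limit.
End Passive.

(** * Transfer of the hypotheses and conclusion *)

Lemma Lploc_mxLpT1 (R : realType) (T : set R) k l (M : R -> 'M[R[i]]_(k, l)) :
  open T -> is_interval T -> Lploc_mx 1 T M -> mLpT E1 T M.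
Proof.
move=> oT iT lM a b Ta Tb ab i j; have [lr li] := lM i j.
by split; [exact: (LplocP1 _ oT iT).1 lr _ _ Ta Tb ab
         | exact: (LplocP1 _ oT iT).1 li _ _ Ta Tb ab].
Qed.

Lemma Lploc_mxLpToo (R : realType) (T : set R) k l (M : R -> 'M[R[i]]_(k, l)) :
  open T -> is_interval T -> Lploc_mx +oo%E T M -> mLpT Eoo T M.
Proof.
move=> oT iT lM a b Ta Tb ab i j; have [lr li] := lM i j.
by split; [exact: (Lploc_Loo oT iT Ta Tb lr) | exact: (Lploc_Loo oT iT Ta Tb li)].
Qed.

Unset Implicit Arguments.

Theorem theorem5p14 (R : realType) (n m : nat) (T : set R)
    (A : R -> 'M[R[i]]_(n, n)) (B : R -> 'M[R[i]]_(n, m))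
    (C : R -> 'M[R[i]]_(m, n)) (D : R -> 'M[R[i]]_(m, m))
    (oT : open T) (iT : is_interval T)
    (hA : Lploc_mx 1 T A) (hB : Lploc_mx 2%:E T B)
    (hC : Lploc_mx 2%:E T C) (hD : Lploc_mx +oo%E T D)
    (hpassive : passive T A B C D)
    (hcoercive : forall t0 t1 : R, T t0 -> T t1 -> t0 <= t1 ->
       exists c : R, 0 < c /\
         {ae (@lebesgue_measure R), forall t : R, `[t0, t1]%classic t ->
            loewner_ge (D t + (D t) ^t*) (c%:C)%:M}) :
  exists Qa : R -> 'M[R[i]]_n,
    [/\ W11loc_mx T Qa,
        (forall t : R, T t -> psd (Qa t)),
        riccati_solution T A B C D Qa,
        (forall (t : R) (x : 'cV[R[i]]_n), T t ->
           available_storage T A B C D t x =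
           (2^-1 * complex.Re ((x ^t* *m Qa t *m x) 0 0))%:E)
      & kyp_solution T A B C D Qa].

Proof.
have lA := Lploc_mxLpT1 oT iT hA; have lD := Lploc_mxLpToo oT iT hD.
have lB := (Lploc2_mxP oT iT B).1 hB; have lC := (Lploc2_mxP oT iT C).1 hC.
have [V sV] := hpassive.
(* An open interval may be empty here, while a cofinal sequence needs a point to start from. *)
have [T0|[t0 Tt0]] : T = set0 \/ T !=set0.
  by have [->|/set0P] := eqVneq T set0; [left | right].
  have vac t : ~ T t by rewrite T0.
  have W0 : W11loc_deriv_mx T (fun=> 0 : 'M[R[i]]_n) (fun=> 0).
    by apply/(W11loc_mxP oT iT) => a b /vac.
  exists (fun=> 0); split.
  - by exists (fun=> 0).
  - by move=> t /vac.
  - by exists (fun=> 0); split => //; apply: aeW => t /vac.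
  - by move=> t x /vac.
  - by exists (fun=> 0); split => //; apply: aeW => t /vac.
have [tau [Ttau mtau ctau]] := cofinal_seq oT Tt0.
have /choice[Qk hQk] k : exists Q, horizon_mx T A B C D (tau k) Q.
  exact: (horizon_mx_exists oT iT lA lB lC lD hcoercive sV (Ttau k)).
(* Limits are chosen pointwise, with value 0 outside [T]; regularity in time follows afterwards from
   [limit_ham]. *)
have /choice[Qa cQa] t : exists M, T t -> mcvg (fun k => Qk k t) M.
  have [Tt|nTt] := pselect (T t); last by exists 0.
  have [M cM] := horizon_limit oT iT lA lB lC lD hcoercive sV Ttau mtau ctau hQk Tt.
  by exists M.
have hric := limit_riccati oT iT lA lB lC lD hcoercive mtau ctau hQk cQa.
exists Qa; split => //.
- by have [dQ [pQ _]] := hric; exists dQ.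
- move=> t Tt; apply/psdP; split.
    exact: (limit_herm Ttau mtau ctau hQk cQa Tt).
  move=> v; exact: (limit_ge0 oT iT lA lB lC lD hcoercive sV Ttau mtau ctau hQk cQa v Tt).
- move=> t x Tt.
  exact: (limit_available_storage oT iT lA lB lC lD hcoercive sV Ttau mtau ctau hQk cQa x Tt).
- exact: (limit_kyp oT iT lA lB lC lD hcoercive Ttau mtau ctau hQk cQa).
Qed.
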